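(* Suppose the structural, smoothness and noise assumptions stated in the context hold, and that $\operatorname{dom} f$ and $\operatorname{dom} g$ are compact. Let $\epsilon>0$, $\mu_x=\gamma$, $\theta=1$, $\lambda=\frac{1}{2\gamma}$, and let $$\tau=\min\Big\{\tfrac{1}{L_{yx}+L_{xx}+2\gamma},\ \tfrac{1}{L_{xy}},\ \tfrac{1}{480\gamma}\cdot\tfrac{\epsilon^2}{\delta_x^2}\Big\},\qquad \sigma=\min\Big\{\tfrac{1}{L_{yx}+2L_{yy}},\ \tfrac{1}{4512\gamma}\cdot\tfrac{\epsilon^2}{\delta_y^2}\Big\},\qquad N=\Big\lceil 33\max\Big\{\tfrac{4}{\gamma\tau},\tfrac{8}{\mu_y\sigma}\Big\}\Big\rceil .$$ Let $(x_0^0,y_0^0)\in\operatorname{dom} f\times\operatorname{dom} g$, and let $\{x_0^t\}_{t\ge 0}$ be generated by SAPD+ (without variance reduction) with parameters $\tau,\sigma,\theta,\mu_x$ and $N_t=N$ for all $t$. Then $$\frac{1}{T+1}\sum_{t=0}^{T}\mathbb{E}\big[\|\nabla\phi_\lambda(x_0^t)\|^2\big]\le \epsilon^2\qquad\text{for all } T\ge 96\,\mathcal{G}(x_0^0,y_0^0)\cdot\frac{\gamma}{\epsilon^2}+1,$$ and computing a point $x_\epsilon$ such that $\mathbb{E}[\|\nabla\phi_\lambda(x_\epsilon)\|]\le\epsilon$ requires $C_\epsilon$ stochastic first-order oracle calls in total, where $$C_\epsilon=\mathcal{O}\Big(\Big(\tfrac{\max\{L_{xx},L_{yx},L_{xy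}\}}{\gamma}+\tfrac{\max\{L_{yy},L_{yx}\}}{\mu_y}\Big)\gamma\,\epsilon^{-2}+\Big(\tfrac{\delta_x^2}{\gamma}+\tfrac{\delta_y^2}{\mu_y}\Big)\gamma^2\,\epsilon^{-4}\Big)\,\mathcal{G}(x_0^0,y_0^0).$$
   Context: Let $\mathcal X=\mathbb R^n$, $\mathcal Y=\mathbb R^m$ with Euclidean norm $\|\cdot\|$, and $\mathrm{prox}_{\lambda h}(x)=\arg\min_w\{h(w)+\frac{1}{2\lambda}\|w-x\|^2\}$. Consider $\min_{x\in\mathcal X}\max_{y\in\mathcal Y}\mathcal L(x,y)$ with $\mathcal L(x,y)=f(x)+\Phi(x,y)-g(y)$. Structural assumption: $f:\mathcal X\to\mathbb R\cup\{+\infty\}$, $g:\mathcal Y\to\mathbb R\cup\{+\infty\}$ are proper, closed, convex; $\Phi:\mathcal X\times\mathcal Y\to\mathbb R$ is such that (i) for any $y\in\operatorname{dom} g$, $\Phi(\cdot,y)$ is $\gamma$-weakly convex (i.e. $x\mapsto\Phi(x,y)+\frac{\gamma}{2}\|x\|^2$ is convex), with $\gamma>0$, and bounded from below; (ii) for any $x\in\operatorname{dom} f$, $\Phi(x,\cdot)$ is $\mu_y$-strongly concave with $\mu_y>0$; (iii) $\Phi$ is differentiable on an open set containing $\operatorname{dom} f\times\operatorname{dom} g$. Smoothness assumption: there are $L_{xx},L_{yy}\ge0$, $L_{xy},L_{yx}>0$ with $\|\nabla_x\Phi(x,y)-\nabla_x\Phi(\bar x,\bar y)\|\le L_{xx}\|x-\bar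 x\|+L_{xy}\|y-\bar y\|$ and $\|\nabla_y\Phi(x,y)-\nabla_y\Phi(\bar x,\bar y)\|\le L_{yx}\|x-\bar x\|+L_{yy}\|y-\bar y\|$ for all $x,\bar x\in\operatorname{dom} f$, $y,\bar y\in\operatorname{dom} g$. Since $\Phi(\cdot,y)$ is then $L_{xx}$-weakly convex, $\gamma\le L_{xx}$ by convention. SAPD$(\tau,\sigma,\theta,\mu_x,x_0,y_0,N)$: set $\tilde q_0=0$; for $k=0,\dots,N-1$: $\tilde s_k=\tilde\nabla_y\Phi(x_k,y_k;\omega_k^y)+\theta\tilde q_k$; $y_{k+1}=\mathrm{prox}_{\sigma g}(y_k+\sigma\tilde s_k)$; $x_{k+1}=\mathrm{prox}_{\tau f}\big(x_k-\tau[\tilde\nabla_x\Phi(x_k,y_{k+1};\omega_k^x)+(\mu_x+\gamma)(x_k-x_0)]\big)$; $\tilde q_{k+1}=\tilde\nabla_y\Phi(x_{k+1},y_{k+1};\omega_{k+1}^y)-\tilde\nabla_y\Phi(x_k,y_k;\omega_k^y)$. Output $\frac1N\sum_{k=0}^{N-1}(x_{k+1},y_{k+1})$. Here $\tilde\nabla_x\Phi(\cdot,\cdot;\omega)$, $\tilde\nabla_y\Phi(\cdot,\cdot;\omega)$ are stochastic gradient estimates; one evaluation is one stochastic first-order oracle call. (SAPD targets $\min_x\max_y\mathcal L(x,y)+\frac{\mu_x+\gamma}{2}\|x-x_0\|^2$.) Noise assumption: for arbitrary starting point and $\mu_x>0$, there are $\delta_x,\delta_y\ge0$ such that along SAPD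 iterates, for all $k\ge0$: $\mathbb E[\tilde\nabla_x\Phi(x_k,y_{k+1};\omega_k^x)\mid x_k,y_{k+1}]=\nabla_x\Phi(x_k,y_{k+1})$; $\mathbb E[\tilde\nabla_y\Phi(x_k,y_k;\omega_k^y)\mid x_k,y_k]=\nabla_y\Phi(x_k,y_k)$; $\mathbb E[\|\tilde\nabla_x\Phi(x_k,y_{k+1};\omega_k^x)-\nabla_x\Phi(x_k,y_{k+1})\|^2\mid x_k,y_{k+1}]\le\delta_x^2$; $\mathbb E[\|\tilde\nabla_y\Phi(x_k,y_k;\omega_k^y)-\nabla_y\Phi(x_k,y_k)\|^2\mid x_k,y_k]\le\delta_y^2$. SAPD+ (without variance reduction): for $t=0,1,\dots,T$, $(x_0^{t+1},y_0^{t+1})=\mathrm{SAPD}(\tau,\sigma,\theta,\mu_x,x_0^t,y_0^t,N_t)$. Notation: $\phi(x)=\max_{y\in\mathcal Y}\mathcal L(x,y)$, which is $\gamma$-weakly convex. For $\lambda\in(0,\gamma^{-1})$ its Moreau envelope is $\phi_\lambda(x)=\min_{w}\phi(w)+\frac1{2\lambda}\|w-x\|^2$, which is differentiable with $\nabla\phi_\lambda(x)=\lambda^{-1}(x-\mathrm{prox}_{\lambda\phi}(x))$. $\mathcal G(x,y)=\sup_{y'\in\mathcal Y}\mathcal L(x,y')-\inf_{x'\in\mathcal X}\mathcal L(x',y)$. The terms $\epsilon^2/\delta_x^2$, $\epsilon^2/\delta_y^2$ are $+\infty$ if $\delta_x=0$, $\delta_y=0$. $\mathcal O(\cdot)$ is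 understood as $\epsilon\to0$ with an absolute hidden constant.
   Formalization: The noise assumption (unbiasedness and variance bounds) is conditioned on all oracle answers received before the query, not only on the query point (x_k,y_{k+1}) or (x_k,y_k); with arbitrarily dependent samples, conditioning on the query point alone makes the claim false. *)

(* Defs.v *)
From HB Require Import structures.
From mathcomp Require Import all_boot all_order all_algebra.
From mathcomp Require Import all_classical all_reals all_analysis.
Set Implicit Arguments.
Unset Strict Implicit.
Unset Printing Implicit Defensive.
Import Order.TTheory GRing.Theory Num.Theory.
Import numFieldNormedType.Exports.
Local Open Scope classical_set_scope.
Local Open Scope ring_scope.

(* The library norm of 'rV[R]_n is the sup norm; it is used only through the
   topology and the differentiable structure, which do not depend on the choice
   of the norm. *)
Definition enorm (R : realType) (n : nat) (x : 'rV[R]_n) : R :=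
  Num.sqrt (\sum_(i < n) x 0 i ^+ 2).

Definition grad (R : realType) (n : nat) (h : 'rV[R]_n -> R) (x : 'rV[R]_n)
  : 'rV[R]_n := \row_(i < n) 'D_(delta_mx 0 i) h x.

Definition grad_x (R : realType) (n m : nat) (Phi : 'rV[R]_n -> 'rV[R]_m -> R)
  (x : 'rV[R]_n) (y : 'rV[R]_m) : 'rV[R]_n := grad (Phi ^~ y) x.

Definition grad_y (R : realType) (n m : nat) (Phi : 'rV[R]_n -> 'rV[R]_m -> R)
  (x : 'rV[R]_n) (y : 'rV[R]_m) : 'rV[R]_m := grad (Phi x) y.

Section convex_analysis.
Local Open Scope ereal_scope.

Definition edom (R : realType) (n : nat) (h : 'rV[R]_n -> \bar R)
  : set 'rV[R]_n := [set x | h x < +oo].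

Definition proper (R : realType) (n : nat) (h : 'rV[R]_n -> \bar R) : Prop :=
  (forall x, -oo < h x) /\ edom h !=set0.

(* For t = 0 or t = 1 the convention 0 * +oo = 0 makes the inequality trivial. *)
Definition econvex (R : realType) (n : nat) (h : 'rV[R]_n -> \bar R) : Prop :=
  forall (x y : 'rV[R]_n) (t : R), (0 <= t <= 1)%R ->
    h (t *: x + (1 - t) *: y)%R <= t%:E * h x + (1 - t)%:E * h y.

Definition proper_closed_convex (R : realType) (n : nat)
    (h : 'rV[R]_n -> \bar R) : Prop :=
  [/\ proper h, lower_semicontinuous h & econvex h].

Definition weakly_convex (R : realType) (n : nat) (gamma : R)
    (h : 'rV[R]_n -> R) : Prop :=
  convex_function setT (fun x : 'rV[R]_n => h x + gamma / 2 * enorm x ^+ 2)%R.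

Definition strongly_concave (R : realType) (n : nat) (mu : R)
    (h : 'rV[R]_n -> R) : Prop :=
  convex_function setT (fun y : 'rV[R]_n => - h y - mu / 2 * enorm y ^+ 2)%R.

Definition prox_obj (R : realType) (n : nat) (lambda : R)
    (h : 'rV[R]_n -> \bar R) (x w : 'rV[R]_n) : \bar R :=
  h w + ((2 * lambda)^-1 * enorm (w - x) ^+ 2)%:E.

(* The minimizer is unique in all uses below; the default value 0 is then
   irrelevant. *)
Definition prox (R : realType) (n : nat) (lambda : R)
    (h : 'rV[R]_n -> \bar R) (x : 'rV[R]_n) : 'rV[R]_n :=
  xget 0%R [set w | forall w', prox_obj lambda h x w <= prox_obj lambda h x w'].

Definition moreau (R : realType) (n : nat) (lambda : R)
    (h : 'rV[R]_n -> \bar R) (x : 'rV[R]_n) : \bar R :=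
  ereal_inf (range (prox_obj lambda h x)).

Definition grad_moreau (R : realType) (n : nat) (lambda : R)
    (h : 'rV[R]_n -> \bar R) (x : 'rV[R]_n) : 'rV[R]_n :=
  grad (fun u => fine (moreau lambda h u)) x.

(* In \bar R one has +oo - +oo = -oo; this value (x and y both outside the
   domains) affects neither the supremum over y nor, for y in edom g, the
   infimum over x. *)
Definition lagr (R : realType) (n m : nat) (f : 'rV[R]_n -> \bar R)
    (g : 'rV[R]_m -> \bar R) (Phi : 'rV[R]_n -> 'rV[R]_m -> R)
    (x : 'rV[R]_n) (y : 'rV[R]_m) : \bar R :=
  f x + (Phi x y)%:E - g y.

Definition primal (R : realType) (n m : nat) (f : 'rV[R]_n -> \bar R)
    (g : 'rV[R]_m -> \bar R) (Phi : 'rV[R]_n -> 'rV[R]_m -> R)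
    (x : 'rV[R]_n) : \bar R :=
  ereal_sup (range (lagr f g Phi x)).

Definition gap (R : realType) (n m : nat) (f : 'rV[R]_n -> \bar R)
    (g : 'rV[R]_m -> \bar R) (Phi : 'rV[R]_n -> 'rV[R]_m -> R)
    (x : 'rV[R]_n) (y : 'rV[R]_m) : \bar R :=
  ereal_sup (range (lagr f g Phi x)) - ereal_inf (range ((lagr f g Phi) ^~ y)).

End convex_analysis.

Definition structural_assumption (R : realType) (n m : nat)
    (f : 'rV[R]_n -> \bar R) (g : 'rV[R]_m -> \bar R)
    (Phi : 'rV[R]_n -> 'rV[R]_m -> R) (gamma mu_y : R) : Prop :=
  [/\ proper_closed_convex f /\ proper_closed_convex g,
      0 < gamma /\ (forall y, edom g y ->
        weakly_convex gamma (Phi ^~ y) /\ exists b, forall x, b <= Phi x y),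
      0 < mu_y /\ (forall x, edom f x -> strongly_concave mu_y (Phi x)) &
      exists U : set ('rV[R]_n * 'rV[R]_m),
        [/\ open U, edom f `*` edom g `<=` U &
            forall z, U z ->
              differentiable (fun u : 'rV[R]_n * 'rV[R]_m => Phi u.1 u.2 : R^o) z]].

Definition smoothness_assumption (R : realType) (n m : nat)
    (f : 'rV[R]_n -> \bar R) (g : 'rV[R]_m -> \bar R)
    (Phi : 'rV[R]_n -> 'rV[R]_m -> R) (Lxx Lxy Lyx Lyy : R) : Prop :=
  [/\ 0 <= Lxx /\ 0 <= Lyy, 0 < Lxy /\ 0 < Lyx,
      forall x x' y y', edom f x -> edom f x' -> edom g y -> edom g y' ->
        enorm (grad_x Phi x y - grad_x Phi x' y') <=
          Lxx * enorm (x - x') + Lxy * enorm (y - y') &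
      forall x x' y y', edom f x -> edom f x' -> edom g y -> edom g y' ->
        enorm (grad_y Phi x y - grad_y Phi x' y') <=
          Lyx * enorm (x - x') + Lyy * enorm (y - y')].

Record sapd_params (R : realType) := SapdParams {
  tau : R;
  sigma : R;
  theta : R;
  mu_x : R;
  iters : nat }.

Section sapd.
Context (R : realType) (n m : nat).
Context (f : 'rV[R]_n -> \bar R) (g : 'rV[R]_m -> \bar R) (gamma : R).
Context (p : sapd_params R).

(* qx k and qy k answer the oracle queries that use the samples omega^x_k and
   omega^y_k; the state is (x_k, y_k, q_k). *)
Fixpoint sapd_state (x0 : 'rV[R]_n) (y0 : 'rV[R]_m)
    (qx : nat -> 'rV[R]_n -> 'rV[R]_m -> 'rV[R]_n)
    (qy : nat -> 'rV[R]_n -> 'rV[R]_m -> 'rV[R]_m) (k : nat)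
    : 'rV[R]_n * 'rV[R]_m * 'rV[R]_m :=
  if k is j.+1 then
    let: (x, y, q) := sapd_state x0 y0 qx qy j in
    let s := qy j x y + theta p *: q in
    let y' := prox (sigma p) g (y + sigma p *: s) in
    let x' := prox (tau p) f
      (x - tau p *: (qx j x y' + (mu_x p + gamma) *: (x - x0))) in
    (x', y', qy j.+1 x' y' - qy j x y)
  else (x0, y0, 0).

Definition sapd_out (x0 : 'rV[R]_n) (y0 : 'rV[R]_m)
    (qx : nat -> 'rV[R]_n -> 'rV[R]_m -> 'rV[R]_n)
    (qy : nat -> 'rV[R]_n -> 'rV[R]_m -> 'rV[R]_m) : 'rV[R]_n * 'rV[R]_m :=
  ((iters p)%:R^-1 *: \sum_(k < iters p) (sapd_state x0 y0 qx qy k.+1).1.1,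
   (iters p)%:R^-1 *: \sum_(k < iters p) (sapd_state x0 y0 qx qy k.+1).1.2).

End sapd.

(* omega_x t k and omega_y t k are the k-th samples of the t-th call to SAPD. *)
Record sfo (R : realType) (n m : nat) (Om : Type) := Sfo {
  Xi_x : Type;
  Xi_y : Type;
  est_x : 'rV[R]_n -> 'rV[R]_m -> Xi_x -> 'rV[R]_n;
  est_y : 'rV[R]_n -> 'rV[R]_m -> Xi_y -> 'rV[R]_m;
  omega_x : nat -> nat -> Om -> Xi_x;
  omega_y : nat -> nat -> Om -> Xi_y }.

Section sapd_plus.
Context (R : realType) (n m : nat).
Context (f : 'rV[R]_n -> \bar R) (g : 'rV[R]_m -> \bar R) (gamma : R).
Context (p : sapd_params R) (Om : Type) (Orc : sfo R n m Om).
Context (x0 : 'rV[R]_n) (y0 : 'rV[R]_m).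

Definition query_x (w : Om) (t k : nat) (x : 'rV[R]_n) (y : 'rV[R]_m)
  : 'rV[R]_n := est_x x y (omega_x Orc t k w).

Definition query_y (w : Om) (t k : nat) (x : 'rV[R]_n) (y : 'rV[R]_m)
  : 'rV[R]_m := est_y x y (omega_y Orc t k w).

(* The pair (x_0^t, y_0^t). *)
Fixpoint sapdp_start (t : nat) (w : Om) : 'rV[R]_n * 'rV[R]_m :=
  if t is s.+1 then
    let: (x, y) := sapdp_start s w in
    sapd_out f g gamma p x y (query_x w s) (query_y w s)
  else (x0, y0).

Definition iter_x (t k : nat) (w : Om) : 'rV[R]_n :=
  (sapd_state f g gamma p (sapdp_start t w).1 (sapdp_start t w).2
     (query_x w t) (query_y w t) k).1.1.

Definition iter_y (t k : nat) (w : Om) : 'rV[R]_m :=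
  (sapd_state f g gamma p (sapdp_start t w).1 (sapdp_start t w).2
     (query_x w t) (query_y w t) k).1.2.

Definition answer_x (t k : nat) (w : Om) : 'rV[R]_n :=
  query_x w t k (iter_x t k w) (iter_y t k.+1 w).

Definition answer_y (t k : nat) (w : Om) : 'rV[R]_m :=
  query_y w t k (iter_x t k w) (iter_y t k w).

(* Within an iteration the y-answer comes first.  (s, j) precedes (t, k) when
   s < t and j is one of the iterations actually performed, or s = t, j < k. *)
Definition before (t k s j : nat) : bool :=
  ((s < t) && (j < iters p) || (s == t) && (j < k))%N.

(* Coordinates of the answers received before the y-query, resp. the x-query,
   of iteration k of the t-th call. *)
Definition past_y (t k : nat) : set (Om -> R) :=
  [set X | exists s j, before t k s j /\
     ((exists i, X = fun w => answer_x s j w 0 i) \/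
      (exists i, X = fun w => answer_y s j w 0 i))].

Definition past_x (t k : nat) : set (Om -> R) :=
  past_y t k `|` [set X | exists i, X = fun w => answer_y t k w 0 i].

End sapd_plus.

(* Each SAPD call makes iters x-queries and iters + 1 y-queries; t calls are
   needed to compute (x_0^s, y_0^s) for all s <= t. *)
Definition oracle_calls (N t : nat) : nat := (t * (N + N.+1))%N.

Definition sigma_gen (R : realType) (Om : Type) (F : set (Om -> R))
  : set (set Om) :=
  <<s \bigcup_(X in F) preimage_set_system setT X measurable >>.

Section conditional_expectation.
Context (R : realType) (d : measure_display) (Om : measurableType d).
Context (P : probability Om R).
Local Open Scope ereal_scope.

(* Z is a version of E[X | G]. *)
Definition is_cond_exp (G : set (set Om)) (X Z : Om -> R) : Prop :=
  [/\ P.-integrable setT (EFin \o X), P.-integrable setT (EFin \o Z),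
      preimage_set_system setT Z measurable `<=` G &
      forall A, G A -> \int[P]_(w in A) (X w)%:E = \int[P]_(w in A) (Z w)%:E].

Definition cond_mean (n : nat) (G : set (set Om)) (X Z : Om -> 'rV[R]_n)
  : Prop := forall i, is_cond_exp G (fun w => X w 0%R i) (fun w => Z w 0%R i).

Definition cond_second_moment_le (n : nat) (G : set (set Om))
    (X : Om -> 'rV[R]_n) (c : R) : Prop :=
  exists2 V : Om -> R, is_cond_exp G (fun w => enorm (X w) ^+ 2)%R V &
    {ae P, forall w, (V w <= c)%R}.

End conditional_expectation.

(* The conditioning is on everything observed before the query, of which the
   query point is a function.  Conditioning on the query point alone is not
   enough: the center x_0^t, which is random for t > 0, and the momentum q_k are
   not functions of it. *)
Definition noise_assumption (R : realType) (n m : nat)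
    (f : 'rV[R]_n -> \bar R) (g : 'rV[R]_m -> \bar R)
    (Phi : 'rV[R]_n -> 'rV[R]_m -> R) (gamma : R)
    (d : measure_display) (Om : measurableType d) (P : probability Om R)
    (Orc : sfo R n m Om) (mux : R) (x0 : 'rV[R]_n) (y0 : 'rV[R]_m)
    (delta_x delta_y : R) : Prop :=
  forall p : sapd_params R,
    0 < tau p -> 0 < sigma p -> 0 <= theta p -> mu_x p = mux ->
    (0 < iters p)%N ->
  forall t k : nat, (k < iters p)%N ->
    let Gx := sigma_gen (past_x f g gamma p Orc x0 y0 t k) in
    let Gy := sigma_gen (past_y f g gamma p Orc x0 y0 t k) in
    let x := iter_x f g gamma p Orc x0 y0 t k in
    let y := iter_y f g gamma p Orc x0 y0 t k in
    let y' := iter_y f g gamma p Orc x0 y0 t k.+1 in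
    let ax := answer_x f g gamma p Orc x0 y0 t k in
    let ay := answer_y f g gamma p Orc x0 y0 t k in
    [/\ cond_mean P Gx ax (fun w => grad_x Phi (x w) (y' w)),
        cond_mean P Gy ay (fun w => grad_y Phi (x w) (y w)),
        cond_second_moment_le P Gx
          (fun w => ax w - grad_x Phi (x w) (y' w)) (delta_x ^+ 2) &
        cond_second_moment_le P Gy
          (fun w => ay w - grad_y Phi (x w) (y w)) (delta_y ^+ 2)].

Definition noise_ratio (R : realType) (eps delta : R) : \bar R :=
  if delta == 0 then +oo%E else (eps ^+ 2 / delta ^+ 2)%:E.

Definition sapdp_params (R : realType)
    (gamma mu_y Lxx Lxy Lyx Lyy delta_x delta_y eps : R) : sapd_params R :=
  let ta := fine (Order.min (1 / (Lyx + Lxx + 2 * gamma))%:E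
    (Order.min (1 / Lxy)%:E ((1 / (480 * gamma))%:E * noise_ratio eps delta_x)))%E in
  let si := fine (Order.min (1 / (Lyx + 2 * Lyy))%:E
    ((1 / (4512 * gamma))%:E * noise_ratio eps delta_y))%E in
  {| tau := ta; sigma := si; theta := 1; mu_x := gamma;
     iters := `|Num.ceil
       (33 * Num.max (4 / (gamma * ta)) (8 / (mu_y * si)))|%N |}.

(* Main.v *)
(** Each call of SAPD is an inexact proximal point step on the primal function
    [phi], so that the prox of [phi] at the center [z] of the call, and hence the
    gradient of the Moreau envelope, is controlled by the decrease of [phi].

    Let [l] be the Lagrangian, [psi z y] the minimum over [x] of
    [l x y + gamma |x - z|^2], and let a call lead from [(z, y)] to [(z', y')].
    Set [A = phi z - psi z y] and
    [B = phi z' + gamma |z' - z|^2 - psi z y'], the duality gaps of the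
    subproblem centered at [z] at the two ends of the call.
    - Summing the two prox inequalities over the iterations bounds [B] by
      squared distances of [(z, y)] to the best responses to [(z', y')], plus
      noise.  Strong convexity and weak duality bound these distances by
      [A + B], and [N] is so large that [43 B <= A + 44 V] with a noise term [V].
    - With [Delta = z' - z] and [D] the gap between [phi z] and its Moreau
      envelope, [phi z' + gamma |Delta|^2 <= phi z - D + B], and the next [A] is
      at most [2 B + 8 gamma |Delta|^2].
    Summing over the calls gives [41 sum D <= 42 G + 44 sum V] along every path,
    where [G] is the initial duality gap, and [D] dominates the squared gradient
    of the Moreau envelope divided by [8 gamma].

    Only [V] has to be averaged.  It is a sum of products of the noise with
    iterates; each iterate is compared with the one that exact gradients would
    have produced.  The latter is known before the query, so its product with
    the noise has mean zero, and the difference is a multiple of the noise. *)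
Require Import Defs.
From HB Require Import structures.
From mathcomp Require Import all_boot all_order all_algebra.
From mathcomp Require Import all_classical all_reals all_analysis.
From mathcomp Require Import measurable_realfun ring lra.
Set Implicit Arguments.
Unset Strict Implicit.
Unset Printing Implicit Defensive.
Import Order.TTheory GRing.Theory Num.Theory.
Import numFieldNormedType.Exports.
Local Open Scope classical_set_scope.
Local Open Scope ring_scope.

(** * Euclidean inner product *)

(** The points at which the ergodic inequality becomes a duality gap are the best responses to the
    output of a call. They depend on all the noise of that call and nothing is known about their
    measurability, so no expectation is taken while they are present: Young's inequality moves them
    into the distance terms, and a noise term free of them remains. Compactness of the domains
    enters twice: best responses and proximal points exist, and test vectors are bounded, so that
    their products with the noise are integrable without any moment bound on the iterates. The
    constants 43 and 44 come from [N]: 33 times 4 and 33 times 8 are 132 and 264, and 2/132 + 2/264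
    = 1/44. Optimality conditions are kept in three-point form, without subgradients, so that each
    estimate is an inequality between inner products. *)

Definition dot (R : realType) (n : nat) (u v : 'rV[R]_n) : R :=
  \sum_(i < n) u 0 i * v 0 i.

Section euclid.
Context (R : realType) (n : nat).
Implicit Types (u v w x y z : 'rV[R]_n) (a : R).

Lemma dotC u v : dot u v = dot v u.
Proof. by apply: eq_bigr => i _; rewrite mulrC. Qed.

Lemma dotDl u v w : dot (u + v) w = dot u w + dot v w.
Proof.
by rewrite /dot -big_split; apply: eq_bigr => i _; rewrite mxE mulrDl.
Qed.

Lemma dotZl a u v : dot (a *: u) v = a * dot u v.
Proof. by rewrite /dot mulr_sumr; apply: eq_bigr => i _; rewrite mxE mulrA. Qed.

Lemma dotNl u v : dot (- u) v = - dot u v.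
Proof. by rewrite -scaleN1r dotZl mulN1r. Qed.

Lemma dotDr u v w : dot u (v + w) = dot u v + dot u w.
Proof. by rewrite dotC dotDl !(dotC u). Qed.

Lemma dotZr a u v : dot u (a *: v) = a * dot u v.
Proof. by rewrite dotC dotZl dotC. Qed.

Lemma dotNr u v : dot u (- v) = - dot u v.
Proof. by rewrite dotC dotNl dotC. Qed.

Lemma dot0l v : dot 0 v = 0.
Proof. by rewrite -(scale0r 0) dotZl mul0r. Qed.

(** Once symmetric products are oriented by explicit uses of [dotC], expanding by these rules leaves
    inner products as atoms, and a vector inequality becomes linear arithmetic. *)
Definition dotE := (dotDl, dotDr, dotNl, dotNr, dotZl, dotZr).

Lemma dot_suml (I : Type) (r : seq I) (P : pred I) (F : I -> 'rV[R]_n) v :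
  dot (\sum_(i <- r | P i) F i) v = \sum_(i <- r | P i) dot (F i) v.
Proof.
by elim/big_rec2: _ => [|i a b _ <-]; rewrite ?dot0l ?dotDl.
Qed.

Lemma dot_ge0 u : 0 <= dot u u.
Proof. by apply: sumr_ge0 => i _; rewrite -expr2 sqr_ge0. Qed.

Lemma dot_eq0 u : (dot u u == 0) = (u == 0).
Proof.
apply/idP/eqP => [|->]; last by rewrite dot0l.
rewrite psumr_eq0 => [/allP h|i _]; last by rewrite -expr2 sqr_ge0.
apply/rowP => i; rewrite mxE; apply/eqP; rewrite -sqrf_eq0 expr2.
by apply: (implyP (h i _)); rewrite ?mem_index_enum.
Qed.

Lemma enorm_sqr u : enorm u ^+ 2 = dot u u.
Proof.
rewrite sqr_sqrtr; first by apply: eq_bigr => i _; rewrite expr2.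
by apply: sumr_ge0 => i _; rewrite sqr_ge0.
Qed.

Lemma enorm_ge0 u : 0 <= enorm u.
Proof. exact: sqrtr_ge0. Qed.

(** Cauchy-Schwarz: the square of [dot v v *: u - dot u v *: v] is [dot v v] times the Gram
    determinant of [u] and [v], which is therefore nonnegative. *)
Lemma dot_le_enorm u v : dot u v <= enorm u * enorm v.
Proof.
have [v0|v0] := eqVneq (dot v v) 0.
  move/eqP: v0; rewrite dot_eq0 => /eqP ->.
  by rewrite dotC dot0l mulr_ge0 ?enorm_ge0.
have vp : 0 < dot v v by rewrite lt_neqAle eq_sym v0 dot_ge0.
have := dot_ge0 (dot v v *: u - dot u v *: v).
rewrite !dotE (dotC v u) => h.
have {}h : 0 <= dot v v * (dot u u * dot v v - dot u v ^+ 2).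
  by apply: le_trans h _; rewrite le_eqVlt; apply/orP; left; apply/eqP; ring.
rewrite pmulr_rge0 // subr_ge0 -!enorm_sqr -exprMn in h.
have [d0|d0] := leP (dot u v) 0.
  by apply: le_trans d0 _; rewrite mulr_ge0 ?enorm_ge0.
by rewrite -ler_sqr ?nnegrE ?(ltW d0) // mulr_ge0 ?enorm_ge0.
Qed.

Lemma enorm_le a u : 0 <= a -> dot u u <= a ^+ 2 -> enorm u <= a.
Proof.
by move=> a0; rewrite -enorm_sqr ler_sqr // nnegrE ?enorm_ge0.
Qed.

Lemma enormD u v : enorm (u + v) <= enorm u + enorm v.
Proof.
apply: enorm_le; first by rewrite addr_ge0 ?enorm_ge0.
have := dot_le_enorm u v.
rewrite !dotE (dotC v u) -!enorm_sqr; nra.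
Qed.

Lemma enormZ a u : enorm (a *: u) = `|a| * enorm u.
Proof.
apply/eqP; rewrite -(@eqrXn2 _ 2) ?mulr_ge0 ?enorm_ge0 //.
by rewrite enorm_sqr exprMn enorm_sqr real_normK ?num_real // !dotE mulrA -expr2.
Qed.

Lemma enormN u : enorm (- u) = enorm u.
Proof. by rewrite -scaleN1r enormZ normrN1 mul1r. Qed.

Lemma enormB u v : enorm (u - v) = enorm (v - u).
Proof. by rewrite -enormN opprB. Qed.

Lemma enorm_le_add u v w : enorm (u - w) <= enorm (u - v) + enorm (v - w).
Proof. by rewrite -[u - w](subrKA v) enormD. Qed.

Lemma enorm_coord u i : `|u 0 i| <= enorm u.
Proof.
rewrite -ler_sqr ?nnegrE ?enorm_ge0 ?normr_ge0 // real_normK ?num_real //.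
rewrite enorm_sqr /dot (bigD1 i) //= -expr2 lerDl.
by apply: sumr_ge0 => j _; rewrite -expr2 sqr_ge0.
Qed.

Lemma enorm0 : enorm (0 : 'rV[R]_n) = 0.
Proof. by apply/eqP; rewrite -sqrf_eq0 enorm_sqr dot0l. Qed.

Lemma dot_delta_delta (i : 'I_n) : dot (delta_mx 0 i) (delta_mx 0 i : 'rV[R]_n) = 1.
Proof.
rewrite /dot (bigD1 i) //= big1 ?addr0 => [|j ji]; rewrite !mxE ?eqxx ?mulr1 //.
by rewrite (negbTE ji) mul0r.
Qed.

Lemma dot_delta u i : dot u (delta_mx 0 i) = u 0 i.
Proof.
rewrite /dot (bigD1 i) //= big1 ?addr0 => [|j ji]; rewrite !mxE ?eqxx ?mulr1 //.
by rewrite (negbTE ji) mulr0.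
Qed.

Lemma dot_young a u v : 0 < a ->
  dot u v <= a / 2 * dot u u + (2 * a)^-1 * dot v v.
Proof.
move=> a0; have := dot_ge0 (a *: u - v); rewrite !dotE (dotC v u) => h.
have -> : a / 2 * dot u u + (2 * a)^-1 * dot v v = dot u v +
   (2 * a)^-1 * (a * (a * dot u u) - a * dot u v - (a * dot u v - dot v v)).
  by field; rewrite gt_eqF.
by rewrite lerDl mulr_ge0 // ?invr_ge0; [lra|apply: le_trans h _; lra].
Qed.

Lemma continuous_dotB z : continuous (fun u : 'rV[R]_n => dot (u - z) (u - z)).
Proof.
rewrite /dot; apply: continuous_big => [|i _ u]; first exact: add_continuous.
have cv : {for u, continuous (fun v : 'rV[R]_n => (v - z) 0 i)}.
  apply: (@continuous_comp _ _ _ (fun v : 'rV[R]_n => v - z)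
    (fun v : 'rV[R]_n => v 0 i) u).
    by apply: continuousB; [exact: cvg_id|exact: cst_continuous].
  exact: coord_continuous.
exact: continuousM.
Qed.

Lemma continuous_enormB z : continuous (fun u : 'rV[R]_n => enorm (u - z)).
Proof.
have -> : (fun u : 'rV[R]_n => enorm (u - z)) =
    Num.sqrt \o fun u => dot (u - z) (u - z).
  by apply/funext => v /=; rewrite -enorm_sqr sqrtr_sqr ger0_norm ?enorm_ge0.
move=> u; apply: continuous_comp; first exact: continuous_dotB.
exact: sqrt_continuous.
Qed.

Lemma near_enorm z (e : R) : 0 < e -> \forall u \near z, enorm (u - z) < e.
Proof.
move=> e0; have c := @continuous_enormB z z; rewrite /continuous_at in c.
near=> u; suff : `|enorm (z - z) - enorm (u - z)| < e.
  by rewrite subrr enorm0 sub0r normrN ger0_norm ?enorm_ge0.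
near: u; exact: (cvgrPdist_lt _ _).1 c _ e0.
Unshelve. all: by end_near.
Qed.

End euclid.

(** * Strong convexity and minimizers *)

Definition cvx_set (R : realType) (n : nat) (C : set 'rV[R]_n) : Prop :=
  forall x y (t : R), C x -> C y -> 0 <= t <= 1 -> C (t *: x + (1 - t) *: y).

(** The modulus may be negative: [- gamma] encodes weak convexity, and strong concavity is a
    positive modulus of the opposite function. Moduli of summands simply add up. *)
Definition sconvex (R : realType) (n : nat) (C : set 'rV[R]_n) (mu : R)
    (h : 'rV[R]_n -> R) : Prop :=
  forall x y (t : R), C x -> C y -> 0 <= t <= 1 ->
    h (t *: x + (1 - t) *: y) <=
      t * h x + (1 - t) * h y - mu / 2 * (t * (1 - t)) * dot (x - y) (x - y).

(** Relative to [C], because it is applied to finite parts of extended-valued functions, which mean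
    nothing outside their domain. *)
Definition lsc_on (R : realType) (n : nat) (C : set 'rV[R]_n)
    (h : 'rV[R]_n -> R) : Prop :=
  forall x, C x -> forall e, 0 < e -> \forall z \near x, C z -> h x - e < h z.

Section convexity.
Context (R : realType).

Lemma le_small (a b c : R) :
  (forall t, 0 < t -> t < 1 -> a <= b + t * c) -> a <= b.
Proof.
move=> h; apply/ler_addgt0Pr => e e0.
have cp : 0 < 2 * (`|c| + e) by rewrite mulr_gt0 // ltr_wpDl.
have t0 : 0 < e / (2 * (`|c| + e)) by rewrite divr_gt0.
have t1 : e / (2 * (`|c| + e)) < 1.
  by rewrite ltr_pdivrMr // mul1r; have := normr_ge0 c; lra.
apply: le_trans (h _ t0 t1) _; rewrite lerD2l.
apply: le_trans (ler_norm _) _; rewrite normrM (gtr0_norm t0) mulrAC.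
by rewrite ler_pdivrMr // ler_pM2l //; lra.
Qed.

Context (n : nat).
Implicit Types (x y z : 'rV[R]_n) (C : set 'rV[R]_n) (h k : 'rV[R]_n -> R).

Lemma sconvexD C mu nu h k : sconvex C mu h -> sconvex C nu k ->
  sconvex C (mu + nu) (fun x => h x + k x).
Proof.
by move=> hc kc x y t Cx Cy t01; have := hc x y t Cx Cy t01;
   have := kc x y t Cx Cy t01; nra.
Qed.

Lemma sconvexZ C mu h (a : R) : 0 <= a -> sconvex C mu h ->
  sconvex C (a * mu) (fun x => a * h x).
Proof.
move=> a0 hc x y t Cx Cy t01.
have := ler_wpM2l a0 (hc x y t Cx Cy t01).
by move/le_trans; apply; lra.
Qed.

Lemma sconvex_cst C (a : R) : sconvex C 0 (fun=> a).
Proof. by move=> x y t _ _ _; rewrite mul0r mul0r mul0r; lra. Qed.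

Lemma sconvex_dot C z : sconvex C 2 (fun x => dot (x - z) (x - z)).
Proof.
move=> x y t _ _ _.
rewrite !dotE (dotC z x) (dotC z y) (dotC y x); lra.
Qed.

Lemma sconvexW C D mu nu h : C `<=` D -> nu <= mu ->
  sconvex D mu h -> sconvex C nu h.
Proof.
move=> CD le hc x y t Cx Cy t01.
have := hc x y t (CD _ Cx) (CD _ Cy) t01.
move/le_trans; apply; rewrite lerD2l lerN2.
by rewrite ler_wpM2r ?dot_ge0 // ler_wpM2r; lra || nra.
Qed.

(** Quadratic growth at a minimizer: compare [p] with the point at parameter [t] on the segment to
    [x], divide by [t], and let [t] tend to 0. *)
Lemma sconvex_min C mu h p : cvx_set C -> sconvex C mu h -> C p ->
  (forall x, C x -> h p <= h x) ->
  forall x, C x -> h p + mu / 2 * dot (x - p) (x - p) <= h x.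
Proof.
move=> cC hc Cp pmin x Cx; set d := dot _ _.
apply: (@le_small _ _ (mu / 2 * d)) => t t0 t1.
have t01 : 0 <= t <= 1 by rewrite !ltW.
have h1 := hc x p t Cx Cp t01.
have h2 := pmin _ (cC x p t Cx Cp t01).
have : t * (h p + mu / 2 * d) <= t * (h x + t * (mu / 2 * d)).
  by have := le_trans h2 h1; rewrite -/d; nra.
by rewrite ler_pM2l.
Qed.

Lemma cvx_avg C (N : nat) (v : nat -> 'rV[R]_n) : cvx_set C ->
  (forall i, (i <= N)%N -> C (v i)) ->
  C (N.+1%:R^-1 *: \sum_(i < N.+1) v i).
Proof.
move=> cC; elim: N => [|N IH] Cv.
  by rewrite big_ord1 invr1 scale1r; apply: Cv.
rewrite big_ord_recr /=.
have N0 : (N.+1%:R : R) != 0 by rewrite pnatr_eq0.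
have N1 : (N.+2%:R : R) != 0 by rewrite pnatr_eq0.
have -> : N.+2%:R^-1 *: (\sum_(i < N.+1) v i + v N.+1) =
    (N.+1%:R / N.+2%:R) *: (N.+1%:R^-1 *: \sum_(i < N.+1) v i) +
    (1 - N.+1%:R / N.+2%:R) *: v N.+1 :> 'rV[R]_n.
  rewrite scalerDr scalerA mulrAC divff // mul1r; congr (_ + _ *: _).
  by rewrite -[X in X - _](divff N1) -mulrBl -natrB // subSnn mul1r.
apply: cC; [|exact: Cv|].
  by apply: IH => i iN; apply: Cv; rewrite leqW.
rewrite divr_ge0 //= ler_pdivrMr ?ltr0n // mul1r ler_nat; exact: leqnSn.
Qed.

(** Jensen's inequality for equal weights: the average of N + 2 points is a convex combination of
    the average of the first N + 1 and the last one. *)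
Lemma sconvex_avg C h (N : nat) (v : nat -> 'rV[R]_n) : cvx_set C ->
  sconvex C 0 h -> (forall i, (i <= N)%N -> C (v i)) ->
  h (N.+1%:R^-1 *: \sum_(i < N.+1) v i) <=
    N.+1%:R^-1 * \sum_(i < N.+1) h (v i).
Proof.
move=> cC hc; elim: N => [|N IH] Cv.
  by rewrite !big_ord1 invr1 scale1r mul1r.
have Cv' i : (i <= N)%N -> C (v i) by move=> iN; apply: Cv; rewrite leqW.
have avg := cvx_avg cC Cv'.
rewrite big_ord_recr [X in _ <= _ * X]big_ord_recr /=.
have N0 : (N.+1%:R : R) != 0 by rewrite pnatr_eq0.
have N1 : (N.+2%:R : R) != 0 by rewrite pnatr_eq0.
have e1 : 1 - N.+1%:R / N.+2%:R = N.+2%:R^-1 :> R.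
  by rewrite -[X in X - _](divff N1) -mulrBl -natrB // subSnn mul1r.
have -> : N.+2%:R^-1 *: (\sum_(i < N.+1) v i + v N.+1) =
    (N.+1%:R / N.+2%:R) *: (N.+1%:R^-1 *: \sum_(i < N.+1) v i) +
    (1 - N.+1%:R / N.+2%:R) *: v N.+1 :> 'rV[R]_n.
  by rewrite scalerDr scalerA mulrAC divff // mul1r e1.
have t01 : 0 <= (N.+1%:R / N.+2%:R : R) <= 1.
  apply/andP; split; first exact: divr_ge0.
  by rewrite ler_pdivrMr ?ltr0n // mul1r ler_nat leqnSn.
apply: le_trans (hc _ _ _ avg (Cv _ (leqnn _)) t01) _.
rewrite !mul0r subr0 e1 mulrDr lerD2r mulrAC.
apply: le_trans (ler_wpM2r _ (ler_wpM2l _ (IH Cv'))) _ => //.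
by rewrite mulrA divff // mul1r mulrC.
Qed.

Lemma lsc_onD C h k : lsc_on C h -> lsc_on C k ->
  lsc_on C (fun x => h x + k x).
Proof.
move=> hl kl x Cx e e0; have e20 : 0 < e / 2 by lra.
near=> z; move=> Cz.
have h1 : h x - e / 2 < h z by move: Cz; near: z; exact: hl.
have h2 : k x - e / 2 < k z by move: Cz; near: z; exact: kl.
by lra.
Unshelve. all: by end_near. Qed.

Lemma lsc_on_continuous C h :
  (forall x, C x -> {for x, continuous h}) -> lsc_on C h.
Proof.
move=> hc x Cx e e0; have c := hc x Cx; rewrite /continuous_at in c.
near=> z; move=> _.
have : `|h x - h z| < e by near: z; exact: (cvgrPdist_lt _ _).1 c _ e0.
by rewrite ltr_norml; lra.
Unshelve. all: by end_near. Qed.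

(** The supremum is attained at each point, so the neighbourhood provided by one single [k i]
    suffices. *)
Lemma lsc_on_sup C h (I : Type) (k : I -> _) :
  (forall i, lsc_on C (k i)) -> (forall i x, C x -> k i x <= h x) ->
  (forall x, C x -> exists i, h x = k i x) -> lsc_on C h.
Proof.
move=> kl kh hk x Cx e e0; have [i hi] := hk x Cx.
near=> z; move=> Cz; rewrite hi.
apply: lt_le_trans (kh i z Cz); move: Cz; near: z; exact: kl.
Unshelve. all: by end_near. Qed.

(** Weierstrass. Sublevel sets are nested and generate a filter. At a cluster point [p], a value
    [h x < h p] would be exceeded on a whole neighbourhood of [p], which nevertheless meets the
    sublevel set of [x]. *)
Lemma compact_min C h : compact C -> C !=set0 -> lsc_on C h ->
  exists2 p, C p & forall x, C x -> h p <= h x.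
Proof.
move=> cptC [c0 Cc0] hl.
pose S x := [set z | C z /\ h z <= h x].
have FS : ProperFilter (filter_from C S).
  apply: filter_from_proper => [|x Cx]; last by exists x.
  apply: filter_from_filter; first by exists c0.
  move=> x y Cx Cy; have [xy|yx] := leP (h x) (h y).
    by exists x => // z [Cz zx]; split; split=> //; exact: le_trans xy.
  by exists y => // z [Cz zy]; split; split=> //; apply: le_trans zy (ltW yx).
have [|p [Cp clp]] := cptC (filter_from C S).
  by exists c0 => // z [].
exists p => // x Cx; rewrite leNgt; apply/negP => ltxp.
have e0 : 0 < h p - h x by rewrite subr_gt0.
have [|z [[Cz zx] /(_ Cz)]] := clp (S x) _ _ (hl p Cp _ e0); first by exists x.
by lra.
Qed.

End convexity.

(** * First-order inequalities *)

Section differential_calculus.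
Context (R : realType) (n : nat).
Implicit Types (h : 'rV[R]_n -> R) (x v : 'rV[R]_n).

Lemma derive_grad h x v : differentiable (h : _ -> R^o) x ->
  'D_v (h : _ -> R^o) x = dot (grad h x) v.
Proof.
move=> dh; rewrite deriveE // [v in LHS]row_sum_delta linear_sum.
apply: eq_bigr => i _; rewrite linearZ /= mxE deriveE // mulrC.
by [].
Qed.

Lemma is_derive_segment h x v (t : R) :
  differentiable (h : _ -> R^o) (x + t *: v) ->
  is_derive t (1 : R) (fun s : R => h (x + s *: v) : R^o)
    (dot (grad h (x + t *: v)) v).
Proof.
move=> dh; have dv := @diff_derivable _ _ _ (h : _ -> R^o) _ v dh.
have e : (fun s : R => s^-1 *:
      (((fun s : R => h (x + s *: v) : R^o) \o shift t) (s *: (1 : R))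
       - h (x + t *: v))) =
    (fun s : R => s^-1 *:
      (((h : _ -> R^o) \o shift (x + t *: v)) (s *: v) - h (x + t *: v))).
  apply/funext => s /=; congr (_ *: (h _ - _)).
  by rewrite /shift /= scalerDl -[s *: 1]/(s * 1) mulr1 addrCA.
split; first by rewrite /derivable e.
by rewrite -derive_grad // /derive e.
Qed.

Lemma descent (C : set 'rV[R]_n) h (L : R) : cvx_set C ->
  (forall x, C x -> differentiable (h : _ -> R^o) x) ->
  (forall x z, C x -> C z ->
    enorm (grad h x - grad h z) <= L * enorm (x - z)) ->
  forall x z, C x -> C z ->
    h z <= h x + dot (grad h x) (z - x) + L / 2 * dot (z - x) (z - x).
Proof.
move=> cC dh Lh x z Cx Cz; set v := z - x; set a := dot (grad h x) v.
pose r (t : R) : R^o := h (x + t *: v).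
(* The subtracted quadratic makes the derivative of [q] nonpositive on the segment: it is the
   gradient increment times [v], minus [L * t * dot v v]. The mean value theorem then gives
   [q 1 <= q 0]. *)
pose q (t : R) : R^o := r t - (a * t + L / 2 * dot v v * (t ^+ 2)).
have Cs t : 0 <= t <= 1 -> C (x + t *: v).
  move=> t01; have -> : x + t *: v = t *: z + (1 - t) *: x.
    by rewrite /v scalerBr scalerBl scale1r addrCA addrA.
  exact: cC.
have dr (t : R) : 0 <= t <= 1 -> is_derive t 1 r (dot (grad h (x + t *: v)) v).
  by move=> t01; apply/is_derive_segment/dh/Cs.
have dq (t : R) : 0 <= t <= 1 -> is_derive t 1 q
    (dot (grad h (x + t *: v)) v - (a + L * dot v v * t)).
  move=> t01; have := dr t t01 => drt.
  have : is_derive t 1 (fun t : R => a * t + L / 2 * dot v v * (t ^+ 2) : R^o)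
      (a + L * dot v v * t).
    apply: is_derive_eq.
    by rewrite -[a%:A]/(a * 1) -[t%:A]/(t * 1) -[_ *: (_ + _)]/(_ * _); field.
  by move=> ?; apply: is_deriveB.
have [||c] := @MVT_segment R q
  (fun t => dot (grad h (x + t *: v)) v - (a + L * dot v v * t)) 0 1 ler01.
- by move=> t /[!in_itv]/= /andP[t0 t1]; apply: dq; rewrite !ltW.
- apply: derivable_within_continuous => t /[!in_itv]/= t01.
  exact: (@ex_derive _ _ _ _ _ _ _ (dq t t01)).
rewrite in_itv /= => c01; rewrite /q /r scale0r addr0 scale1r.
rewrite [x + v]addrC subrK subr0 mulr1 => e.
have h1 : dot (grad h (x + c *: v)) v - a <= L * c * dot v v.
  rewrite /a -dotNl -dotDl.
  apply: le_trans (dot_le_enorm _ _) _.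
  have := Lh _ _ (Cs c c01) Cx; rewrite [x + _]addrC addrK enormZ.
  have /andP[c0 _] := c01; rewrite (ger0_norm c0) => h1.
  apply: le_trans (ler_wpM2r (enorm_ge0 _) h1) _.
  by rewrite -enorm_sqr expr2 !mulrA.
by move: e; rewrite !mulr0 !mulr1 expr1n expr0n /= -/a; lra.
Qed.

(** Differentiability is available at [x] only, so the slope is taken as the limit from the right of
    difference quotients, each bounded by the convexity inequality between [x] and [z]. *)
Lemma sconvex_grad (C : set 'rV[R]_n) h (mu : R) x z : sconvex C mu h ->
  C x -> C z -> differentiable (h : _ -> R^o) x ->
  h x + dot (grad h x) (z - x) + mu / 2 * dot (z - x) (z - x) <= h z.
Proof.
move=> hc Cx Cz dh; set v := z - x; set d := dot v v.
have := @diff_derivable _ _ _ (h : _ -> R^o) _ v dh; rewrite /derivable.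
have := derive_grad v dh; rewrite /derive.
set q := (X in lim (X @ _)) => el cv.
have {cv el} cv : q @ 0^' --> (dot (grad h x) v : R^o) by rewrite -el.
have cr : q @ 0^'+ --> (dot (grad h x) v : R^o).
  exact: cvg_dnbhs_at_right.
suff : dot (grad h x) v <= h z - h x - mu / 2 * d by lra.
apply/ler_addgt0Pr => e e0; have e20 : 0 < e / 2 by lra.
near (0 : R)^'+ => t.
have t0 : 0 < t by near: t; exact: nbhs_right_gt.
have t1 : t < 1 by near: t; exact: nbhs_right_lt.
(* The leftover term [t * (mu / 2 * d)] has the sign of [mu]; the absolute value treats both signs
   at once. *)
have tc : t * (`|mu / 2 * d| + 1) <= e / 2.
  rewrite -ler_pdivlMr ?ltr_wpDl //; near: t; apply: nbhs_right_le.
  by rewrite divr_gt0 ?ltr_wpDl.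
have qt : dot (grad h x) v - e / 2 <= q t.
  by near: t; apply: (cvgr_ge _ cr); lra.
have := hc z x t Cz Cx; rewrite (ltW t0) (ltW t1) => /(_ isT).
have -> : t *: z + (1 - t) *: x = t *: v + x.
  by rewrite /v scalerBr scalerBl scale1r -!addrA; congr (_ + _); rewrite addrC.
rewrite -/v -/d => h1.
have : q t <= h z - h x - mu / 2 * d + t * (mu / 2 * d).
  rewrite /q /= -[_ *: _]/(_ * _) mulrC ler_pdivrMr //.
  by rewrite /shift /=; lra.
have : t * (mu / 2 * d) <= t * (`|mu / 2 * d| + 1).
  by rewrite ler_pM2l //; apply: le_trans (ler_norm _) _; rewrite lerDl.
by lra.
Unshelve. all: by end_near. Qed.


End differential_calculus.

(** * Proximal points and the Moreau envelope *)

Section partial_differentials.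
Context (R : realType) (n m : nat) (Phi : 'rV[R]_n -> 'rV[R]_m -> R).

Lemma differentiable_partial_x x y :
  differentiable (fun u : 'rV[R]_n * 'rV[R]_m => Phi u.1 u.2 : R^o) (x, y) ->
  differentiable (Phi ^~ y : _ -> R^o) x.
Proof.
move=> dP.
pose k (u : 'rV[R]_n) : 'rV[R]_n * 'rV[R]_m := (u, y).
have dk : differentiable k x.
  by apply: differentiable_pair; [exact: (@ex_diff _ _ _ _ _ id id)|
                                  exact: differentiable_cst].
exact: (@differentiable_comp _ _ _ _ k _ x dk dP).
Qed.

Lemma differentiable_partial_y x y :
  differentiable (fun u : 'rV[R]_n * 'rV[R]_m => Phi u.1 u.2 : R^o) (x, y) ->
  differentiable (Phi x : _ -> R^o) y.
Proof.
move=> dP.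
pose k (u : 'rV[R]_m) : 'rV[R]_n * 'rV[R]_m := (x, u).
have dk : differentiable k y.
  by apply: differentiable_pair; [exact: differentiable_cst|
                                  exact: (@ex_diff _ _ _ _ _ id id)].
exact: (@differentiable_comp _ _ _ _ k _ y dk dP).
Qed.

End partial_differentials.

Section library_convexity.
Context (R : realType) (n : nat).
Implicit Types (h : 'rV[R]_n -> R) (C : set 'rV[R]_n).

Lemma convex_function_le h x y (t : R) : convex_function setT h ->
  0 <= t <= 1 -> h (t *: x + (1 - t) *: y) <= t * h x + (1 - t) * h y.
Proof.
move=> hc /andP[t0 t1].
by have := hc (@Itv01 R t t0 t1) x y; rewrite !inE => /(_ I I).
Qed.

(** The squared norm satisfies t |x|^2 + (1 - t) |y|^2 - |t x + (1 - t) y|^2 = t (1 - t) |x - y|^2,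
    so adding or removing it shifts the modulus exactly. *)
Lemma weakly_convex_sconvex C (gamma : R) h :
  weakly_convex gamma h -> sconvex C (- gamma) h.
Proof.
move=> hc x y t _ _ t01; have := convex_function_le x y hc t01.
rewrite !enorm_sqr !dotE (dotC y x); lra.
Qed.

Lemma strongly_concave_sconvex C (mu : R) h :
  strongly_concave mu h -> sconvex C mu (fun x => - h x).
Proof.
move=> hc x y t _ _ t01; have := convex_function_le x y hc t01.
rewrite !enorm_sqr !dotE (dotC y x); lra.
Qed.

End library_convexity.

(** The optimality condition in three-point form: the last square on the left is the growth due to
    the strong convexity of the proximal objective. It takes the place of a subgradient
    inclusion. *)
Definition prox_point (R : realType) (n : nat) (C : set 'rV[R]_n)
    (F : 'rV[R]_n -> R) (a : R) (z p : 'rV[R]_n) : Prop :=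
  C p /\ forall x, C x ->
    F p + (2 * a)^-1 * dot (p - z) (p - z) + (2 * a)^-1 * dot (x - p) (x - p)
      <= F x + (2 * a)^-1 * dot (x - z) (x - z).

(** Testing each optimality condition at the other point and adding gives firm nonexpansiveness. It
    serves both to compare iterates and to prove them measurable. *)
Lemma prox_point_lipschitz (R : realType) (n : nat) (C : set 'rV[R]_n)
    (F : 'rV[R]_n -> R) (a : R) (z z' p p' : 'rV[R]_n) : 0 < a ->
  prox_point C F a z p -> prox_point C F a z' p' ->
  enorm (p - p') <= enorm (z - z').
Proof.
move=> a0 [Cp hp] [Cp' hp'].
have c0 : 0 < (2 * a)^-1 by rewrite invr_gt0 mulr_gt0.
have h1 : dot (p - p') (p - p') <= dot (p - p') (z - z').
  rewrite -(ler_pM2l c0); have := hp _ Cp'; have := hp' _ Cp.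
  rewrite !dotE (dotC p' p) (dotC z p) (dotC z p') (dotC z' p) (dotC z' p').
  lra.
have := le_trans h1 (dot_le_enorm _ _); rewrite -enorm_sqr expr2.
have [->|nz] := eqVneq (enorm (p - p')) 0; first by rewrite enorm_ge0.
by rewrite ler_pM2l // lt_neqAle eq_sym nz enorm_ge0.
Qed.

Section proper_closed_convex.
Context (R : realType) (n : nat) (f : 'rV[R]_n -> \bar R).
Hypotheses (pf : proper_closed_convex f) (cf : compact (edom f)).
Let F x := fine (f x).

Lemma edomE x : edom f x -> f x = (fine (f x))%:E.
Proof.
case: pf => -[/(_ x) fx _] _ _ xf; rewrite fineK //.
by rewrite fin_real // fx.
Qed.

Lemma edomN x : ~ edom f x -> f x = +oo%E.
Proof. by rewrite /edom /= => /negP; rewrite -leNgt leye_eq => /eqP. Qed.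

Lemma edom_nonempty : edom f !=set0.
Proof. by case: pf => -[]. Qed.

Lemma cvx_edom : cvx_set (edom f).
Proof.
case: pf => _ _ fc x y t xf yf t01; rewrite /edom /=.
apply: le_lt_trans (fc x y t t01) _.
by rewrite (edomE xf) (edomE yf) -!EFinM -EFinD ltry.
Qed.

Lemma sconvex_fine : sconvex (edom f) 0 F.
Proof.
move=> x y t xf yf t01; case: pf => _ _ /(_ x y t t01).
rewrite (edomE (cvx_edom xf yf t01)) (edomE xf) (edomE yf).
by rewrite -!EFinM -EFinD lee_fin !mul0r subr0.
Qed.

Lemma lsc_fine : lsc_on (edom f) F.
Proof.
move=> x xf e e0; case: pf => _ /(_ x (F x - e)) h _.
have [|V xV VF] := h; first by rewrite (edomE xf) lte_fin gtrBl.
by apply: filterS xV => z Vz zf; have := VF _ Vz; rewrite (edomE zf) lte_fin.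
Qed.

(** The minimum is found among real values on [edom f]; the extended objective is infinite
    elsewhere, so the set from which [prox] chooses is inhabited and its default value is not
    returned. *)
Lemma proxP (a : R) z : 0 < a -> prox_point (edom f) F a z (prox a f z).
Proof.
move=> a0; have c0 : 0 < (2 * a)^-1 by rewrite invr_gt0 mulr_gt0.
pose k x := F x + (2 * a)^-1 * dot (x - z) (x - z).
have kl : lsc_on (edom f) k.
  apply: lsc_onD; first exact: lsc_fine.
  apply: lsc_on_continuous => x _.
  by apply: continuousM; [exact: cst_continuous|exact: continuous_dotB].
have [p pf' pmin] := compact_min cf edom_nonempty kl.
have objE x : edom f x -> prox_obj a f z x = (k x)%:E.
  by move=> xf; rewrite /prox_obj (edomE xf) -EFinD enorm_sqr.
have pP : forall w, (prox_obj a f z p <= prox_obj a f z w)%E.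
  move=> w; have [wf|wf] := pselect (edom f w).
    by rewrite !objE // lee_fin; exact: pmin.
  by rewrite [X in (_ <= X)%E]/prox_obj (edomN wf) addye // leey.
rewrite /prox; set S := [set w | _].
have /= := @xgetPex _ 0 S (ex_intro _ p pP).
set q := xget 0 S => Sq.
(* A minimizer outside the domain would have value +oo, above the finite value at [p]. *)
have qf : edom f q.
  have := Sq p; rewrite (objE p pf') /edom /= ltNge leye_eq => h.
  by apply/negP => /eqP e; move: h; rewrite /prox_obj e addye.
have qmin x : edom f x -> k q <= k x.
  by move=> xf; have := Sq x; rewrite !objE // lee_fin.
split=> // x xf.
have kc : sconvex (edom f) (0 + (2 * a)^-1 * 2) k.
  apply: sconvexD; first exact: sconvex_fine.
  by apply: sconvexZ; [exact: ltW|exact: sconvex_dot].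
have := sconvex_min cvx_edom kc qf qmin xf.
by rewrite /k /F; lra.
Qed.

End proper_closed_convex.

(* For a gamma-weakly convex h this says that p minimizes h + gamma |. - u|^2;
   the last term on the left is the growth due to strong convexity. *)
Definition moreau_point (R : realType) (n : nat) (C : set 'rV[R]_n)
    (h : 'rV[R]_n -> R) (gamma : R) (u p : 'rV[R]_n) : Prop :=
  C p /\ forall x, C x ->
    h p + gamma * dot (p - u) (p - u) + gamma / 2 * dot (x - p) (x - p)
      <= h x + gamma * dot (x - u) (x - u).

Section moreau_envelope.
Context (R : realType) (n : nat) (C : set 'rV[R]_n) (h : 'rV[R]_n -> R).
Context (hE : 'rV[R]_n -> \bar R) (gamma : R).
Hypotheses (g0 : 0 < gamma) (hC : forall x, C x -> hE x = (h x)%:E).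
Hypothesis hN : forall x, ~ C x -> hE x = +oo%E.
Local Notation lambda := (1 / (2 * gamma)).

Lemma moreau_point_exists : compact C -> C !=set0 -> cvx_set C ->
  sconvex C (- gamma) h -> lsc_on C h -> forall u, exists p,
  moreau_point C h gamma u p.
Proof.
move=> cC C0 vC hc hl u.
pose k x := h x + gamma * dot (x - u) (x - u).
have kl : lsc_on C k.
  apply: lsc_onD => //; apply: lsc_on_continuous => x _.
  by apply: continuousM; [exact: cst_continuous|exact: continuous_dotB].
have kc : sconvex C (- gamma + gamma * 2) k.
  by apply: sconvexD => //; apply: sconvexZ; [exact: ltW|exact: sconvex_dot].
have [p Cp pmin] := compact_min cC C0 kl.
exists p; split=> // x Cx; have := sconvex_min vC kc Cp pmin Cx.
by rewrite /k; lra.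
Qed.

(** As for [prox_point_lipschitz], but weak convexity leaves only half of the quadratic growth,
    whence the factor 2. *)
Lemma moreau_point_lipschitz u u' p p' :
  moreau_point C h gamma u p -> moreau_point C h gamma u' p' ->
  enorm (p - p') <= 2 * enorm (u - u').
Proof.
move=> [Cp hp] [Cp' hp'].
have h1 : dot (p - p') (p - p') <= dot (p - p') (2 *: (u - u')).
  rewrite -(ler_pM2l g0); have := hp _ Cp'; have := hp' _ Cp.
  rewrite !dotE (dotC p' p) (dotC u p) (dotC u p') (dotC u' p) (dotC u' p').
  lra.
have := le_trans h1 (dot_le_enorm _ _); rewrite -enorm_sqr expr2 enormZ normr_nat.
have [->|nz] := eqVneq (enorm (p - p')) 0.
  by rewrite mulr_ge0 ?enorm_ge0.
by rewrite ler_pM2l // lt_neqAle eq_sym nz enorm_ge0.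
Qed.

Lemma moreauE u p : moreau_point C h gamma u p ->
  moreau lambda hE u = (h p + gamma * dot (p - u) (p - u))%:E.
Proof.
move=> [Cp hp].
have cE : (2 * lambda)^-1 = gamma by field; rewrite gt_eqF.
have pE x : C x -> prox_obj lambda hE u x =
    (h x + gamma * dot (x - u) (x - u))%:E.
  by move=> Cx; rewrite /prox_obj hC // cE enorm_sqr.
apply/eqP; rewrite eq_le; apply/andP; split.
  by rewrite -pE //; apply: ereal_inf_lbound; exists p.
apply: le_ereal_inf_tmp => _ [x _ <-]; have [Cx|Cx] := pselect (C x).
  rewrite pE // lee_fin; apply: le_trans (hp x Cx).
  by rewrite lerDl mulr_ge0 ?dot_ge0 // ltW // divr_gt0.
by rewrite /prox_obj hN // addye // leey.
Qed.

(** The envelope is squeezed between two quadratics with the same linear part at [u]: the minimizers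
    for [u] and [u + d] are each tested in the problem of the other. This also yields the existence
    of the derivatives. *)
Lemma grad_moreauE u p : (forall z, exists q, moreau_point C h gamma z q) ->
  moreau_point C h gamma u p ->
  grad_moreau lambda hE u = (2 * gamma) *: (u - p).
Proof.
move=> ex mp; pose M z := fine (moreau lambda hE z).
have Mu := moreauE mp.
have bnd d : `|M (u + d) - M u - 2 * gamma * dot (u - p) d| <= gamma * dot d d.
  have [q mq] := ex (u + d); have Md := moreauE mq.
  rewrite /M Mu Md /=; case: mp => Cp /(_ q mq.1) hq; case: mq => Cq /(_ p Cp).
  (* For the lower bound, this square absorbs the product of [q - p] with [d] into the growth
     [gamma / 2 * dot (q - p) (q - p)] and leaves [- gamma * dot d d]. *)
  have := mulr_ge0 (ltW g0) (dot_ge0 (q - p - 2 *: d)).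
  have := mulr_ge0 (ltW g0) (dot_ge0 (q - p)).
  move: hq; rewrite ler_norml !dotE (dotC q p) (dotC u p) (dotC u q) (dotC d p)
    (dotC d q) (dotC d u).
  by move=> *; apply/andP; split; lra.
apply/rowP => i; rewrite mxE; set v := delta_mx 0 i.
have -> : ((2 * gamma) *: (u - p)) 0 i = 2 * gamma * dot (u - p) v.
  by rewrite dot_delta mxE.
apply: cvg_lim => //; apply/cvgrPdist_le => e e0.
near=> s; rewrite /= /shift /= [s *: v + u]addrC -/(M _) -/(M u).
have s0 : s != 0 by near: s; exact: nbhs_dnbhs_neq.
have h1 := bnd (s *: v); rewrite !(dotZr, dotZl) dot_delta_delta mulr1 in h1.
have hs : `|s| <= e / gamma by near: s; apply: dnbhs0_le; rewrite divr_gt0.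
rewrite distrC -[_ *: _]/(_ * _).
rewrite -(ler_pM2l (_ : 0 < `|s|)) ?normr_gt0 // -normrM.
have -> : s * (s^-1 * (M (u + s *: v) - M u) - 2 * gamma * dot (u - p) v) =
  M (u + s *: v) - M u - 2 * gamma * (s * dot (u - p) v) by field.
apply: le_trans h1 _; rewrite -expr2 -real_normK ?num_real // expr2.
by rewrite mulrCA ler_pM2l ?normr_gt0 // mulrC -ler_pdivlMr.
Unshelve. all: by end_near. Qed.

End moreau_envelope.

(** * One call of SAPD along a path *)

(** The assumptions restated for real-valued functions on the effective domains [C] and [D], so that
    the path estimates avoid extended reals. *)
Record saddle_problem (R : realType) (n m : nat) (C : set 'rV[R]_n)
    (D : set 'rV[R]_m) (F : 'rV[R]_n -> R) (G : 'rV[R]_m -> R)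
    (Phi : 'rV[R]_n -> 'rV[R]_m -> R) (gamma mu Lxx Lxy Lyx Lyy : R) : Prop :=
  SaddleProblem {
    sp_gamma : 0 < gamma;
    sp_mu : 0 < mu;
    sp_Lxx : 0 <= Lxx;
    sp_Lxy : 0 < Lxy;
    sp_Lyx : 0 < Lyx;
    sp_Lyy : 0 <= Lyy;
    sp_compact_x : compact C;
    sp_compact_y : compact D;
    sp_cvx_x : cvx_set C;
    sp_cvx_y : cvx_set D;
    sp_lsc_F : lsc_on C F;
    sp_lsc_G : lsc_on D G;
    sp_cvx_F : sconvex C 0 F;
    sp_cvx_G : sconvex D 0 G;
    sp_weakly_convex : forall y, D y -> sconvex C (- gamma) (Phi ^~ y);
    sp_strongly_concave : forall x, C x -> sconvex D mu (fun y => - Phi x y);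
    sp_diff_x : forall x y, C x -> D y ->
      differentiable (Phi ^~ y : _ -> R^o) x;
    sp_diff_y : forall x y, C x -> D y ->
      differentiable (Phi x : _ -> R^o) y;
    sp_lip_x : forall x x' y y', C x -> C x' -> D y -> D y' ->
      enorm (grad_x Phi x y - grad_x Phi x' y') <=
        Lxx * enorm (x - x') + Lxy * enorm (y - y');
    sp_lip_y : forall x x' y y', C x -> C x' -> D y -> D y' ->
      enorm (grad_y Phi x y - grad_y Phi x' y') <=
        Lyx * enorm (x - x') + Lyy * enorm (y - y') }.

(** Expanding the squares around [z] instead of [z + a *: s] turns the shift of the center into a
    linear term in [s]; the square of [a *: s] cancels. *)
Lemma prox_point_ineq (R : realType) (n : nat) (C : set 'rV[R]_n) F (a : R)
    (z s p : 'rV[R]_n) : 0 < a -> prox_point C F a (z + a *: s) p ->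
  forall x, C x -> F p - dot s (p - x) <= F x + (2 * a)^-1 *
    (dot (x - z) (x - z) - dot (x - p) (x - p) - dot (p - z) (p - z)).
Proof.
move=> a0 [Cp hp] x Cx; have := hp x Cx.
have e : (2 * a)^-1 * a = 1 / 2 by field; rewrite gt_eqF.
have d q : (2 * a)^-1 * dot (q - (z + a *: s)) (q - (z + a *: s)) =
    (2 * a)^-1 * dot (q - z) (q - z) - dot s (q - z)
    + (2 * a)^-1 * dot (a *: s) (a *: s).
  rewrite (_ : dot s (q - z) = 2 * ((2 * a)^-1 * a) * dot s (q - z)).
    by rewrite !dotE (dotC z q) (dotC s q) (dotC s z); ring.
  by rewrite e; field.
by rewrite !d !dotE; lra.
Qed.

Lemma half_inv (R : realType) (a : R) : (2 * a)^-1 = a^-1 / 2.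
Proof. by rewrite invfM mulrC. Qed.

Lemma le_inv_of_le_div (R : realType) (a b : R) :
  0 < a -> 0 < b -> a <= 1 / b -> b <= a^-1.
Proof. by move=> a0 b0; rewrite ler_pdivlMr // mulrC -ler_pdivlMr // div1r. Qed.

Lemma gradN (R : realType) (n : nat) (h : 'rV[R]_n -> R) x :
  differentiable (h : _ -> R^o) x -> grad (fun y => - h y) x = - grad h x.
Proof.
move=> dh; apply/rowP => i; rewrite !mxE.
by rewrite -(@deriveN _ _ _ (h : _ -> R^o)) //; exact: diff_derivable.
Qed.

Definition lagrangian (R : realType) (n m : nat) (F : 'rV[R]_n -> R)
    (G : 'rV[R]_m -> R) (Phi : 'rV[R]_n -> 'rV[R]_m -> R) x y : R :=
  F x + Phi x y - G y.

Section sapd_deterministic.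
Context (R : realType) (n m : nat) (C : set 'rV[R]_n) (D : set 'rV[R]_m).
Context (F : 'rV[R]_n -> R) (G : 'rV[R]_m -> R).
Context (Phi : 'rV[R]_n -> 'rV[R]_m -> R) (gamma mu Lxx Lxy Lyx Lyy : R).
Hypothesis SP : saddle_problem C D F G Phi gamma mu Lxx Lxy Lyx Lyy.
Local Notation l := (lagrangian F G Phi).

Let g0 : 0 < gamma. Proof. by case: SP. Qed.

Section path.
Context (tau sigma : R) (xs ax : nat -> 'rV[R]_n) (ys ay : nat -> 'rV[R]_m).
Hypotheses (tau0 : 0 < tau) (sigma0 : 0 < sigma).
Hypothesis tauE : tau <= 1 / (Lyx + Lxx + 2 * gamma).
Hypothesis sigmaE : sigma <= 1 / (Lyx + 2 * Lyy).
Hypotheses (x0C : C (xs 0)) (y0D : D (ys 0)).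
(* As 0.-1 = 0, the momentum vanishes for k = 0. *)
Hypothesis ystep : forall k,
  prox_point D G sigma (ys k + sigma *: (2 *: ay k - ay k.-1)) (ys k.+1).
Hypothesis xstep : forall k, prox_point C F tau
  (xs k - tau *: (ax k + (gamma + gamma) *: (xs k - xs 0))) (xs k.+1).

Let c := xs 0.
(** The function targeted by one call: the coefficient (mu_x + gamma) / 2 equals [gamma] because
    mu_x = [gamma]. *)
Let lc x y := l x y + gamma * dot (x - c) (x - c).
Let wx k := ax k - grad_x Phi (xs k) (ys k.+1).
Let wy k := ay k - grad_y Phi (xs k) (ys k).
Let q k := grad_y Phi (xs k) (ys k) - grad_y Phi (xs k.-1) (ys k.-1).

Lemma path_x k : C (xs k).
Proof. by case: k => // k; case: (xstep k). Qed.

Lemma path_y k : D (ys k).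
Proof. by case: k => // k; case: (ystep k). Qed.

(** The two prox inequalities are combined with concavity in y at the new point, and with weak
    convexity and descent in x at the old one. The center term, linearized at [xs k], gains
    [gamma * dot (u - xs k) (u - xs k)], which outweighs the defect of weak convexity, and costs
    [gamma] times the squared step, whence [Lxx + 2 * gamma]. *)
Lemma sapd_step k u v : C u -> D v ->
  lc (xs k.+1) v - lc u (ys k.+1) <=
    dot (grad_y Phi (xs k.+1) (ys k.+1)) (v - ys k.+1)
    + dot (2 *: ay k - ay k.-1) (ys k.+1 - v) - dot (wx k) (xs k.+1 - u)
    + (2 * tau)^-1 * (dot (u - xs k) (u - xs k)
        - dot (u - xs k.+1) (u - xs k.+1)
        - dot (xs k.+1 - xs k) (xs k.+1 - xs k))
    + (2 * sigma)^-1 * (dot (v - ys k) (v - ys k)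
        - dot (v - ys k.+1) (v - ys k.+1)
        - dot (ys k.+1 - ys k) (ys k.+1 - ys k))
    + (Lxx + 2 * gamma) / 2 * dot (xs k.+1 - xs k) (xs k.+1 - xs k).
Proof.
move=> Cu Dv.
have Cx := path_x k; have Cx' := path_x k.+1.
have Dy := path_y k; have Dy' := path_y k.+1.
set x := xs k; set x' := xs k.+1; set y := ys k; set y' := ys k.+1.
have hy := prox_point_ineq sigma0 (ystep k) Dv.
have hx : F x' + dot (ax k + (gamma + gamma) *: (x - c)) (x' - u) <= F u
    + (2 * tau)^-1 * (dot (u - x) (u - x) - dot (u - x') (u - x')
      - dot (x' - x) (x' - x)).
  have := xstep k; rewrite -scalerN => /(prox_point_ineq tau0)/(_ _ Cu).
  by rewrite dotNl opprK.
have hc : - Phi x' y' + dot (- grad_y Phi x' y') (v - y') <= - Phi x' v.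
  have dP := sp_diff_y SP Cx' Dy'.
  have := sconvex_grad (sp_strongly_concave SP Cx') Dy' Dv (differentiableN dP).
  rewrite gradN //; apply: le_trans; rewrite lerDl.
  by rewrite mulr_ge0 ?dot_ge0 // divr_ge0 // ltW // (sp_mu SP).
have hw : Phi x y' + dot (grad_x Phi x y') (u - x)
    - gamma / 2 * dot (u - x) (u - x) <= Phi u y'.
  have := sconvex_grad (sp_weakly_convex SP Dy') Cx Cu (sp_diff_x SP Cx Dy').
  by rewrite !mulNr.
have hd : Phi x' y' <= Phi x y' + dot (grad_x Phi x y') (x' - x)
    + Lxx / 2 * dot (x' - x) (x' - x).
  apply: (@descent _ _ C (Phi ^~ y') Lxx) => //; first by case: SP.
    by move=> z Cz; exact: (sp_diff_x SP Cz Dy').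
  move=> z z' Cz Cz'; have := sp_lip_x SP Cz Cz' Dy' Dy'.
  by rewrite subrr enorm0 mulr0 addr0.
have du := mulr_ge0 (ltW g0) (dot_ge0 (u - x)).
rewrite /lc /lagrangian /wx; move: hy hx hc hw hd du; rewrite -/x -/x' -/y -/y'.
move: (grad_x Phi x y') (grad_y Phi x' y') (ax k) (2 *: ay k - ay k.-1).
move=> gx gy a s.
have -> : x' - u = (x' - x) - (u - x) by rewrite opprB addrA subrK.
have -> : u - x' = (u - x) - (x' - x) by rewrite opprB addrA subrK.
have -> : u - c = (u - x) + (x - c) by rewrite addrA subrK.
have -> : x' - c = (x' - x) + (x - c) by rewrite addrA subrK.
rewrite -(opprB y' v); move: (x' - x) (u - x) (x - c) (y' - v) => p r z w.
rewrite !dotE (dotC r p) (dotC z p) (dotC z r).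
by lra.
Qed.

(** Young's inequality with weights 1: the squared displacements obtained are the ones that
    [sapd_sum] keeps in reserve with a negative sign. *)
Lemma momentum_bound k v : dot (q k) v <=
  Lyx / 2 * dot (xs k - xs k.-1) (xs k - xs k.-1)
  + Lyy / 2 * dot (ys k - ys k.-1) (ys k - ys k.-1)
  + (Lyx + Lyy) / 2 * dot v v.
Proof.
apply: le_trans (dot_le_enorm _ _) _.
have h := sp_lip_y SP (path_x k) (path_x k.-1) (path_y k) (path_y k.-1).
apply: le_trans (ler_wpM2r (enorm_ge0 _) h) _.
have h1 := sp_Lyx SP; have h2 := sp_Lyy SP.
rewrite -!enorm_sqr; set a := enorm (xs k - _); set b := enorm (ys k - _).
have := mulr_ge0 (ltW h1) (sqr_ge0 (a - enorm v)).
have := mulr_ge0 h2 (sqr_ge0 (b - enorm v)).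
by nra.
Qed.

(** Everything telescopes except the momentum against the step in y. The negative squares of the
    last displacement are carried in the induction hypothesis to pay for it at the next
    iteration. *)
Lemma sapd_sum k u v : C u -> D v ->
  \sum_(j < k) (lc (xs j.+1) v - lc u (ys j.+1)) <=
    dot (q k) (v - ys k)
    + (2 * tau)^-1 * (dot (u - xs 0) (u - xs 0) - dot (u - xs k) (u - xs k))
    + (2 * sigma)^-1 * (dot (v - ys 0) (v - ys 0) - dot (v - ys k) (v - ys k))
    - Lyx / 2 * dot (xs k - xs k.-1) (xs k - xs k.-1)
    - Lyy / 2 * dot (ys k - ys k.-1) (ys k - ys k.-1)
    + \sum_(j < k) (- dot (wx j) (xs j.+1 - u)
        + dot (2 *: wy j - wy j.-1) (ys j.+1 - v)).
Proof.
move=> Cu Dv; elim: k => [|k IH].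
  by rewrite !big_ord0 /q /= !subrr !dot0l !mulr0 !addr0 !subr0.
rewrite !big_ord_recr /=; apply: le_trans (lerD IH (sapd_step k Cu Dv)) _.
have hq := momentum_bound k (ys k.+1 - ys k).
have e : dot (grad_y Phi (xs k.+1) (ys k.+1)) (v - ys k.+1)
    + dot (2 *: ay k - ay k.-1) (ys k.+1 - v) =
    dot (q k.+1) (v - ys k.+1) - dot (q k) (v - ys k)
    + dot (q k) (ys k.+1 - ys k) + dot (2 *: wy k - wy k.-1) (ys k.+1 - v).
  rewrite /q /wy /=; move: (grad_y Phi (xs k) (ys k)) (grad_y Phi (xs k.-1) _).
  by move=> a b; rewrite !dotE; ring.
have [[[Lxx0 Lyx0] Lyy0] g0'] := (sp_Lxx SP, sp_Lyx SP, sp_Lyy SP, g0).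
(* The step sizes pay for each displacement twice: once now, in the step inequality or the momentum
   bound, and once for the reserve of the next iteration. *)
have ct : (Lxx + 2 * gamma + Lyx) / 2 <= (2 * tau)^-1.
  by rewrite half_inv (addrC _ Lyx) addrA ler_pM2r // le_inv_of_le_div //; lra.
have cs : (Lyx + 2 * Lyy) / 2 <= (2 * sigma)^-1.
  by rewrite half_inv ler_pM2r // le_inv_of_le_div //; lra.
have := ler_wpM2r (dot_ge0 (xs k.+1 - xs k)) ct.
have := ler_wpM2r (dot_ge0 (ys k.+1 - ys k)) cs.
by move: e hq; lra.
Qed.

End path.
End sapd_deterministic.

(** * The outer loop along a path *)

Section proximal_point.
Context (R : realType) (n m : nat) (C : set 'rV[R]_n) (D : set 'rV[R]_m).
Context (F : 'rV[R]_n -> R) (G : 'rV[R]_m -> R).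
Context (Phi : 'rV[R]_n -> 'rV[R]_m -> R) (gamma mu Lxx Lxy Lyx Lyy : R).
Hypothesis SP : saddle_problem C D F G Phi gamma mu Lxx Lxy Lyx Lyy.
Local Notation l := (lagrangian F G Phi).

Let g0 : 0 < gamma. Proof. by case: SP. Qed.

Lemma sconvex_lagr_x y : D y -> sconvex C (- gamma) (l ^~ y).
Proof.
move=> Dy; rewrite -[- gamma]add0r -[_ - gamma]addr0.
apply: (@sconvexD _ _ _ _ 0 (fun x => F x + Phi x y)); last exact: sconvex_cst.
by apply: sconvexD; [exact: (sp_cvx_F SP)|exact: (sp_weakly_convex SP)].
Qed.

Lemma sconvex_lagr_y x : C x -> sconvex D mu (fun y => - l x y).
Proof.
move=> Cx; have -> : (fun y => - l x y) = (fun y => (G y + - Phi x y) - F x).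
  by apply/funext => y; rewrite /lagrangian; ring.
rewrite -[mu]add0r -[_ + mu]addr0.
apply: (@sconvexD _ _ _ _ 0 (fun y => G y + - Phi x y)); last exact: sconvex_cst.
by apply: sconvexD; [exact: (sp_cvx_G SP)|exact: (sp_strongly_concave SP)].
Qed.

Lemma sconvex_center (k : 'rV[R]_n -> R) (c : 'rV[R]_n) :
  sconvex C (- gamma) k ->
  sconvex C gamma (fun x => k x + gamma * dot (x - c) (x - c)).
Proof.
move=> hk; rewrite [X in sconvex _ X](_ : gamma = - gamma + gamma * 2); last ring.
by apply: sconvexD => //; apply: sconvexZ; [exact: ltW|exact: sconvex_dot].
Qed.

Lemma lsc_lagr_x y : D y -> lsc_on C (l ^~ y).
Proof.
move=> Dy; apply: (@lsc_onD _ _ _ (fun x => F x + Phi x y)).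
  apply: lsc_onD; first exact: (sp_lsc_F SP).
  apply: lsc_on_continuous => x Cx.
  exact: differentiable_continuous (sp_diff_x SP Cx Dy).
by apply: lsc_on_continuous => x _; exact: cst_continuous.
Qed.

Lemma lsc_lagr_y x : C x -> lsc_on D (fun y => - l x y).
Proof.
move=> Cx; have -> : (fun y => - l x y) = (fun y => (G y + - Phi x y) - F x).
  by apply/funext => y; rewrite /lagrangian; ring.
apply: (@lsc_onD _ _ _ (fun y => G y + - Phi x y)).
  apply: lsc_onD; first exact: (sp_lsc_G SP).
  apply: lsc_on_continuous => y Dy.
  apply: continuousN; exact: differentiable_continuous (sp_diff_y SP Cx Dy).
by apply: lsc_on_continuous => y _; exact: cst_continuous.
Qed.

(** Best responses. On the domains they exist by compactness, so the default value 0 is not returned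
    there. *)
Definition ymax x := xget 0 [set y | D y /\ forall v, D v -> l x v <= l x y].
Definition xmin c y := xget 0 [set x | C x /\ forall u, C u ->
  l x y + gamma * dot (x - c) (x - c) <= l u y + gamma * dot (u - c) (u - c)].
Definition primal_value x := l x (ymax x).
Definition dual_value c y :=
  l (xmin c y) y + gamma * dot (xmin c y - c) (xmin c y - c).
Local Notation phi := primal_value.
Local Notation psi := dual_value.

Hypotheses (C0 : C !=set0) (D0 : D !=set0).

Lemma ymaxP x : C x -> D (ymax x) /\ forall v, D v -> l x v <= phi x.
Proof.
move=> Cx; have [y Dy hy] := compact_min (sp_compact_y SP) D0 (lsc_lagr_y Cx).
rewrite /phi /ymax; set S := [set y | _].
have Sy : S y by split=> // v /hy; rewrite lerN2.
exact: (@xgetPex _ 0 S (ex_intro _ y Sy)).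
Qed.

Lemma ymax_strong x v : C x -> D v ->
  mu / 2 * dot (ymax x - v) (ymax x - v) <= phi x - l x v.
Proof.
move=> Cx Dv; have [Dy hy] := ymaxP Cx.
have h u : D u -> - l x (ymax x) <= - l x u by rewrite lerN2; exact: hy.
have := sconvex_min (sp_cvx_y SP) (sconvex_lagr_y Cx) Dy h Dv.
by rewrite -(opprB (ymax x)) !(dotNl, dotNr) opprK /phi; lra.
Qed.

Lemma xminP c y u : D y -> C u -> C (xmin c y) /\
  psi c y + gamma / 2 * dot (xmin c y - u) (xmin c y - u) <=
    l u y + gamma * dot (u - c) (u - c).
Proof.
move=> Dy Cu; pose k x := l x y + gamma * dot (x - c) (x - c).
have kl : lsc_on C k.
  apply: lsc_onD; first exact: lsc_lagr_x.
  apply: lsc_on_continuous => x _.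
  by apply: continuousM; [exact: cst_continuous|exact: continuous_dotB].
have [x Cx hx] := compact_min (sp_compact_x SP) C0 kl.
set S := [set x | C x /\ forall u, C u ->
  l x y + gamma * dot (x - c) (x - c) <= l u y + gamma * dot (u - c) (u - c)].
have [Cm hm] : S (xmin c y) by apply: (@xgetPex _ 0 S); exists x.
split=> //.
have := sconvex_min (sp_cvx_x SP) (sconvex_center c (sconvex_lagr_x Dy))
  Cm hm Cu.
by rewrite -(opprB (xmin c y)) !(dotNl, dotNr) opprK.
Qed.

Lemma dual_value_le c y u : D y -> C u ->
  psi c y <= l u y + gamma * dot (u - c) (u - c).
Proof.
move=> Dy Cu; have [_] := xminP c Dy Cu; apply: le_trans.
by rewrite lerDl mulr_ge0 ?dot_ge0 // divr_ge0 // ltW.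
Qed.

Lemma weak_duality c y x : D y -> C x ->
  psi c y <= phi x + gamma * dot (x - c) (x - c).
Proof.
move=> Dy Cx; apply: le_trans (dual_value_le c Dy Cx) _.
by rewrite lerD2r; case: (ymaxP Cx) => _; apply.
Qed.

(** At the maximizer [v] of the intermediate point, the inequality for the Lagrangian with second
    argument [v] applies, and its values at the end points are below the primal values. *)
Lemma sconvex_primal : sconvex C (- gamma) phi.
Proof.
move=> x y t Cx Cy t01; have Cz := sp_cvx_x SP Cx Cy t01.
have [Dv _] := ymaxP Cz; set v := ymax _ in Dv.
have := sconvex_lagr_x Dv Cx Cy t01.
have [_ /(_ v Dv) hx] := ymaxP Cx; have [_ /(_ v Dv) hy] := ymaxP Cy.
case/andP: t01 => t0 t1; have t2 : 0 <= 1 - t by rewrite subr_ge0.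
have := ler_wpM2l t0 hx; have := ler_wpM2l t2 hy.
by rewrite {3}/phi -/v; lra.
Qed.

Lemma lsc_primal : lsc_on C phi.
Proof.
apply: (@lsc_on_sup _ _ _ _ {y | D y} (fun y x => l x (sval y))).
- by move=> [y Dy]; exact: lsc_lagr_x.
- by move=> [y Dy] x Cx; case: (ymaxP Cx) => _; apply.
- by move=> x Cx; have [Dy _] := ymaxP Cx; exists (exist _ _ Dy).
Qed.

Definition prox_primal c := xget 0 [set p | moreau_point C phi gamma c p].

Lemma prox_primalP c : moreau_point C phi gamma c (prox_primal c).
Proof.
have := moreau_point_exists g0 (sp_compact_x SP) C0 (sp_cvx_x SP)
  sconvex_primal lsc_primal c.
exact: (@xgetPex _ 0 [set p | moreau_point C phi gamma c p]).
Qed.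

(* The duality gap at (z, y) of the subproblem centered at z. *)
Definition prox_gap z y := phi z - psi z y.

Definition prox_decrease z :=
  phi z - (phi (prox_primal z)
           + gamma * dot (prox_primal z - z) (prox_primal z - z)).

Lemma prox_decrease_ge z : C z ->
  gamma / 2 * dot (z - prox_primal z) (z - prox_primal z) <= prox_decrease z.
Proof.
move=> Cz; have [_ /(_ z Cz)] := prox_primalP z.
by rewrite subrr dot0l mulr0 addr0 /prox_decrease; lra.
Qed.

Section one_call.
Context (z z' : 'rV[R]_n) (y y' : 'rV[R]_m).
Hypotheses (Cz : C z) (Cz' : C z') (Dy : D y) (Dy' : D y').
Let A := prox_gap z y.
Let B := phi z' + gamma * dot (z' - z) (z' - z) - psi z y'.

(* Weak duality for both pairs, psi z y' <= phi z and
   psi z y <= phi z' + gamma |z' - z|^2, makes a saddle point unnecessary. *)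
Lemma dist_xmin : gamma / 2 * dot (xmin z y' - z) (xmin z y' - z) <= A + B.
Proof.
have [_] := xminP z Dy' Cz; rewrite subrr dot0l mulr0 addr0.
have := weak_duality z Dy Cz'.
have [_ /(_ _ Dy')] := ymaxP Cz.
by rewrite /A /B /prox_gap; lra.
Qed.

Lemma dist_ymax : mu / 2 * dot (ymax z' - y) (ymax z' - y) <= A + B.
Proof.
have := ymax_strong Cz' Dy; have := dual_value_le z Dy Cz'.
have := weak_duality z Dy' Cz; rewrite subrr dot0l mulr0 addr0.
by rewrite /A /B /prox_gap; lra.
Qed.

Lemma call_gap_bound (tau sigma N Q : R) : 0 < tau -> 0 < sigma -> 0 < N ->
  132 <= N * (gamma * tau) -> 264 <= N * (mu * sigma) ->
  (forall u v, C u -> D v ->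
    N * (l z' v + gamma * dot (z' - z) (z' - z)
         - (l u y' + gamma * dot (u - z) (u - z))) <=
    tau^-1 * dot (u - z) (u - z) + sigma^-1 * dot (v - y) (v - y) + Q) ->
  43 * B <= A + 44 * (Q / N).
Proof.
move=> t0 s0 N0 Nt Ns h.
have [Dv _] := ymaxP Cz'; have [Cu _] := xminP z Dy' Cz.
(* For the two best responses the left-hand side is [N * B] by definition. *)
have {h} : N * B <= tau^-1 * dot (xmin z y' - z) (xmin z y' - z) +
    sigma^-1 * dot (ymax z' - y) (ymax z' - y) + Q := h _ _ Cu Dv.
have m0 := sp_mu SP.
(* The squared distance is at most 2 / gamma times [A + B], and 2 / 132 = 1 / 66. The y-part has 2 /
   264 = 1 / 132, and the two fractions add up to 1 / 44. *)
have hx : tau^-1 * dot (xmin z y' - z) (xmin z y' - z) <= N / 66 * (A + B).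
  have AB : 0 <= A + B.
    by apply: le_trans dist_xmin; rewrite mulr_ge0 ?dot_ge0 // divr_ge0 // ltW.
  rewrite mulrC ler_pdivrMr // -(ler_pM2l (_ : 0 < gamma / 2)); last first.
    by rewrite divr_gt0.
  apply: le_trans dist_xmin _.
  have := ler_wpM2r AB Nt; lra.
have hy : sigma^-1 * dot (ymax z' - y) (ymax z' - y) <= N / 132 * (A + B).
  have AB : 0 <= A + B.
    by apply: le_trans dist_ymax; rewrite mulr_ge0 ?dot_ge0 // divr_ge0 // ltW.
  rewrite mulrC ler_pdivrMr // -(ler_pM2l (_ : 0 < mu / 2)); last first.
    by rewrite divr_gt0.
  apply: le_trans dist_ymax _.
  have := ler_wpM2r AB Ns; lra.
move=> h; rewrite -(ler_pM2l N0).
have -> : N * (A + 44 * (Q / N)) = N * A + 44 * Q by field; rewrite gt_eqF.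
lra.
Qed.

(** Weak duality at the proximal point itself: the dual value cannot exceed the envelope, which is
    [phi z - prox_decrease z]. *)
Lemma primal_descent : phi z' + gamma * dot (z' - z) (z' - z) <=
  phi z - prox_decrease z + B.
Proof.
have [Cp _] := prox_primalP z.
by have := weak_duality z Dy' Cp; rewrite /prox_decrease /B; lra.
Qed.

(** Moving the center from [z] to [z'] changes the dual value by a product of [u - z'] with
    [z' - z], where [u] is the best response for the new center. *)
Lemma next_prox_gap :
  prox_gap z' y' <= 2 * B + 8 * (gamma * dot (z' - z) (z' - z)).
Proof.
have [Cu] := xminP z' Dy' Cz'; set u := xmin z' y' in Cu *.
rewrite subrr dot0l mulr0 addr0.
have [_ /(_ _ Dy')] := ymaxP Cz'.
have := dual_value_le z Dy' Cu.
have e : psi z' y' = l u y' + gamma * dot (u - z') (u - z') by [].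
rewrite /prox_gap /B e.
have -> : u - z = (u - z') + (z' - z) by rewrite addrA subrK.
(* The weight 4 leaves a quarter of [gamma] times the square of [u - z']; the growth at [u] bounds
   this by half of the new gap, which moves to the left and doubles the rest. *)
have := mulr_ge0 (ltW g0) (dot_ge0 ((u - z') - 4 *: (z' - z))).
move: (u - z') (z' - z) => a b.
by rewrite !dotE (dotC b a); lra.
Qed.

End one_call.

Lemma outer_loop (z : nat -> 'rV[R]_n) (y : nat -> 'rV[R]_m) (V : nat -> R)
    (gap0 : R) (T : nat) :
  (forall t, C (z t)) -> (forall t, D (y t)) ->
  (forall t, 43 * (phi (z t.+1) + gamma * dot (z t.+1 - z t) (z t.+1 - z t)
                   - psi (z t) (y t.+1)) <=
             prox_gap (z t) (y t) + 44 * V t) ->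
  (forall x, C x -> phi (z 0%N) - phi x <= gap0) ->
  prox_gap (z 0%N) (y 0%N) <= gap0 ->
  41 * \sum_(t < T) prox_decrease (z t) <= 42 * gap0 + 44 * \sum_(t < T) V t.
Proof.
move=> Cz Dy hV hphi hA.
pose B t := phi (z t.+1) + gamma * dot (z t.+1 - z t) (z t.+1 - z t)
                   - psi (z t) (y t.+1).
pose S t := gamma * dot (z t.+1 - z t) (z t.+1 - z t).
pose A t := prox_gap (z t) (y t).
have h1 : \sum_(t < T) prox_decrease (z t) + \sum_(t < T) S t <=
    phi (z 0%N) - phi (z T) + \sum_(t < T) B t.
  elim: T => [|T IH]; first by rewrite !big_ord0 subrr !addr0.
  rewrite !big_ord_recr /=.
  have := primal_descent (z T) (z T.+1) (Dy T.+1).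
  by rewrite -/(S T) -/(B T); lra.
have h2 : A T + \sum_(t < T) A t <= gap0 + 2 * \sum_(t < T) B t +
    8 * \sum_(t < T) S t.
  elim: T {h1} => [|T IH]; first by rewrite !big_ord0 !mulr0 !addr0.
  rewrite !big_ord_recr /=.
  have := next_prox_gap (z T) (Cz T.+1) (Dy T.+1).
  by rewrite -/(S T) -/(B T) -/(A T.+1); lra.
have h3 : 43 * \sum_(t < T) B t <= \sum_(t < T) A t + 44 * \sum_(t < T) V t.
  rewrite !mulr_sumr -big_split; apply: ler_sum => t _; exact: hV.
have h4 : 0 <= \sum_(t < T) prox_decrease (z t).
  apply: sumr_ge0 => t _; apply: le_trans (prox_decrease_ge (Cz t)).
  by rewrite mulr_ge0 ?dot_ge0 // divr_ge0 // ltW.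
have AT : 0 <= A T.
  rewrite subr_ge0; have := weak_duality (z T) (Dy T) (Cz T).
  by rewrite subrr dot0l mulr0 addr0.
have S0 : 0 <= \sum_(t < T) S t.
  by apply: sumr_ge0 => t _; rewrite mulr_ge0 ?dot_ge0 // ltW.
(* With D, S, A, B, V for the sums: 41 (D + S) <= 41 [gap0] + 41 B, and 41 B <= [gap0] + 8 S + 44 V.
   The S-terms leave the surplus 33 S on the left. *)
have := hphi _ (Cz T).
lra.
Qed.

End proximal_point.

(** * The ergodic duality gap of one call *)

Section ergodic_gap.
Context (R : realType) (n m : nat) (C : set 'rV[R]_n) (D : set 'rV[R]_m).
Context (F : 'rV[R]_n -> R) (G : 'rV[R]_m -> R).
Context (Phi : 'rV[R]_n -> 'rV[R]_m -> R) (gamma mu Lxx Lxy Lyx Lyy : R).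
Hypothesis SP : saddle_problem C D F G Phi gamma mu Lxx Lxy Lyx Lyy.
Local Notation l := (lagrangian F G Phi).

Let g0 : 0 < gamma. Proof. by case: SP. Qed.

Context (tau sigma : R) (xs ax : nat -> 'rV[R]_n) (ys ay : nat -> 'rV[R]_m).
Hypotheses (tau0 : 0 < tau) (sigma0 : 0 < sigma).
Hypothesis tauE : tau <= 1 / (Lyx + Lxx + 2 * gamma).
Hypothesis sigmaE : sigma <= 1 / (Lyx + 2 * Lyy).
Hypotheses (x0C : C (xs 0)) (y0D : D (ys 0)).
Hypothesis ystep : forall k,
  prox_point D G sigma (ys k + sigma *: (2 *: ay k - ay k.-1)) (ys k.+1).
Hypothesis xstep : forall k, prox_point C F tau
  (xs k - tau *: (ax k + (gamma + gamma) *: (xs k - xs 0))) (xs k.+1).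

Definition noise_x k := ax k - grad_x Phi (xs k) (ys k.+1).
Definition noise_y k := ay k - grad_y Phi (xs k) (ys k).
(** The noise of the extrapolated direction [2 *: ay k - ay k.-1]; for k = 0 it is just
    [noise_y 0]. *)
Definition noise_e k := 2 *: noise_y k - noise_y k.-1.

(* N times the error that the noise adds to the ergodic duality gap; the
   squared norms come from replacing the comparison points by x_0 and y_0. *)
Definition noise_error N :=
  \sum_(k < N) (- dot (noise_x k) (xs k.+1 - xs 0)
                + dot (noise_e k) (ys k.+1 - ys 0))
  + tau / 2 * dot (\sum_(k < N) noise_x k) (\sum_(k < N) noise_x k)
  + sigma / 2 * dot (\sum_(k < N) noise_e k) (\sum_(k < N) noise_e k).

Definition ergodic_x N : 'rV[R]_n := N%:R^-1 *: \sum_(k < N) xs k.+1.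
Definition ergodic_y N : 'rV[R]_m := N%:R^-1 *: \sum_(k < N) ys k.+1.

Lemma ergodic_xC N : (0 < N)%N -> C (ergodic_x N).
Proof.
case: N => // N _; apply: (@cvx_avg _ _ _ N (fun k => xs k.+1)).
  exact: (sp_cvx_x SP).
by move=> k _; exact: (path_x x0C xstep).
Qed.

Lemma ergodic_yD N : (0 < N)%N -> D (ergodic_y N).
Proof.
case: N => // N _; apply: (@cvx_avg _ _ _ N (fun k => ys k.+1)).
  exact: (sp_cvx_y SP).
by move=> k _; exact: (path_y y0D ystep).
Qed.

(** Jensen's inequality applied to [sapd_sum]. The noise is tested against [xs 0] and [ys 0]; the
    remaining products with [u - xs 0] and [ys 0 - v] are split by Young's inequality, which doubles
    the factor 1 / (2 tau) to 1 / tau, and likewise for sigma. *)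
Lemma ergodic_gap N u v : (0 < N)%N -> C u -> D v ->
  N%:R * (l (ergodic_x N) v
     + gamma * dot (ergodic_x N - xs 0) (ergodic_x N - xs 0)
     - (l u (ergodic_y N) + gamma * dot (u - xs 0) (u - xs 0))) <=
  tau^-1 * dot (u - xs 0) (u - xs 0) + sigma^-1 * dot (v - ys 0) (v - ys 0)
  + noise_error N.
Proof.
case: N => // N' _ Cu Dv; set N := N'.+1; set c := xs 0.
have N0 : 0 < N%:R :> R by rewrite ltr0n.
have Nn0 : N%:R != 0 :> R by rewrite gt_eqF.
pose lc x y := l x y + gamma * dot (x - c) (x - c).
have hx : N%:R * lc (ergodic_x N) v <= \sum_(k < N) lc (xs k.+1) v.
  have k0 : sconvex C 0 (lc ^~ v).
    apply: (@sconvexW _ _ _ C gamma) => //; first exact: ltW.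
    exact: (sconvex_center SP c (sconvex_lagr_x SP Dv)).
  have := sconvex_avg (N := N') (v := fun k => xs k.+1) (sp_cvx_x SP) k0.
  move=> /(_ (fun k _ => path_x x0C xstep k.+1)).
  by rewrite mulrC ler_pdivlMr // mulrC.
have hy : N%:R * - lc u (ergodic_y N) <= \sum_(k < N) - lc u (ys k.+1).
  have k0 : sconvex D 0 (fun y => - lc u y).
    apply: (@sconvexW _ _ _ D mu) => //; first exact: ltW (sp_mu SP).
    have -> : (fun y => - lc u y) =
        (fun y => - l u y + (- (gamma * dot (u - c) (u - c)))).
      by apply/funext => y; rewrite opprD.
    rewrite -[mu]addr0; apply: (@sconvexD _ _ _ mu 0 (fun y => - l u y)).
      exact: (sconvex_lagr_y SP Cu).
    exact: sconvex_cst.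
  have := sconvex_avg (N := N') (v := fun k => ys k.+1) (sp_cvx_y SP) k0.
  move=> /(_ (fun k _ => path_y y0D ystep k.+1)).
  by rewrite mulrC ler_pdivlMr // mulrC.
have hs := sapd_sum SP tau0 sigma0 tauE sigmaE x0C y0D ystep xstep N Cu Dv.
(* The final momentum survives the telescoping. The reserve pays for its displacement part, and the
   final distance from [v] to [ys N] for the rest. *)
have hq := momentum_bound SP x0C y0D ystep xstep N (v - ys N).
have [[Lyx0 Lyy0] Lxx0] := (sp_Lyx SP, sp_Lyy SP, sp_Lxx SP).
have cs : (Lyx + 2 * Lyy) / 2 <= (2 * sigma)^-1.
  by rewrite half_inv ler_pM2r // le_inv_of_le_div //; lra.
have hv := ler_wpM2r (dot_ge0 (v - ys N)) cs.
have hLv := mulr_ge0 Lyy0 (dot_ge0 (v - ys N)).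
have hu : 0 <= (2 * tau)^-1 * dot (u - xs N) (u - xs N).
  by rewrite mulr_ge0 ?dot_ge0 // invr_ge0 mulr_ge0 // ltW.
set W := \sum_(k < N) noise_x k; set E := \sum_(k < N) noise_e k.
have eW : \sum_(j < N) (- dot (noise_x j) (xs j.+1 - u)
        + dot (noise_e j) (ys j.+1 - v)) =
    \sum_(k < N) (- dot (noise_x k) (xs k.+1 - xs 0)
                + dot (noise_e k) (ys k.+1 - ys 0)) +
    (dot W (u - c) + dot E (ys 0 - v)).
  rewrite /W /E !dot_suml -!big_split; apply: eq_bigr => k _ /=.
  by rewrite !dotE; ring.
have yW := dot_young W (u - c) tau0.
have yE := dot_young E (ys 0 - v) sigma0.
have sW : \sum_(j < N) (lc (xs j.+1) v - lc u (ys j.+1)) =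
   \sum_(j < N) lc (xs j.+1) v + \sum_(j < N) - lc u (ys j.+1).
  by rewrite -big_split.
have -> : N%:R * (l (ergodic_x N) v
     + gamma * dot (ergodic_x N - c) (ergodic_x N - c)
     - (l u (ergodic_y N) + gamma * dot (u - c) (u - c))) =
   N%:R * lc (ergodic_x N) v + N%:R * - lc u (ergodic_y N).
  by rewrite /lc; ring.
apply: le_trans (lerD hx hy) _; rewrite -sW.
apply: le_trans hs _; rewrite -/noise_x -/noise_y.
rewrite [X in _ + X]eW /noise_error -/W -/E -/c.
have yN : dot (ys 0%N - v) (ys 0%N - v) = dot (v - ys 0%N) (v - ys 0%N).
  by rewrite -(opprB v) dotNl dotNr opprK.
rewrite yN in yE.
move: yW yE hq hv hLv hu; rewrite !half_inv -/c.
lra.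
Qed.

End ergodic_gap.

(** * Measurability of vectors *)

Lemma lipschitz_lsc_on (R : realType) (n p : nat) (C : set 'rV[R]_n)
    (h : 'rV[R]_n -> 'rV[R]_p) (L : R) i : 0 <= L ->
  (forall x z, C x -> C z -> enorm (h x - h z) <= L * enorm (x - z)) ->
  lsc_on C (fun x => h x 0 i).
Proof.
move=> L0 Lh x Cx e e0; have e1 : 0 < e / (L + 1) by rewrite divr_gt0 ?ltr_wpDl.
apply: filterS (near_enorm x e1) => z zx Cz.
rewrite ltr_pdivlMr ?ltr_wpDl // mulrC in zx.
have := enorm_coord (h x - h z) i; rewrite !mxE => h1.
have h2 := le_trans h1 (Lh x z Cx Cz); rewrite enormB in h2.
have := le_trans (ler_norm _) h2; have := enorm_ge0 (z - x).
by nra.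
Qed.

Section measurable_vectors.
Context (R : realType) (d : measure_display) (T : measurableType d).

Definition vmeas (n : nat) (X : T -> 'rV[R]_n) : Prop :=
  forall i, measurable_fun setT (fun w => X w 0 i).

(** A countable base of the topology, with membership expressed by coordinates only, to match
    [vmeas]. *)
Definition box (n : nat) (q : 'rV[rat]_n) (k : nat) : set 'rV[R]_n :=
  [set z | forall i, `|z 0 i - ratr (q 0 i)| < k.+1%:R^-1].

Lemma nbhs_box (n : nat) (x : 'rV[R]_n) (A : set 'rV[R]_n) : nbhs x A ->
  exists q k, box q k x /\ box q k `<=` A.
Proof.
move=> /nbhs_ballP[e /= e0 eA].
have e20 : 0 < e / 2 by rewrite divr_gt0.
pose k := Num.truncn (e / 2)^-1.
have ke : k.+1%:R^-1 < e / 2.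
  rewrite -[X in _ < X]invrK ltf_pV2 ?posrE ?invr_gt0 //.
  by rewrite truncnS_gt.
have : 0 < k.+1%:R^-1 :> R by rewrite invr_gt0.
suff : forall r : R, r = k.+1%:R^-1 -> 0 < r ->
    exists q, box q k x /\ box q k `<=` A.
  by move=> h k0; have [q] := h _ erefl k0; exists q, k.
move=> r rE r0; rewrite -rE in ke.
have hq i : exists q : rat, `|x 0 i - ratr q| < r.
  have lt : x 0 i - r < x 0 i + r by lra.
  have [q] := rat_in_itvoo lt; rewrite in_itv /= => /andP[h1 h2].
  by exists q; rewrite ltr_distl; apply/andP; split; lra.
exists (\row_i xchoose (hq i)); split=> [i|z zb].
  by rewrite mxE -rE; exact: (xchooseP (hq i)).
apply: eA; split=> // i j; rewrite !ord1 /ball /=.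
have := zb j; rewrite mxE -rE; have := xchooseP (hq j).
rewrite !ltr_distl => /andP[h1 h2] /andP[h3 h4]; apply/andP; split; lra.
Qed.

Lemma measurable_box (n : nat) (X : T -> 'rV[R]_n) q k : vmeas X ->
  measurable [set w | box q k (X w)].
Proof.
move=> mX.
have -> : [set w | box q k (X w)] = \bigcap_(i in [set: 'I_n])
    ((fun w => `|X w 0 i - ratr (q 0 i)|) @^-1` `]-oo, k.+1%:R^-1[%classic).
  apply/seteqP; split=> w /= wb i.
    by move=> _; rewrite /= in_itv /=; exact: wb.
  by have := wb i I; rewrite /= in_itv /=.
apply: fin_bigcap_measurable => // i _; rewrite -[X in measurable X]setTI.
have m : measurable_fun setT (fun w => X w 0 i - ratr (q 0 i)).
  by apply: measurable_funB; [exact: mX|exact: measurable_cst].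
by apply: (measurableT_comp (@normr_measurable R setT) m).
Qed.

(** A strict superlevel set of [h] is open relative to [C], hence is the union of the countably many
    rational boxes whose trace on [C] it contains. *)
Lemma measurable_lsc (n : nat) (C : set 'rV[R]_n) (h : 'rV[R]_n -> R)
    (X : T -> 'rV[R]_n) : vmeas X -> (forall w, C (X w)) -> lsc_on C h ->
  measurable_fun setT (fun w => h (X w)).
Proof.
move=> mX CX hl; apply: (measurability _ (RGenOInfty.measurableE R)).
move=> /= _ [_ [a ->]] <-; rewrite setTI.
pose good (p : 'rV[rat]_n * nat) := forall z, box p.1 p.2 z -> C z -> a < h z.
have -> : (fun w => h (X w)) @^-1` `]a, +oo[%classic =
   \bigcup_p (if `[< good p >] then [set w | box p.1 p.2 (X w)] else set0).
  apply/seteqP; split=> w /=.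
    rewrite in_itv /= andbT => ha.
    have e0 : 0 < h (X w) - a by rewrite subr_gt0.
    have [q [k [wb bA]]] := nbhs_box (hl _ (CX w) _ e0).
    exists (q, k) => //; rewrite asboolT //= => z zb Cz.
    by have := bA z zb Cz; rewrite opprB addrCA subrr addr0.
  move=> [p _]; case: asboolP => // gp wb.
  by rewrite in_itv /= andbT; exact: gp.
apply: countable_bigcupT_measurable => [|p]; first exact: countableP.
by case: asboolP => // _; exact: measurable_box.
Qed.

Lemma vmeas_lipschitz (n p : nat) (C : set 'rV[R]_n) (h : 'rV[R]_n -> 'rV[R]_p)
    (L : R) (X : T -> 'rV[R]_n) : 0 <= L ->
  (forall x z, C x -> C z -> enorm (h x - h z) <= L * enorm (x - z)) ->
  vmeas X -> (forall w, C (X w)) -> vmeas (fun w => h (X w)).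
Proof.
move=> L0 Lh mX CX i.
exact: (measurable_lsc mX CX (lipschitz_lsc_on i L0 Lh)).
Qed.

Lemma vmeas_cst (n : nat) (x : 'rV[R]_n) : vmeas (fun=> x).
Proof. by move=> i; exact: measurable_cst. Qed.

Lemma vmeasD (n : nat) (X Y : T -> 'rV[R]_n) :
  vmeas X -> vmeas Y -> vmeas (fun w => X w + Y w).
Proof.
move=> mX mY i; have := measurable_funD (mX i) (mY i).
by apply: eq_measurable_fun => w _; rewrite mxE.
Qed.

Lemma vmeasZ (n : nat) (a : R) (X : T -> 'rV[R]_n) :
  vmeas X -> vmeas (fun w => a *: X w).
Proof.
move=> mX i; have := measurable_funM (measurable_cst a) (mX i).
by apply: eq_measurable_fun => w _; rewrite mxE.
Qed.

Lemma vmeasB (n : nat) (X Y : T -> 'rV[R]_n) :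
  vmeas X -> vmeas Y -> vmeas (fun w => X w - Y w).
Proof.
move=> mX mY i; have := measurable_funB (mX i) (mY i).
by apply: eq_measurable_fun => w _; rewrite !mxE.
Qed.

Lemma vmeas_sum (n N : nat) (X : nat -> T -> 'rV[R]_n) :
  (forall k, (k < N)%N -> vmeas (X k)) -> vmeas (fun w => \sum_(k < N) X k w).
Proof.
move=> mX i.
have := @measurable_sum _ _ _ _ _ (index_enum 'I_N)
  (fun (k : 'I_N) w => X k w 0 i).
move=> /(_ setT (fun k => mX k (ltn_ord k) i)).
by apply: eq_measurable_fun => w _; rewrite summxE.
Qed.

Lemma vmeas_row (n p : nat) (X : T -> 'rV[R]_n) (Y : T -> 'rV[R]_p) :
  vmeas X -> vmeas Y -> vmeas (fun w => row_mx (X w) (Y w)).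
Proof.
move=> mX mY i; rewrite -[i]splitK; case: (fintype.split i) => j /=.
  by have := mX j; apply: eq_measurable_fun => w _; rewrite row_mxEl.
by have := mY j; apply: eq_measurable_fun => w _; rewrite row_mxEr.
Qed.

Lemma measurable_dot (n : nat) (X Y : T -> 'rV[R]_n) :
  vmeas X -> vmeas Y -> measurable_fun setT (fun w => dot (X w) (Y w)).
Proof.
move=> mX mY; apply: measurable_sum => i; exact: measurable_funM.
Qed.

(** Concatenating the two arguments into one row vector reduces this to a Lipschitz function of one
    variable. *)
Lemma vmeas_pair_lipschitz (n p r : nat) (C : set 'rV[R]_n) (D : set 'rV[R]_p)
    (h : 'rV[R]_n -> 'rV[R]_p -> 'rV[R]_r) (L M : R)
    (X : T -> 'rV[R]_n) (Y : T -> 'rV[R]_p) : 0 <= L -> 0 <= M ->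
  (forall x x' y y', C x -> C x' -> D y -> D y' ->
    enorm (h x y - h x' y') <= L * enorm (x - x') + M * enorm (y - y')) ->
  vmeas X -> vmeas Y -> (forall w, C (X w)) -> (forall w, D (Y w)) ->
  vmeas (fun w => h (X w) (Y w)).
Proof.
move=> L0 M0 Lh mX mY CX DY.
pose k (z : 'rV[R]_(n + p)) := h (lsubmx z) (rsubmx z).
have dE (z : 'rV[R]_(n + p)) :
    dot z z = dot (lsubmx z) (lsubmx z) + dot (rsubmx z) (rsubmx z).
  by rewrite /dot big_split_ord /=; congr (_ + _);
     apply: eq_bigr => i _; rewrite !mxE.
have kL x z : C (lsubmx x) /\ D (rsubmx x) -> C (lsubmx z) /\ D (rsubmx z) ->
    enorm (k x - k z) <= (L + M) * enorm (x - z).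
  move=> [Cx Dx] [Cz Dz]; apply: le_trans (Lh _ _ _ _ Cx Cz Dx Dz) _.
  rewrite mulrDl lerD // ler_wpM2l //.
    apply: enorm_le; first exact: enorm_ge0.
    by rewrite enorm_sqr dE !linearB /= lerDl dot_ge0.
  apply: enorm_le; first exact: enorm_ge0.
  by rewrite enorm_sqr dE !linearB /= lerDr dot_ge0.
have := vmeas_lipschitz (addr_ge0 L0 M0) kL (vmeas_row mX mY).
have kE w : k (row_mx (X w) (Y w)) = h (X w) (Y w).
  by rewrite /k row_mxKl row_mxKr.
under [X in _ -> vmeas X]eq_fun do rewrite -kE; apply => w.
by rewrite row_mxKl row_mxKr.
Qed.

End measurable_vectors.

(** * Noise is orthogonal to the past *)

(** The measurable type whose measurable sets are [sigma_gen F]: being a function of the past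
    becomes measurability on it. *)
Notation observed F :=
  (g_sigma_algebraType (\bigcup_(X in F) preimage_set_system setT X measurable)).

Section observed_algebra.
Context (R : realType) (d : measure_display) (Om : measurableType d).
Implicit Types (F : set (Om -> R)) (X U Z : Om -> R).

Lemma observed_gen F X : F X -> measurable_fun setT (X : observed F -> R).
Proof.
move=> FX _ A mA; apply: sub_sigma_algebra; exists X => //.
by exists A.
Qed.

Lemma observed_subset F F' X : F `<=` F' ->
  measurable_fun setT (X : observed F -> R) ->
  measurable_fun setT (X : observed F' -> R).
Proof.
move=> FF' mX _ A mA; move: (mX measurableT A mA).
apply: smallest_sub; first exact: smallest_sigma_algebra.
by move=> B [Y FY YB]; apply: sub_sigma_algebra; exists Y => //; exact: FF'.
Qed.

Lemma observed_sets F : (forall X, F X -> measurable_fun setT X) ->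
  sigma_gen F `<=` (measurable : set (set Om)).
Proof.
move=> mF; apply: smallest_sub; first exact: sigma_algebra_measurable.
by move=> _ [X FX [B mB <-]]; exact: mF.
Qed.

Lemma observed_measurable F X : (forall Y, F Y -> measurable_fun setT Y) ->
  measurable_fun setT (X : observed F -> R) -> measurable_fun setT X.
Proof.
by move=> mF mX _ A mA; exact: (observed_sets mF (mX measurableT A mA)).
Qed.

Lemma cond_exp_observed (P : probability Om R) F X Z :
  is_cond_exp P (sigma_gen F) X Z ->
  measurable_fun setT (Z : observed F -> R).
Proof. by move=> [_ _ ZF _] _ A mA; apply: ZF; exists A. Qed.

End observed_algebra.

Section orthogonality.
Context (R : realType) (d : measure_display) (Om : measurableType d).
Context (P : probability Om R).
Implicit Types (F : set (Om -> R)) (X U Z D : Om -> R).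
Import HBNNSimple.

(** [U] is approximated by simple functions on [observed F]. Their level sets lie in [sigma_gen F],
    where [D] integrates to 0, and the absolute value of [U * D] dominates the limit. *)
Let orth_ge0 F D U : (forall X, F X -> measurable_fun setT X) ->
  P.-integrable setT (EFin \o D) ->
  (forall A, sigma_gen F A -> (\int[P]_(w in A) (D w)%:E = 0)%E) ->
  measurable_fun setT (U : observed F -> R) -> (forall w, 0 <= U w) ->
  P.-integrable setT (EFin \o (fun w => U w * D w)) ->
  (\int[P]_w (U w * D w)%:E = 0)%E.
Proof.
move=> mF iD D0 mU U0 iUD.
have mD : measurable_fun setT D by apply/measurable_EFinP/(measurable_int P iD).
have mU' := observed_measurable mF mU.
have mEU : measurable_fun setT (EFin \o U : observed F -> \bar R).
  exact/measurable_EFinP.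
pose h := nnsfun_approx measurableT mEU.
have hU n w : h n w <= U w.
  rewrite -lee_fin /h nnsfun_approxE.
  by apply: (@le_approx _ _ _ setT (EFin \o U : observed F -> \bar R)) => // x _;
     rewrite lee_fin.
have h0 n w : 0 <= h n w by exact: fun_ge0.
have mh n : measurable_fun setT (h n : Om -> R).
  by apply: (observed_measurable mF); exact: measurable_funP.
have hE n : exists s : seq R, forall w : Om, (h n w * D w)%:E =
    (\sum_(r <- s) (r * (\1_(h n @^-1` [set r]) w * D w))%:E)%E.
  eexists => w; rewrite {1}(fimfunE (h n) w) fsbig_finite //= mulr_suml -sumEFin.
  by apply: eq_bigr => r _; rewrite mulrA.
have int0 n : (\int[P]_w (h n w * D w)%:E = 0)%E.
  have [s sE] := hE n; under eq_integral do rewrite sE.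
  have mA (r : R) : sigma_gen F (h n @^-1` [set r]).
    rewrite -[X in sigma_gen _ X]setTI.
    have mhn : measurable_fun setT (h n : observed F -> R).
      exact: measurable_funP.
    exact: (mhn measurableT _ (measurable_set1 r)).
  have cE (r c : R) w : (c * (\1_(h n @^-1` [set r]) w * D w))%:E =
      (c%:E * ((EFin \o D) \_ (h n @^-1` [set r])) w)%E.
    rewrite patchE indicE EFinM; case: (w \in _); first by rewrite mul1r.
    by rewrite mul0r.
  have iD' r : P.-integrable setT ((EFin \o D) \_ (h n @^-1` [set r])).
    have mr := observed_sets mF (mA r).
    by apply/(integrable_mkcond _ mr); exact: (integrableS measurableT mr _ iD).
  have ii r : P.-integrable setT
      (fun w => (r * (\1_(h n @^-1` [set r]) w * D w))%:E).
    have := integrableZl measurableT r (iD' r); exact: eq_integrable.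
  rewrite (integral_sum measurableT ii).
  rewrite big1 // => i _; under eq_integral do rewrite cE.
  by rewrite integralZl // -integral_mkcond D0 ?mule0.
have iN : P.-integrable setT (fun w => `|U w * D w|%:E).
  by have := integrable_abse iUD; apply: eq_integrable.
have [//|||||_ _ cv] := @dominated_convergence _ _ _ P setT measurableT
  (fun n w => (h n w * D w)%:E) (fun w => (U w * D w)%:E)
  (fun w => `|U w * D w|%:E).
- by move=> n; apply/measurable_EFinP/measurable_funM.
- exact/measurable_EFinP/measurable_funM.
- apply/aeW => w _; rewrite EFinM; under eq_fun do rewrite EFinM.
  apply: cvgeZr => //.
  exact: (cvg_nnsfun_approx measurableT mEU
    (fun x _ => (U0 x : (0 <= (U x)%:E)%E)) I).
- exact: iN.
- apply/aeW => w n _; rewrite abse_EFin lee_fin !normrM ler_wpM2r //.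
  by rewrite !ger0_norm.
have : (fun n => \int[P]_w (h n w * D w)%:E)%E @ \oo --> 0%E.
  by under eq_fun do rewrite int0; exact: cvg_cst.
by move/(cvg_unique _ cv); apply.
Qed.

(** Positive and negative parts of [U] are treated separately; each is at most [U] in absolute
    value, so integrability of the product is inherited. *)
Lemma cond_exp_orthogonal F X Z U :
  (forall Y, F Y -> measurable_fun setT Y) ->
  is_cond_exp P (sigma_gen F) X Z ->
  measurable_fun setT (U : observed F -> R) ->
  P.-integrable setT (EFin \o (fun w => U w * (X w - Z w))) ->
  (\int[P]_w (U w * (X w - Z w))%:E = 0)%E.
Proof.
move=> mF [iX iZ _ XZ] mU iU; pose D w := X w - Z w.
have iD : P.-integrable setT (EFin \o D).
  by have := integrableB measurableT iX iZ; apply: eq_integrable.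
have D0 A : sigma_gen F A -> (\int[P]_(w in A) (D w)%:E = 0)%E.
  move=> GA; have mA := observed_sets mF GA.
  have iXA := integrableS measurableT mA (@subsetT _ _) iX.
  have iZA := integrableS measurableT mA (@subsetT _ _) iZ.
  have := integralB mA iXA iZA; rewrite /= XZ // subee; last first.
    exact: integrable_fin_num iZA.
  by move=> <-; apply: eq_integral => w _.
have mU' := observed_measurable mF mU.
have mD := (measurable_EFinP _ _).1 (measurable_int P iD).
have ip (s : R -> R) : measurable_fun setT s -> (forall x, `|s x| <= `|x|) ->
    P.-integrable setT (EFin \o (fun w => s (U w) * D w)).
  move=> ms sle; apply: le_integrable iU => //.
    apply/measurable_EFinP/measurable_funM => //.
    exact: measurableT_comp.
  by move=> w _; rewrite !abse_EFin lee_fin !normrM ler_wpM2r.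
pose sp (x : R) := Num.max x 0; pose sn (x : R) := Num.max (- x) 0.
have mp : measurable_fun setT sp by apply: measurable_maxr.
have mn : measurable_fun setT sn by apply: measurable_maxr.
have ipp : P.-integrable setT (EFin \o (fun w => sp (U w) * D w)).
  by apply: ip => // x; rewrite /sp; case: (leP x 0) => x0; rewrite ?normr0.
have ipn : P.-integrable setT (EFin \o (fun w => sn (U w) * D w)).
  by apply: ip => // x; rewrite /sn; case: (leP (- x) 0) => x0;
     rewrite ?normr0 ?normrN.
have pU : (\int[P]_w (sp (U w) * D w)%:E = 0)%E.
  apply: (orth_ge0 mF iD D0) => //; first exact: (measurableT_comp mp mU).
  by move=> w; rewrite le_max lexx orbT.
have nU : (\int[P]_w (sn (U w) * D w)%:E = 0)%E.
  apply: (orth_ge0 mF iD D0) => //; first exact: (measurableT_comp mn mU).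
  by move=> w; rewrite le_max lexx orbT.
have e w : (U w * D w)%:E = ((sp (U w) * D w)%:E - (sn (U w) * D w)%:E)%E.
  rewrite -EFinB -mulrBl; congr (_ * _)%:E; rewrite /sp /sn.
  by case: (leP (U w) 0) => u0; case: (leP (- U w) 0) => u1; lra.
have := integralB measurableT ipp ipn; rewrite /= pU nU subee // => <-.
by apply: eq_integral => w _; rewrite e.
Qed.

End orthogonality.

(** * Bounds in mean and moments of the noise *)

Section mean_bounds.
Context (R : realType) (d : measure_display) (Om : measurableType d).
Context (P : probability Om R).
Implicit Types (X Y : Om -> R).

(** Integrability is included so that such bounds can be added and scaled. *)
Definition mean_le X (c : R) : Prop :=
  P.-integrable setT (EFin \o X) /\ (\int[P]_w (X w)%:E <= c%:E)%E.

Lemma mean_leD X Y a b : mean_le X a -> mean_le Y b ->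
  mean_le (fun w => X w + Y w) (a + b).
Proof.
move=> [iX Xa] [iY Yb]; split.
  by have := integrableD measurableT iX iY; exact: eq_integrable.
have := integralD measurableT iX iY => /= e.
by under eq_integral do rewrite EFinD; rewrite e EFinD leeD.
Qed.

Lemma mean_leZ X a k : 0 <= k -> mean_le X a ->
  mean_le (fun w => k * X w) (k * a).
Proof.
move=> k0 [iX Xa]; split.
  by have := integrableZl measurableT k iX; exact: eq_integrable.
have := integralZl measurableT iX k => /= e.
by under eq_integral do rewrite EFinM; rewrite e EFinM lee_wpmul2l.
Qed.

Lemma mean_le_cst c : mean_le (fun=> c) c.
Proof.
split; first exact: finite_measure_integrable_cst.
by rewrite integral_cst //= probability_setT mule1.
Qed.

Lemma mean_leW X a b : a <= b -> mean_le X a -> mean_le X b.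
Proof. by move=> ab [iX Xa]; split=> //; apply: le_trans Xa _; rewrite lee_fin. Qed.

Lemma mean_le_eq X Y a : (forall w, X w = Y w) -> mean_le X a -> mean_le Y a.
Proof. by move=> /funext ->. Qed.

Lemma mean_le_dominated X Y a : measurable_fun setT X ->
  (forall w, 0 <= X w) -> (forall w, X w <= Y w) -> mean_le Y a -> mean_le X a.
Proof.
move=> mX X0 XY [iY Ya].
have iX : P.-integrable setT (EFin \o X).
  apply: le_integrable iY => //; first exact/measurable_EFinP.
  move=> w _ /=; rewrite lee_fin !ger0_norm //.
  exact: le_trans (X0 w) (XY w).
split=> //; apply: le_trans Ya; apply: le_integral => // w _.
by rewrite lee_fin.
Qed.

Lemma mean_le_bounded X B : measurable_fun setT X ->
  (forall w, 0 <= X w <= B) -> mean_le X B.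
Proof.
move=> mX XB; apply: mean_le_dominated (mean_le_cst B) => // w.
  by have /andP[] := XB w.
by have /andP[] := XB w.
Qed.

Definition omeas (n : nat) (F : set (Om -> R)) (X : Om -> 'rV[R]_n) : Prop :=
  @vmeas R _ (observed F) n X.

Lemma omeas_subset (n : nat) F F' (X : Om -> 'rV[R]_n) : F `<=` F' ->
  omeas F X -> omeas F' X.
Proof. by move=> FF' mX i; exact: observed_subset FF' (mX i). Qed.

Lemma omeas_vmeas (n : nat) F (X : Om -> 'rV[R]_n) :
  (forall Y, F Y -> measurable_fun setT Y) -> omeas F X -> vmeas X.
Proof. by move=> mF mX i; exact: observed_measurable mF (mX i). Qed.

Lemma omeas_gen (n : nat) F (X : Om -> 'rV[R]_n) :
  (forall i, F (fun w => X w 0 i)) -> omeas F X.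
Proof. by move=> FX i; exact: observed_gen. Qed.

Lemma omeas_cond_mean (n : nat) F (X Z : Om -> 'rV[R]_n) :
  cond_mean P (sigma_gen F) X Z -> omeas F Z.
Proof. by move=> XZ i; exact: cond_exp_observed (XZ i). Qed.

Lemma cond_second_moment_mean (n : nat) F (X : Om -> 'rV[R]_n) c :
  (forall Y, F Y -> measurable_fun setT Y) ->
  cond_second_moment_le P (sigma_gen F) X c ->
  mean_le (fun w => dot (X w) (X w)) c.
Proof.
move=> mF [V [iX iV _ XV] Vc].
have {}iX : P.-integrable setT (EFin \o (fun w => dot (X w) (X w))).
  apply: eq_integrable iX => // w _ /=; by rewrite enorm_sqr.
split=> //.
have GT : sigma_gen F setT.
  exact: (@measurableT _ (observed F : measurableType _)).
have := XV _ GT; under eq_integral do rewrite enorm_sqr; move=> ->.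
have mV := (measurable_EFinP _ _).1 (measurable_int P iV).
(* Equal to [V] almost everywhere and at most [c] everywhere, which permits a pointwise comparison
   of integrals. *)
pose V' w := Num.min (V w) c.
have mV' : measurable_fun setT V' by apply: measurable_minr.
have -> : (\int[P]_w (V w)%:E = \int[P]_w (V' w)%:E)%E.
  apply: ae_eq_integral => //; [exact/measurable_EFinP|exact/measurable_EFinP|].
  by apply: filterS Vc => w Vw _; rewrite /V' min_l.
have iV' : P.-integrable setT (EFin \o V').
  apply: (@le_integrable _ _ _ _ _ measurableT _
    (EFin \o (fun w => `|V w| + `|c|))) => //.
  - exact/measurable_EFinP.
  - move=> w _; rewrite /= lee_fin [X in _ <= X]ger0_norm ?addr_ge0 //.
    by rewrite /V'; case: (leP (V w) c) => _; rewrite ?lerDl ?lerDr.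
  - have := integrableD measurableT (integrable_abse iV)
      (finite_measure_integrable_cst P `|c| measurableT).
    by apply: eq_integrable => // w _.
have [_ ce] := mean_le_cst c; apply: le_trans ce.
apply: le_integral => //; first exact: finite_measure_integrable_cst.
by move=> w _; rewrite lee_fin ge_min lexx orbT.
Qed.

(** By coordinates: each product is dominated by the sum of the two squared norms, hence integrable,
    and [cond_exp_orthogonal] applies. *)
Lemma noise_orthogonal (n : nat) F (X Z U : Om -> 'rV[R]_n) a b :
  (forall Y, F Y -> measurable_fun setT Y) ->
  cond_mean P (sigma_gen F) X Z -> omeas F U ->
  mean_le (fun w => dot (U w) (U w)) a ->
  mean_le (fun w => dot (X w - Z w) (X w - Z w)) b ->
  forall k : R, mean_le (fun w => k * dot (X w - Z w) (U w)) 0.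
Proof.
move=> mF XZ mU [iU _] [iD _] k.
have iS : P.-integrable setT
    (EFin \o (fun w => dot (U w) (U w) + dot (X w - Z w) (X w - Z w))).
  by have := integrableD measurableT iU iD; exact: eq_integrable.
have mU' := omeas_vmeas mF mU.
have mD i : measurable_fun setT (fun w => X w 0 i - Z w 0 i).
  case: (XZ i) => iX iZ _ _; apply: measurable_funB.
    exact: (measurable_EFinP _ _).1 (measurable_int P iX).
  exact: (measurable_EFinP _ _).1 (measurable_int P iZ).
have ii i : P.-integrable setT
    (EFin \o (fun w => U w 0 i * (X w 0 i - Z w 0 i))).
  apply: le_integrable iS => //; first exact/measurable_EFinP/measurable_funM.
  move=> w _; rewrite /= lee_fin normrM [X in _ <= X]ger0_norm; last first.
    by rewrite addr_ge0 ?dot_ge0.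
  have h1 := enorm_coord (U w) i; have := enorm_coord (X w - Z w) i.
  rewrite !mxE => h2; apply: le_trans (ler_pM _ _ h1 h2) _ => //.
  rewrite -!enorm_sqr; have := sqr_ge0 (enorm (U w) - enorm (X w - Z w)).
  have := sqr_ge0 (enorm (U w) + enorm (X w - Z w)); nra.
have i0 i : (\int[P]_w (U w 0 i * (X w 0 i - Z w 0 i))%:E = 0)%E.
  exact: cond_exp_orthogonal mF (XZ i) (mU i) (ii i).
have e w : k * dot (X w - Z w) (U w) =
    \sum_i k * (U w 0 i * (X w 0 i - Z w 0 i)).
  rewrite /dot mulr_sumr; apply: eq_bigr => i _; rewrite !mxE.
  by rewrite [X in _ * X = _]mulrC.
have iki i : P.-integrable setT
    (fun w => (k * (U w 0 i * (X w 0 i - Z w 0 i)))%:E).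
  by have := integrableZl measurableT k (ii i); exact: eq_integrable.
split.
  have : P.-integrable setT
      (fun w => \sum_i (k * (U w 0 i * (X w 0 i - Z w 0 i)))%:E)%E.
    by apply: integrable_sum => // i _; exact: iki.
  by apply: eq_integrable => // w _; rewrite /= e sumEFin.
under eq_integral do rewrite e -sumEFin.
rewrite (integral_sum measurableT iki) big1 // => i _.
have := integralZl measurableT (ii i) k; rewrite /= i0 mule0 => <-.
by apply: eq_integral.
Qed.

End mean_bounds.

Lemma bounded_compact (R : realType) (n : nat) (C : set 'rV[R]_n) :
  compact C -> C !=set0 -> exists B, forall x z, C x -> C z ->
  dot (x - z) (x - z) <= B.
Proof.
move=> cC C0; have := @compact_min R n C (fun x => - dot (x - 0) (x - 0)) cC C0.
case=> [|p _ hp].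
  apply: lsc_on_continuous => x _; apply: continuousN; exact: continuous_dotB.
exists (4 * dot p p) => x z /hp; rewrite !subr0 => h1 /hp; rewrite !subr0 => h2.
by have := dot_ge0 (x + z); rewrite !dotE (dotC z x); lra.
Qed.

(** * The mean of the noise error *)

Section upper_means.
Context (R : realType) (d : measure_display) (Om : measurableType d).
Context (P : probability Om R).
Implicit Types (X Y : Om -> R).

(* X itself need not be measurable. *)
Definition mean_ub X (c : R) : Prop :=
  exists2 Y, (forall w, X w <= Y w) & mean_le P Y c.

Lemma mean_ub_le X c : mean_le P X c -> mean_ub X c.
Proof. by exists X. Qed.

Lemma mean_ub_dominated X Y c : (forall w, X w <= Y w) ->
  mean_ub Y c -> mean_ub X c.
Proof. by move=> XY [Z YZ Zc]; exists Z => // w; exact: le_trans (XY w) (YZ w). Qed.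

Lemma mean_ubW X a b : a <= b -> mean_ub X a -> mean_ub X b.
Proof. by move=> ab [Y XY Ya]; exists Y => //; exact: mean_leW ab Ya. Qed.

Lemma mean_ubD X Y a b : mean_ub X a -> mean_ub Y b ->
  mean_ub (fun w => X w + Y w) (a + b).
Proof.
move=> [X' XX' Xa] [Y' YY' Yb]; exists (fun w => X' w + Y' w).
  by move=> w; rewrite lerD.
exact: mean_leD.
Qed.

Lemma mean_ubZ X a k : 0 <= k -> mean_ub X a -> mean_ub (fun w => k * X w) (k * a).
Proof.
move=> k0 [Y XY Ya]; exists (fun w => k * Y w); last exact: mean_leZ.
by move=> w; rewrite ler_wpM2l.
Qed.

Lemma mean_ub_sum N (X : nat -> Om -> R) (a : R) :
  (forall k, (k < N)%N -> mean_ub (X k) a) ->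
  mean_ub (fun w => \sum_(k < N) X k w) (N%:R * a).
Proof.
elim: N => [|N IH] h.
  rewrite mul0r; apply: mean_ub_le.
  by apply: mean_le_eq (mean_le_cst P 0) => w; rewrite big_ord0.
rewrite -natr1 mulrDl mul1r.
have -> : (fun w => \sum_(k < N.+1) X k w) = fun w => \sum_(k < N) X k w + X N w.
  by apply/funext => w; rewrite big_ord_recr.
by apply: mean_ubD; [apply: IH => k kN; apply: h; rewrite ltnW|exact: h].
Qed.

End upper_means.

(** The arithmetic of [dist_yy]: [A], [B], [c] are the norms of [wy k], [wy k.+1], [wx k], while
    [d1] and [d2] are the distances of the iterates from [yh k] and [xhh k]. The constant is 9 = 2 +
    4 + 2 + 1. *)
Lemma ystep_arith (R : realType) (s L M t A B c d1 d2 e E : R) :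
  0 <= s -> 0 <= A -> 0 <= L -> 0 <= M -> s * L <= 1 -> s * M <= 1 / 2 ->
  d1 <= 2 * s * A -> d2 <= t * c + 2 * s * A -> e <= L * d2 + M * d1 ->
  E <= 2 * B + (2 * e + A) ->
  d1 + s * E <= 9 * s * A + 2 * s * B + 2 * (s * L) * (t * c).
Proof.
move=> s0 A0 L0 M0 sL sM h1 h2 h3 h4.
have h5 := ler_wpM2l s0 h3; have h6 := ler_wpM2l (mulr_ge0 s0 L0) h2.
have h7 := ler_wpM2l (mulr_ge0 s0 M0) h1; have sA := mulr_ge0 s0 A0.
have h8 := ler_wpM2r sA sL; have h9 := ler_wpM2r sA sM.
have := ler_wpM2l s0 h4; lra.
Qed.

Section call_noise.
Context (R : realType) (n m : nat) (C : set 'rV[R]_n) (D : set 'rV[R]_m).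
Context (F : 'rV[R]_n -> R) (G : 'rV[R]_m -> R).
Context (Phi : 'rV[R]_n -> 'rV[R]_m -> R) (gamma mu Lxx Lxy Lyx Lyy : R).
Hypothesis SP : saddle_problem C D F G Phi gamma mu Lxx Lxy Lyx Lyy.
Context (tau sigma : R).
Hypotheses (tau0 : 0 < tau) (sigma0 : 0 < sigma).
Hypotheses (tauE : tau <= 1 / (Lyx + Lxx + 2 * gamma)) (tauE2 : tau <= 1 / Lxy).
Hypothesis sigmaE : sigma <= 1 / (Lyx + 2 * Lyy).
Context (pf : 'rV[R]_n -> 'rV[R]_n) (pg : 'rV[R]_m -> 'rV[R]_m).
Hypotheses (pfP : forall z, prox_point C F tau z (pf z)).
Hypotheses (pgP : forall z, prox_point D G sigma z (pg z)).

Context (d : measure_display) (Om : measurableType d) (P : probability Om R).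
Context (N : nat) (Fx Fy : nat -> set (Om -> R)).
Hypothesis mFx : forall k, (k < N)%N -> forall Y, Fx k Y -> measurable_fun setT Y.
Hypothesis mFy : forall k, (k <= N)%N -> forall Y, Fy k Y -> measurable_fun setT Y.
Hypothesis Fyx : forall k, (k < N)%N -> Fy k `<=` Fx k.
Hypothesis Fxy : forall k, (k < N)%N -> Fx k `<=` Fy k.+1.
Context (xs ax : nat -> Om -> 'rV[R]_n) (ys ay : nat -> Om -> 'rV[R]_m).
Hypotheses (x0m : omeas (Fy 0%N) (xs 0%N)) (y0m : omeas (Fy 0%N) (ys 0%N)).
Hypotheses (x0C : forall w, C (xs 0%N w)) (y0D : forall w, D (ys 0%N w)).
Hypothesis ysS : forall k w,
  ys k.+1 w = pg (ys k w + sigma *: (2 *: ay k w - ay k.-1 w)).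
Hypothesis xsS : forall k w, xs k.+1 w =
  pf (xs k w - tau *: (ax k w + (gamma + gamma) *: (xs k w - xs 0%N w))).
Hypothesis axF : forall k, (k < N)%N -> forall i, Fy k.+1 (fun w => ax k w 0 i).
Hypothesis ayF : forall k, (k < N)%N -> forall i, Fx k (fun w => ay k w 0 i).
Context (dx dy : R).
Let gx k w := grad_x Phi (xs k w) (ys k.+1 w).
Let gy k w := grad_y Phi (xs k w) (ys k w).
Hypothesis meanx : forall k, (k < N)%N ->
  cond_mean P (sigma_gen (Fx k)) (ax k) (gx k).
Hypothesis meany : forall k, (k < N)%N ->
  cond_mean P (sigma_gen (Fy k)) (ay k) (gy k).
Let wx k w := ax k w - gx k w.
Let wy k w := ay k w - gy k w.
Hypothesis varx : forall k, (k < N)%N ->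
  mean_le P (fun w => dot (wx k w) (wx k w)) dx.
Hypothesis vary : forall k, (k < N)%N ->
  mean_le P (fun w => dot (wy k w) (wy k w)) dy.

Let pfC z : C (pf z). Proof. by case: (pfP z). Qed.
Let pgD z : D (pg z). Proof. by case: (pgP z). Qed.

Let Cx k w : C (xs k w).
Proof. by case: k => // k; rewrite xsS; exact: pfC. Qed.

Let Dy k w : D (ys k w).
Proof. by case: k => // k; rewrite ysS; exact: pgD. Qed.

Let g0 : 0 < gamma. Proof. by case: SP. Qed.

Let xsE k : xs k.+1 = (fun w =>
  pf (xs k w - tau *: (ax k w + (gamma + gamma) *: (xs k w - xs 0%N w)))).
Proof. exact/funext/xsS. Qed.

Let ysE k : ys k.+1 = (fun w =>
  pg (ys k w + sigma *: (2 *: ay k w - ay k.-1 w))).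
Proof. exact/funext/ysS. Qed.

Lemma Fy_mono j k : (j <= k)%N -> (k <= N)%N -> Fy j `<=` Fy k.
Proof.
elim: k => [|k IH]; first by rewrite leqn0 => /eqP -> _ Y.
rewrite leq_eqVlt => /predU1P[-> _ Y //|jk kN].
by move=> Y /(IH jk (ltnW kN)) /(Fyx kN) /(Fxy kN).
Qed.

Lemma omeas_pf (H : set (Om -> R)) (X : Om -> 'rV[R]_n) :
  omeas H X -> omeas H (fun w => pf (X w)).
Proof.
move=> mX; have L x z : [set: 'rV[R]_n] x -> [set: 'rV[R]_n] z ->
    enorm (pf x - pf z) <= 1 * enorm (x - z).
  by move=> _ _; rewrite mul1r; exact: prox_point_lipschitz tau0 (pfP x) (pfP z).
exact: (vmeas_lipschitz ler01 L mX).
Qed.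

Lemma omeas_pg (H : set (Om -> R)) (X : Om -> 'rV[R]_m) :
  omeas H X -> omeas H (fun w => pg (X w)).
Proof.
move=> mX; have L x z : [set: 'rV[R]_m] x -> [set: 'rV[R]_m] z ->
    enorm (pg x - pg z) <= 1 * enorm (x - z).
  by move=> _ _; rewrite mul1r; exact: prox_point_lipschitz sigma0 (pgP x) (pgP z).
exact: (vmeas_lipschitz ler01 L mX).
Qed.

Lemma omeas_grad_x (H : set (Om -> R)) (X : Om -> 'rV[R]_n)
    (Y : Om -> 'rV[R]_m) : omeas H X -> omeas H Y ->
  (forall w, C (X w)) -> (forall w, D (Y w)) ->
  omeas H (fun w => grad_x Phi (X w) (Y w)).
Proof.
move=> mX mY CX DY.
exact: (vmeas_pair_lipschitz (sp_Lxx SP) (ltW (sp_Lxy SP)) (sp_lip_x SP)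
  mX mY CX DY).
Qed.

Lemma omeas_grad_y (H : set (Om -> R)) (X : Om -> 'rV[R]_n)
    (Y : Om -> 'rV[R]_m) : omeas H X -> omeas H Y ->
  (forall w, C (X w)) -> (forall w, D (Y w)) ->
  omeas H (fun w => grad_y Phi (X w) (Y w)).
Proof.
move=> mX mY CX DY.
exact: (vmeas_pair_lipschitz (ltW (sp_Lyx SP)) (sp_Lyy SP) (sp_lip_y SP)
  mX mY CX DY).
Qed.

Lemma omeas_xstep (H : set (Om -> R)) (X U X0 : Om -> 'rV[R]_n) :
  omeas H X -> omeas H U -> omeas H X0 ->
  omeas H (fun w => pf (X w - tau *: (U w + (gamma + gamma) *: (X w - X0 w)))).
Proof.
move=> mX mU mX0; apply: omeas_pf; apply: vmeasB => //; apply: vmeasZ.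
by apply: vmeasD => //; apply: vmeasZ; exact: vmeasB.
Qed.

Lemma omeas_ystep (H : set (Om -> R)) (X U V : Om -> 'rV[R]_m) :
  omeas H X -> omeas H U -> omeas H V ->
  omeas H (fun w => pg (X w + sigma *: (2 *: U w - V w))).
Proof.
move=> mX mU mV; apply: omeas_pg; apply: vmeasD => //; apply: vmeasZ.
by apply: vmeasB => //; exact: vmeasZ.
Qed.

Lemma omeas_ay k : (k < N)%N -> omeas (Fx k) (ay k).
Proof. by move=> kN; exact: omeas_gen (ayF kN). Qed.

Lemma omeas_ax k : (k < N)%N -> omeas (Fy k.+1) (ax k).
Proof. by move=> kN; exact: omeas_gen (axF kN). Qed.

Lemma omeas_ay_prev k : (k < N)%N -> omeas (Fx k) (ay k.-1).
Proof.
case: k => [|k] kN; first exact: omeas_ay.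
apply: omeas_subset (omeas_ay (ltnW kN)) => Y.
by move=> /(Fxy (ltnW kN)) /(Fyx kN).
Qed.

Lemma omeas_iterates k : (k <= N)%N ->
  omeas (Fy k) (xs k) /\ omeas (Fy k) (ys k).
Proof.
elim: k => // k IH kN; have [mx my] := IH (ltnW kN); split.
  rewrite xsE; apply: omeas_xstep; [|exact: omeas_ax|].
    by apply: omeas_subset mx; exact: Fy_mono.
  by apply: omeas_subset x0m; exact: Fy_mono.
rewrite ysE.
apply: omeas_subset (Fxy kN) _.
apply: omeas_ystep; [|exact: omeas_ay|exact: omeas_ay_prev].
exact: omeas_subset (Fyx kN) my.
Qed.

(* The iterates that exact gradients would have produced.  yh k and xh k remove
   the noise of the current query from ys k.+1 and xs k.+1.  Through the momentum
   wy k also acts on ys k.+2; yt k removes it from there, using xhh k as the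
   corresponding version of xs k.+1. *)
Let b k w := if k is j.+1 then ay j w else gy 0%N w.
Let yh k w := pg (ys k w + sigma *: (2 *: gy k w - b k w)).
Let xh k w := pf (xs k w - tau *: (gx k w + (gamma + gamma) *: (xs k w - xs 0%N w))).
Let xhh k w := pf (xs k w - tau *: (grad_x Phi (xs k w) (yh k w)
                    + (gamma + gamma) *: (xs k w - xs 0%N w))).
Let yt k w := pg (yh k w + sigma *: (2 *: grad_y Phi (xhh k w) (yh k w) - gy k w)).

Let yhD k w : D (yh k w). Proof. exact: pgD. Qed.
Let xhhC k w : C (xhh k w). Proof. exact: pfC. Qed.
Let xhC k w : C (xh k w). Proof. exact: pfC. Qed.
Let ytD k w : D (yt k w). Proof. exact: pgD. Qed.

Let omeas_gy k : (k < N)%N -> omeas (Fy k) (gy k).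
Proof. by move=> kN; exact: omeas_cond_mean (meany kN). Qed.

Let omeas_gx k : (k < N)%N -> omeas (Fx k) (gx k).
Proof. by move=> kN; exact: omeas_cond_mean (meanx kN). Qed.

Let omeas_yh k : (k < N)%N -> omeas (Fy k) (yh k).
Proof.
move=> kN; have [_ my] := omeas_iterates (ltnW kN).
apply: omeas_ystep => //; first exact: omeas_gy.
case: k kN {my} => [|k] kN; first exact: omeas_gy.
exact: omeas_subset (Fxy (ltnW kN)) (omeas_ay (ltnW kN)).
Qed.

Let omeas_xh k : (k < N)%N -> omeas (Fx k) (xh k).
Proof.
move=> kN; have [mx _] := omeas_iterates (ltnW kN).
apply: omeas_xstep; [exact: omeas_subset (Fyx kN) mx|exact: omeas_gx|].
by apply: omeas_subset x0m => Y /(Fy_mono (leq0n k) (ltnW kN)) /(Fyx kN).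
Qed.

Let omeas_xhh k : (k < N)%N -> omeas (Fy k) (xhh k).
Proof.
move=> kN; have [mx _] := omeas_iterates (ltnW kN).
apply: omeas_xstep => //.
  by apply: omeas_grad_x => //; exact: omeas_yh.
by apply: omeas_subset x0m; exact: Fy_mono (ltnW kN).
Qed.

Let omeas_yt k : (k < N)%N -> omeas (Fy k) (yt k).
Proof.
move=> kN; apply: omeas_ystep; [exact: omeas_yh| |exact: omeas_gy].
by apply: omeas_grad_y => //; [exact: omeas_xhh|exact: omeas_yh].
Qed.

Let xstep_diff x u u' c :
  enorm (pf (x - tau *: (u + c)) - pf (x - tau *: (u' + c))) <=
  tau * enorm (u - u').
Proof.
apply: le_trans (prox_point_lipschitz tau0 (pfP _) (pfP _)) _.
rewrite opprB addrC addrA subrK -scalerBr enormZ gtr0_norm //.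
by rewrite opprD addrACA subrr addr0 enormB.
Qed.

Let ystep_diff y y' s s' :
  enorm (pg (y + sigma *: s) - pg (y' + sigma *: s')) <=
  enorm (y - y') + sigma * enorm (s - s').
Proof.
apply: le_trans (prox_point_lipschitz sigma0 (pgP _) (pgP _)) _.
rewrite opprD addrACA -scalerBr; apply: le_trans (enormD _ _) _.
by rewrite enormZ gtr0_norm.
Qed.

Let dist_x k w : enorm (xs k.+1 w - xh k w) <= tau * enorm (wx k w).
Proof. by rewrite xsS; exact: xstep_diff. Qed.

Let dist_y k w : enorm (ys k.+1 w - yh k w) <= 2 * sigma * enorm (wy k w).
Proof.
rewrite ysS; apply: le_trans (ystep_diff _ _ _ _) _.
rewrite subrr enorm0 add0r (mulrC 2) -mulrA ler_pM2l //.
(* In the first iteration the extrapolated answer is [ay 0] itself, so its noise enters once instead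
   of twice. *)
case: k => [|k] /=.
  have -> : 2 *: ay 0%N w - ay 0%N w - (2 *: gy 0%N w - gy 0%N w) = wy 0%N w.
    by rewrite !scaler_nat !mulr2n !addrK.
  by have := enorm_ge0 (wy 0%N w); lra.
have -> : 2 *: ay k.+1 w - ay k w - (2 *: gy k.+1 w - ay k w) = 2 *: wy k.+1 w.
  by rewrite opprB addrA subrK scalerBr.
by rewrite enormZ normr_nat.
Qed.

Let sL : sigma * Lyx <= 1.
Proof.
have [Lyx0 Lyy0] := conj (sp_Lyx SP) (sp_Lyy SP).
have := sigmaE; rewrite ler_pdivlMr; last lra.
by have := mulr_ge0 (ltW sigma0) Lyy0; lra.
Qed.

Let sLy : sigma * Lyy <= 1 / 2.
Proof.
have [Lyx0 Lyy0] := conj (sp_Lyx SP) (sp_Lyy SP).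
have := sigmaE; rewrite ler_pdivlMr; last lra.
by have := mulr_ge0 (ltW sigma0) (ltW Lyx0); lra.
Qed.

Let tL : tau * Lyx <= 1.
Proof.
have [[Lyx0 Lxx0] g1] := conj (conj (sp_Lyx SP) (sp_Lxx SP)) g0.
have := tauE; rewrite ler_pdivlMr; last lra.
have := mulr_ge0 (ltW tau0) Lxx0; have := mulr_ge0 (ltW tau0) (ltW g1); lra.
Qed.

Let tLxy : tau * Lxy <= 1.
Proof. by have := tauE2; rewrite ler_pdivlMr ?(sp_Lxy SP). Qed.

(** The x-step reacts to the y-noise through [grad_x]; the condition [tau * Lxy <= 1] keeps that
    reaction from amplifying it. *)
Let dist_xx k w : enorm (xs k.+1 w - xhh k w) <=
  tau * enorm (wx k w) + 2 * sigma * enorm (wy k w).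
Proof.
rewrite xsS; apply: le_trans (xstep_diff _ _ _ _) _.
apply: le_trans (ler_wpM2l (ltW tau0) (enorm_le_add _ (gx k w) _)) _.
rewrite mulrDr lerD2l.
have := sp_lip_x SP (Cx k w) (Cx k w) (Dy k.+1 w) (yhD k w).
rewrite subrr enorm0 mulr0 add0r => h.
apply: le_trans (ler_wpM2l (ltW tau0) h) _.
rewrite mulrA; apply: le_trans (ler_wpM2r (enorm_ge0 _) tLxy) _.
by rewrite mul1r.
Qed.

Let dist_yy k w : enorm (ys k.+2 w - yt k w) <=
  9 * sigma * enorm (wy k w) + 2 * sigma * enorm (wy k.+1 w)
  + 2 * (sigma * Lyx) * (tau * enorm (wx k w)).
Proof.
rewrite ysS; apply: le_trans (ystep_diff _ _ _ _) _ => /=.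
have h1 := dist_y k w; have h2 := dist_xx k w.
have h3 := sp_lip_y SP (Cx k.+1 w) (xhhC k w) (Dy k.+1 w) (yhD k w).
set g := grad_y Phi (xhh k w) (yh k w) in h3 *.
have -> : 2 *: ay k.+1 w - ay k w - (2 *: g - gy k w) =
    2 *: wy k.+1 w + (2 *: (gy k.+1 w - g) - wy k w).
  rewrite /wy; move: (ay _ w) (ay k w) (gy _ w) (gy k w) => a1 a2 g1 g2.
  by apply/rowP => i; rewrite !mxE; ring.
have h4 : enorm (2 *: wy k.+1 w + (2 *: (gy k.+1 w - g) - wy k w)) <=
    2 * enorm (wy k.+1 w) + (2 * enorm (gy k.+1 w - g) + enorm (wy k w)).
  apply: le_trans (enormD _ _) _; rewrite enormZ normr_nat lerD2l.
  by apply: le_trans (enormD _ _) _; rewrite enormZ normr_nat enormN.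
exact: (ystep_arith (ltW sigma0) (enorm_ge0 _) (ltW (sp_Lyx SP)) (sp_Lyy SP)
  sL sLy h1 h2 h3 h4).
Qed.

Context (BC BD : R).
Hypothesis BCP : forall x z, C x -> C z -> dot (x - z) (x - z) <= BC.
Hypothesis BDP : forall y z, D y -> D z -> dot (y - z) (y - z) <= BD.

(** The test vector joins two points of the compact domain, so its square is bounded and thus
    integrable. *)
Let mean_x k (U : Om -> 'rV[R]_n) (c : R) : (k < N)%N -> omeas (Fx k) U ->
  (forall w, C (U w)) -> mean_le P (fun w => c * dot (wx k w) (U w - xs 0%N w)) 0.
Proof.
move=> kN mU CU.
have mV : omeas (Fx k) (fun w => U w - xs 0%N w).
  apply: vmeasB => //.
  by apply: omeas_subset x0m => Y /(Fy_mono (leq0n k) (ltnW kN)) /(Fyx kN).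
apply: (noise_orthogonal (mFx kN) (meanx kN) mV _ (varx kN)).
apply: (@mean_le_bounded _ _ _ P _ BC).
  have mV' := omeas_vmeas (mFx kN) mV; exact: measurable_dot.
by move=> w; rewrite dot_ge0 BCP.
Qed.

Let mean_y k (U : Om -> 'rV[R]_m) (c : R) : (k < N)%N -> omeas (Fy k) U ->
  (forall w, D (U w)) -> mean_le P (fun w => c * dot (wy k w) (U w - ys 0%N w)) 0.
Proof.
move=> kN mU DU.
have mV : omeas (Fy k) (fun w => U w - ys 0%N w).
  by apply: vmeasB => //; apply: omeas_subset y0m; exact: Fy_mono (ltnW kN).
apply: (noise_orthogonal (mFy (ltnW kN)) (meany kN) mV _ (vary kN)).
apply: (@mean_le_bounded _ _ _ P _ BD).
  have mV' := omeas_vmeas (mFy (ltnW kN)) mV; exact: measurable_dot.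
by move=> w; rewrite dot_ge0 BDP.
Qed.

Let dx0 : (0 < N)%N -> 0 <= dx.
Proof.
move=> N0; have [_ h] := varx N0; rewrite -lee_fin; apply: le_trans h.
by apply: integral_ge0 => w _; rewrite lee_fin dot_ge0.
Qed.

Let dy0 : (0 < N)%N -> 0 <= dy.
Proof.
move=> N0; have [_ h] := vary N0; rewrite -lee_fin; apply: le_trans h.
by apply: integral_ge0 => w _; rewrite lee_fin dot_ge0.
Qed.

Let term_x k : (k < N)%N ->
  mean_ub P (fun w => - dot (wx k w) (xs k.+1 w - xs 0%N w)) (tau * dx).
Proof.
move=> kN; rewrite -[_ * dx]addr0.
apply: mean_ub_dominated (mean_ubD (mean_ub_le (mean_leZ (ltW tau0) (varx kN)))
  (mean_ub_le (mean_x (-1) kN (omeas_xh kN) (xhC k)))) => w.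
have -> : xs k.+1 w - xs 0%N w = (xs k.+1 w - xh k w) + (xh k w - xs 0%N w).
  by rewrite addrA subrK.
rewrite dotDr -enorm_sqr.
have := dot_le_enorm (- wx k w) (xs k.+1 w - xh k w); rewrite enormN dotNl => h.
have := ler_wpM2l (enorm_ge0 (wx k w)) (dist_x k w).
by move: h; lra.
Qed.

Let term_y k : (k < N)%N ->
  mean_ub P (fun w => 2 * dot (wy k w) (ys k.+1 w - ys 0%N w)) (4 * sigma * dy).
Proof.
move=> kN; rewrite -[_ * dy]addr0.
have s4 : 0 <= 4 * sigma by rewrite mulr_ge0 // ltW.
apply: mean_ub_dominated (mean_ubD (mean_ub_le (mean_leZ s4 (vary kN)))
  (mean_ub_le (mean_y 2 kN (omeas_yh kN) (yhD k)))) => w.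
have -> : ys k.+1 w - ys 0%N w = (ys k.+1 w - yh k w) + (yh k w - ys 0%N w).
  by rewrite addrA subrK.
rewrite dotDr -enorm_sqr.
have h := dot_le_enorm (wy k w) (ys k.+1 w - yh k w).
have := ler_wpM2l (enorm_ge0 (wy k w)) (dist_y k w).
by move: h; lra.
Qed.

Let term_y_prev k : (k < N)%N ->
  mean_ub P (fun w => - dot (wy k.-1 w) (ys k.+1 w - ys 0%N w))
    (tau * dx + 12 * sigma * dy).
Proof.
case: k => [|k] kN /=.
  have s2 : 0 <= 2 * sigma by rewrite mulr_ge0 // ltW.
  apply: (@mean_ubW _ _ _ _ _ (2 * sigma * dy + 0)).
    have := mulr_ge0 (ltW tau0) (dx0 kN); have := mulr_ge0 (ltW sigma0) (dy0 kN).
    lra.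
  apply: mean_ub_dominated (mean_ubD (mean_ub_le (mean_leZ s2 (vary kN)))
    (mean_ub_le (mean_y (-1) kN (omeas_yh kN) (yhD 0%N)))) => w.
  have -> : ys 1%N w - ys 0%N w = (ys 1%N w - yh 0%N w) + (yh 0%N w - ys 0%N w).
    by rewrite addrA subrK.
  rewrite dotDr -enorm_sqr.
  have := dot_le_enorm (- wy 0%N w) (ys 1%N w - yh 0%N w).
  rewrite enormN dotNl => h.
  have := ler_wpM2l (enorm_ge0 (wy 0%N w)) (dist_y 0%N w).
  by move: h; lra.
have k1 := ltnW kN.
have s11 : 0 <= 11 * sigma by rewrite mulr_ge0 // ltW.
have -> : tau * dx + 12 * sigma * dy =
    11 * sigma * dy + (sigma * dy + (tau * dx + 0)) by ring.
apply: mean_ub_dominated (mean_ubD (mean_ub_le (mean_leZ s11 (vary k1)))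
  (mean_ubD (mean_ub_le (mean_leZ (ltW sigma0) (vary kN)))
  (mean_ubD (mean_ub_le (mean_leZ (ltW tau0) (varx k1)))
  (mean_ub_le (mean_y (-1) k1 (omeas_yt k1) (ytD k)))))) => w.
have -> : ys k.+2 w - ys 0%N w = (ys k.+2 w - yt k w) + (yt k w - ys 0%N w).
  by rewrite addrA subrK.
rewrite dotDr -[dot (wy k w) (wy k w)]enorm_sqr
  -[dot (wy k.+1 w) (wy k.+1 w)]enorm_sqr -[dot (wx k w) (wx k w)]enorm_sqr.
have := dot_le_enorm (- wy k w) (ys k.+2 w - yt k w); rewrite enormN dotNl => h.
have h1 := ler_wpM2l (enorm_ge0 (wy k w)) (dist_yy k w).
set a := enorm (wy k w) in h h1 *; set b' := enorm (wy k.+1 w) in h1 *.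
set c := enorm (wx k w) in h1 *.
(* Young's inequality on the two mixed products in the bound of [dist_yy] adds 1 + 1 to the 9; the
   mixed x-y product is split using [sigma * Lyx <= 1] and [tau * Lyx <= 1]. *)
have h2 := mulr_ge0 (ltW sigma0) (sqr_ge0 (a - b')).
have h3 := mulr_ge0 (mulr_ge0 (mulr_ge0 (ltW sigma0) (ltW (sp_Lyx SP)))
  (ltW tau0)) (sqr_ge0 (a - c)).
have h4 := ler_wpM2r (mulr_ge0 (ltW tau0) (sqr_ge0 c)) sL.
have h5 := ler_wpM2r (mulr_ge0 (ltW sigma0) (sqr_ge0 a)) tL.
by lra.
Qed.

(** The partial sum is known before the next query, so cross terms have mean zero and second moments
    add up: growth is linear in [M], as for martingale differences. *)
Let sum_wx M : (M <= N)%N -> mean_le P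
  (fun w => dot (\sum_(k < M) wx k w) (\sum_(k < M) wx k w)) (M%:R * dx).
Proof.
elim: M => [|M IH] MN.
  rewrite mul0r; apply: mean_le_eq (mean_le_cst P 0) => w.
  by rewrite big_ord0 dot0l.
have mW : omeas (Fx M) (fun w => \sum_(k < M) wx k w).
  apply: vmeas_sum => k kM; have kN := ltn_trans kM MN.
  apply: vmeasB.
    apply: omeas_subset (omeas_ax kN) => Y.
    by move=> /(Fy_mono kM (ltnW MN)) /(Fyx MN).
  apply: omeas_subset (omeas_gx kN) => Y /(Fxy kN).
  by move=> /(Fy_mono kM (ltnW MN)) /(Fyx MN).
have IH' := IH (ltnW MN).
have h := noise_orthogonal (mFx MN) (meanx MN) mW IH' (varx MN) 2.
have -> : M.+1%:R * dx = M%:R * dx + 0 + dx by rewrite -natr1; ring.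
apply: mean_le_eq (mean_leD (mean_leD IH' h) (varx MN)) => w.
rewrite !big_ord_recr /= -/(wx M w).
move: (\sum_(k < M) wx k w) (wx M w) => s a.
by rewrite !dotE (dotC s a); ring.
Qed.

Let sum_wy M : (M <= N)%N -> mean_le P
  (fun w => dot (\sum_(k < M) wy k w) (\sum_(k < M) wy k w)) (M%:R * dy).
Proof.
elim: M => [|M IH] MN.
  rewrite mul0r; apply: mean_le_eq (mean_le_cst P 0) => w.
  by rewrite big_ord0 dot0l.
have mW : omeas (Fy M) (fun w => \sum_(k < M) wy k w).
  apply: vmeas_sum => k kM; have kN := ltn_trans kM MN.
  apply: vmeasB.
    apply: omeas_subset (omeas_ay kN) => Y /(Fxy kN).
    by move=> /(Fy_mono kM (ltnW MN)).
  by apply: omeas_subset (omeas_gy kN); exact: Fy_mono (ltnW kM) (ltnW MN).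
have IH' := IH (ltnW MN).
have h := noise_orthogonal (mFy (ltnW MN)) (meany MN) mW IH' (vary MN) 2.
have -> : M.+1%:R * dy = M%:R * dy + 0 + dy by rewrite -natr1; ring.
apply: mean_le_eq (mean_leD (mean_leD IH' h) (vary MN)) => w.
rewrite !big_ord_recr /= -/(wy M w).
move: (\sum_(k < M) wy k w) (wy M w) => s a.
by rewrite !dotE (dotC s a); ring.
Qed.

Lemma call_noise_bound : (0 < N)%N ->
  mean_ub P (fun w => noise_error Phi tau sigma (xs ^~ w) (ax ^~ w)
                        (ys ^~ w) (ay ^~ w) N)
    (N%:R * (3 * (tau * dx) + 21 * (sigma * dy))).
Proof.
move=> N0; have dx1 := dx0 N0; have dy1 := dy0 N0.
have t0 := mulr_ge0 (ltW tau0) dx1; have s0 := mulr_ge0 (ltW sigma0) dy1.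
have h1 : mean_ub P (fun w => \sum_(k < N)
      (- dot (wx k w) (xs k.+1 w - xs 0%N w)
       + (2 * dot (wy k w) (ys k.+1 w - ys 0%N w)
          + - dot (wy k.-1 w) (ys k.+1 w - ys 0%N w))))
    (N%:R * (tau * dx + (4 * sigma * dy + (tau * dx + 12 * sigma * dy)))).
  apply: (@mean_ub_sum _ _ _ P N (fun k w => - dot (wx k w) (xs k.+1 w - xs 0%N w)
       + (2 * dot (wy k w) (ys k.+1 w - ys 0%N w)
          + - dot (wy k.-1 w) (ys k.+1 w - ys 0%N w)))) => k kN.
  exact: mean_ubD (term_x kN) (mean_ubD (term_y kN) (term_y_prev kN)).
have t2 : 0 <= tau / 2 by rewrite divr_ge0 // ltW.
have h2 := mean_ubZ t2 (mean_ub_le (sum_wx (leqnn N))).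
have N1 : (N.-1 < N)%N by rewrite prednK.
have s2 : 0 <= sigma / 2 * 3 by rewrite mulr_ge0 // divr_ge0 // ltW.
have h3 := mean_ubZ s2 (mean_ub_le (mean_leD (sum_wy (leqnn N))
  (mean_leD (vary N1) (vary N0)))).
(* The coefficient of [tau * dx] is 2 + 1/2 per iteration; that of [sigma * dy] is 16 + 3/2, plus 3
   in total for the boundary terms, hence at most 20.5. *)
apply: (@mean_ubW _ _ _ _ _ (N%:R * (tau * dx + (4 * sigma * dy
    + (tau * dx + 12 * sigma * dy))) + tau / 2 * (N%:R * dx)
    + sigma / 2 * 3 * (N%:R * dy + (dy + dy)))).
  have N2 : 1 <= N%:R :> R by rewrite ler1n.
  have := ler_wpM2r t0 N2; have := ler_wpM2r s0 N2; lra.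
apply: mean_ub_dominated (mean_ubD (mean_ubD h1 h2) h3) => w.
rewrite /noise_error.
(* The extrapolated noises telescope up to two boundary terms. *)
have eE M : \sum_(k < M.+1) noise_e Phi (xs ^~ w) (ys ^~ w) (ay ^~ w) k =
    \sum_(k < M.+1) wy k w + wy M w - wy 0%N w.
  elim: M => [|M IH]; first by rewrite !big_ord1 /noise_e scaler_nat mulr2n.
  rewrite big_ord_recr IH [in RHS]big_ord_recr /= /noise_e /=.
  rewrite /noise_y -/(gy M.+1 w) -/(gy M w) -/(wy M.+1 w) -/(wy M w).
  move: (\sum_(k < M.+1) _) (wy M.+1 w) (wy M w) (wy 0%N w) => s a e0 f.
  by apply/rowP => i; rewrite !mxE; ring.
have := eE N.-1; rewrite prednK // => ->.
rewrite -[X in _ <= X]addrA -addrA; apply: lerD.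
  rewrite le_eqVlt; apply/orP; left; apply/eqP.
  apply: eq_bigr => k _; congr (_ + _).
  by rewrite [LHS]dotDl dotNl dotZl.
apply: lerD => //; rewrite -[X in _ <= X]mulrA ler_wpM2l ?divr_ge0 ?(ltW sigma0) //.
(* The square of a sum of three vectors is at most three times the sum of the squares. *)
move: (\sum_(k < N) wy k w) (wy N.-1 w) (wy 0%N w) => s a e0.
have := dot_ge0 (s - a); have := dot_ge0 (s + e0); have := dot_ge0 (a + e0).
rewrite !dotE (dotC a s) (dotC e0 s) (dotC e0 a); lra.
Qed.

End call_noise.

(** * SAPD+ *)

Section instance.
Context (R : realType) (n m : nat).
Context (f : 'rV[R]_n -> \bar R) (g : 'rV[R]_m -> \bar R).
Context (Phi : 'rV[R]_n -> 'rV[R]_m -> R) (gamma mu Lxx Lxy Lyx Lyy : R).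
Hypothesis SA : structural_assumption f g Phi gamma mu.
Hypothesis SM : smoothness_assumption f g Phi Lxx Lxy Lyx Lyy.
Hypotheses (cf : compact (edom f)) (cg : compact (edom g)).
Let F x := fine (f x).
Let G y := fine (g y).

Lemma assumptions_saddle_problem :
  saddle_problem (edom f) (edom g) F G Phi gamma mu Lxx Lxy Lyx Lyy.
Proof.
case: SA => -[pf pg] [gam0 wc] [mu0 sc] [U [oU sU dU]].
case: SM => -[Lxx0 Lyy0] [Lxy0 Lyx0] lx ly.
split => //.
- exact: cvx_edom.
- exact: cvx_edom.
- exact: lsc_fine.
- exact: lsc_fine.
- exact: sconvex_fine.
- exact: sconvex_fine.
- by move=> y Dy; apply: weakly_convex_sconvex; case: (wc y Dy).
- by move=> x Cx; apply: strongly_concave_sconvex; exact: sc.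
- by move=> x y Cx Dy; apply: differentiable_partial_x; apply: dU; exact: sU.
- by move=> x y Cx Dy; apply: differentiable_partial_y; apply: dU; exact: sU.
Qed.

Let SP := assumptions_saddle_problem.
Let pf : proper_closed_convex f. Proof. by case: SA => -[]. Qed.
Let pg : proper_closed_convex g. Proof. by case: SA => -[]. Qed.
Local Notation l := (lagrangian F G Phi).
Local Notation phi := (primal_value (edom g) F G Phi).

Let C0 := edom_nonempty pf.
Let D0 := edom_nonempty pg.

Lemma lagrE x y : edom f x -> edom g y -> lagr f g Phi x y = (l x y)%:E.
Proof. by move=> Cx Dy; rewrite /lagr (edomE pf Cx) (edomE pg Dy). Qed.

Lemma lagrNy x y : edom f x -> ~ edom g y -> lagr f g Phi x y = -oo%E.
Proof. by move=> Cx Dy; rewrite /lagr (edomE pf Cx) (edomN Dy) -EFinD addeC. Qed.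

Lemma lagrNx x y : ~ edom f x -> edom g y -> lagr f g Phi x y = +oo%E.
Proof. by move=> Cx Dy; rewrite /lagr (edomN Cx) (edomE pg Dy) !addye. Qed.

Lemma primalE x : edom f x -> primal f g Phi x = (phi x)%:E.
Proof.
move=> Cx; have [Dy hy] := ymaxP SP D0 Cx.
apply/eqP; rewrite eq_le; apply/andP; split.
  apply: ge_ereal_sup => _ [y _ <-]; have [Dy'|Dy'] := pselect (edom g y).
    by rewrite lagrE // lee_fin; exact: hy.
  by rewrite lagrNy // leNye.
by rewrite -lagrE //; apply: ereal_sup_ubound; exists (ymax (edom g) F G Phi x).
Qed.

Lemma primalN x : ~ edom f x -> primal f g Phi x = +oo%E.
Proof.
move=> Cx; have [y Dy] := D0.
apply/eqP; rewrite -leye_eq -(lagrNx Cx Dy).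
by apply: ereal_sup_ubound; exists y.
Qed.

(** The infimum in the gap carries no proximal term, so it lies below every primal value and below
    the dual value centered at [x0]. The one number [g0] thus controls both initial quantities of
    the outer loop. *)
Lemma gapE x0 y0 : edom f x0 -> edom g y0 -> exists g0 : R,
  [/\ gap f g Phi x0 y0 = g0%:E,
      forall x, edom f x -> phi x0 - phi x <= g0 &
      prox_gap (edom f) (edom g) F G Phi gamma x0 y0 <= g0].
Proof.
move=> Cx Dy; have [xm Cm hm] := compact_min cf C0 (lsc_lagr_x SP Dy).
exists (phi x0 - l xm y0); split.
- rewrite /gap -/(primal f g Phi x0) primalE //.
  suff -> : ereal_inf (range ((lagr f g Phi) ^~ y0)) = (l xm y0)%:E by [].
  apply/eqP; rewrite eq_le; apply/andP; split.
    by rewrite -lagrE //; apply: ereal_inf_lbound; exists xm.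
  apply: le_ereal_inf_tmp => _ [x _ <-]; have [Cx'|Cx'] := pselect (edom f x).
    by rewrite lagrE // lee_fin; exact: hm.
  by rewrite lagrNx // leey.
- move=> x Cx'; rewrite lerD2l lerN2; apply: le_trans (hm x Cx') _.
  by have [_] := ymaxP SP D0 Cx'; apply.
- rewrite lerD2l lerN2; have [Cu _] := xminP SP C0 x0 Dy Cx.
  apply: le_trans (hm _ Cu) _; rewrite lerDl mulr_ge0 ?dot_ge0 //.
  by case: SP => /ltW.
Qed.

Definition grad_vector u : 'rV[R]_n :=
  (2 * gamma) *: (u - prox_primal (edom f) (edom g) F G Phi gamma u).

Lemma grad_moreau_primal u :
  grad_moreau (1 / (2 * gamma)) (primal f g Phi) u = grad_vector u.
Proof.
have pp := prox_primalP SP C0 D0.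
apply: (grad_moreauE (C := edom f) (h := phi)) => //.
- by case: SP.
- exact: primalE.
- exact: primalN.
- by move=> z; exists (prox_primal (edom f) (edom g) F G Phi gamma z); exact: pp.
Qed.

(** The squared norm is 4 gamma^2 times the squared proximal displacement, that is 8 gamma times the
    lower bound in [prox_decrease_ge]. *)
Lemma grad_vector_decrease u : edom f u -> dot (grad_vector u) (grad_vector u) <=
  8 * gamma * prox_decrease (edom f) (edom g) F G Phi gamma u.
Proof.
move=> Cu; have := prox_decrease_ge SP C0 D0 Cu.
have g0 := sp_gamma SP => h.
have := ler_wpM2l (ltW g0) h; rewrite /grad_vector dotZl dotZr; lra.
Qed.

(** 6 = 2 (1 + 2), the inner 2 being the Lipschitz constant of the proximal map. It gives
    measurability of the gradient along the algorithm. *)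
Lemma grad_vector_lipschitz u v :
  enorm (grad_vector u - grad_vector v) <= 6 * gamma * enorm (u - v).
Proof.
have g0 := sp_gamma SP; have pp := prox_primalP SP C0 D0.
rewrite /grad_vector -scalerBr enormZ gtr0_norm ?mulr_gt0 //.
have h := moreau_point_lipschitz g0 (pp u) (pp v).
set a := prox_primal _ _ _ _ _ _ u in h *.
set b := prox_primal _ _ _ _ _ _ v in h *.
have -> : u - a - (v - b) = (u - v) + - (a - b).
  by apply/rowP => i; rewrite !mxE; ring.
have := enormD (u - v) (- (a - b)); rewrite enormN => h1.
have := ler_wpM2l (ltW g0) (le_trans h1 (lerD (lexx _) h)); lra.
Qed.

End instance.

(** * The algorithm as a recursion on its oracle answers *)

Section sapd_recurrence.
Context (R : realType) (n m : nat).
Context (f : 'rV[R]_n -> \bar R) (g : 'rV[R]_m -> \bar R) (gamma : R).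
Context (p : sapd_params R).
Hypotheses (th1 : theta p = 1) (mux : mu_x p = gamma).
Context (Om : Type) (Orc : sfo R n m Om) (x0 : 'rV[R]_n) (y0 : 'rV[R]_m).
Local Notation ix := (iter_x f g gamma p Orc x0 y0).
Local Notation iy := (iter_y f g gamma p Orc x0 y0).
Local Notation ax := (answer_x f g gamma p Orc x0 y0).
Local Notation ay := (answer_y f g gamma p Orc x0 y0).

Lemma iter_step t k w :
  iy t k.+1 w = prox (sigma p) g
    (iy t k w + sigma p *: (2 *: ay t k w - ay t k.-1 w)) /\
  ix t k.+1 w = prox (tau p) f
    (ix t k w - tau p *: (ax t k w + (gamma + gamma) *: (ix t k w - ix t 0 w))).
Proof.
pose st k := sapd_state f g gamma p (sapdp_start f g gamma p Orc x0 y0 t w).1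
  (sapdp_start f g gamma p Orc x0 y0 t w).2 (query_x Orc w t) (query_y Orc w t) k.
(* The stored momentum is the difference of consecutive answers, and is 0 at the start since 0.-1 =
   0. With [theta p = 1] this yields [2 *: ay - ay] of the previous index. *)
have stq j : (st j).2 = ay t j w - ay t j.-1 w.
  case: j => [|j]; first by rewrite subrr.
  rewrite /answer_y /iter_x /iter_y -/(st j.+1) -/(st j) /=.
  rewrite /st /= -/(st j); by case: (st j) => -[x y] q.
have e : st k.+1 =
    let: (x, y, q) := st k in
    let s := query_y Orc w t k x y + theta p *: q in
    let y' := prox (sigma p) g (y + sigma p *: s) in
    let x' := prox (tau p) f (x - tau p *: (query_x Orc w t k x y'
      + (mu_x p + gamma) *: (x - (sapdp_start f g gamma p Orc x0 y0 t w).1))) in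
    (x', y', query_y Orc w t k.+1 x' y' - query_y Orc w t k x y) by [].
have iyE : iy t k.+1 w = prox (sigma p) g
    (iy t k w + sigma p *: (2 *: ay t k w - ay t k.-1 w)).
  rewrite {1}/iter_y -/(st k.+1) e /iter_y -/(st k).
  have ayk : ay t k w = query_y Orc w t k (st k).1.1 (st k).1.2 by [].
  have := stq k; case: (st k) ayk => -[x y] q /= ayk ->.
  rewrite th1 scale1r -ayk; congr (prox _ _ (_ + _ *: _)).
  by rewrite addrA scaler_nat mulr2n.
split=> //.
have axk : ax t k w = query_x Orc w t k (st k).1.1 (iy t k.+1 w) by [].
have : iy t k.+1 w = (st k.+1).1.2 by [].
rewrite {1}/iter_x -/(st k.+1) e axk /iter_x -/(st k) -/(st 0%N) mux.
by case: (st k) => -[x y] q /= ->.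
Qed.

Lemma sapdp_startS t w : sapdp_start f g gamma p Orc x0 y0 t.+1 w =
  (ergodic_x (ix t ^~ w) (iters p), ergodic_y (iy t ^~ w) (iters p)).
Proof.
have -> : sapdp_start f g gamma p Orc x0 y0 t.+1 w =
    let: (x, y) := sapdp_start f g gamma p Orc x0 y0 t w in
    sapd_out f g gamma p x y (query_x Orc w t) (query_y Orc w t) by [].
rewrite /iter_x /iter_y /ergodic_x /ergodic_y.
by case: (sapdp_start f g gamma p Orc x0 y0 t w) => x y.
Qed.

End sapd_recurrence.

Section sapdp_mean.
Context (R : realType) (n m : nat).
Context (f : 'rV[R]_n -> \bar R) (g : 'rV[R]_m -> \bar R).
Context (Phi : 'rV[R]_n -> 'rV[R]_m -> R) (gamma mu Lxx Lxy Lyx Lyy : R).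
Hypothesis SA : structural_assumption f g Phi gamma mu.
Hypothesis SM : smoothness_assumption f g Phi Lxx Lxy Lyx Lyy.
Hypotheses (cf : compact (edom f)) (cg : compact (edom g)).
Context (d : measure_display) (Om : measurableType d) (P : probability Om R).
Context (Orc : sfo R n m Om) (x0 : 'rV[R]_n) (y0 : 'rV[R]_m).
Context (delta_x delta_y : R).
Hypothesis NA : noise_assumption f g Phi gamma P Orc gamma x0 y0 delta_x delta_y.
Hypotheses (x0f : edom f x0) (y0g : edom g y0).
Context (p : sapd_params R).
Hypotheses (tau0 : 0 < tau p) (sigma0 : 0 < sigma p).
Hypotheses (th1 : theta p = 1) (mux : mu_x p = gamma) (N0 : (0 < iters p)%N).
Hypotheses (tauE : tau p <= 1 / (Lyx + Lxx + 2 * gamma)) (tauE2 : tau p <= 1 / Lxy).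
Hypothesis sigmaE : sigma p <= 1 / (Lyx + 2 * Lyy).
Local Notation N := (iters p).
Local Notation ix := (iter_x f g gamma p Orc x0 y0).
Local Notation iy := (iter_y f g gamma p Orc x0 y0).
Local Notation ax := (answer_x f g gamma p Orc x0 y0).
Local Notation ay := (answer_y f g gamma p Orc x0 y0).
Local Notation Fx := (past_x f g gamma p Orc x0 y0).
Local Notation Fy := (past_y f g gamma p Orc x0 y0).
Local Notation F := (fun x => fine (f x)).
Local Notation G := (fun y => fine (g y)).

Let SP := assumptions_saddle_problem SA SM cf cg.
Let pf : proper_closed_convex f. Proof. by case: SA => -[]. Qed.
Let pg : proper_closed_convex g. Proof. by case: SA => -[]. Qed.
Let C0 := edom_nonempty pf.
Let D0 := edom_nonempty pg.

Let noise t k : (k < N)%N ->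
  [/\ cond_mean P (sigma_gen (Fx t k)) (ax t k)
        (fun w => grad_x Phi (ix t k w) (iy t k.+1 w)),
      cond_mean P (sigma_gen (Fy t k)) (ay t k)
        (fun w => grad_y Phi (ix t k w) (iy t k w)),
      cond_second_moment_le P (sigma_gen (Fx t k))
        (fun w => ax t k w - grad_x Phi (ix t k w) (iy t k.+1 w)) (delta_x ^+ 2) &
      cond_second_moment_le P (sigma_gen (Fy t k))
        (fun w => ay t k w - grad_y Phi (ix t k w) (iy t k w)) (delta_y ^+ 2)].
Proof.
by move=> kN; apply: NA => //; rewrite th1.
Qed.

(** Answers are measurable because the conditional means in the noise assumption include their
    integrability. *)
Lemma measurable_past_y t k : (k <= N)%N ->
  forall Y, Fy t k Y -> measurable_fun setT Y.
Proof.
move=> kN Y [s [j [b h]]].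
have jN : (j < N)%N.
  by case/orP: b => /andP[_ jk] //; exact: leq_trans jk kN.
have [hx hy _ _] := noise s jN.
case: h => -[i ->].
  by have [h _ _ _] := hx i; exact: (measurable_EFinP _ _).1 (measurable_int P h).
by have [h _ _ _] := hy i; exact: (measurable_EFinP _ _).1 (measurable_int P h).
Qed.

Lemma measurable_past_x t k : (k < N)%N ->
  forall Y, Fx t k Y -> measurable_fun setT Y.
Proof.
move=> kN Y [|[i ->]]; first exact: (measurable_past_y (ltnW kN)).
have [_ hy _ _] := noise t kN.
by have [h _ _ _] := hy i; exact: (measurable_EFinP _ _).1 (measurable_int P h).
Qed.

Lemma past_yx t k : Fy t k `<=` Fx t k.
Proof. by move=> Y; left. Qed.

Lemma past_xy t k : Fx t k `<=` Fy t k.+1.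
Proof.
move=> Y [[s [j [b h]]]|[i ->]].
  exists s, j; split=> //; case/orP: b => /andP[h1 h2]; apply/orP; [left|right].
    by rewrite h1 h2.
  by rewrite h1 ltnW.
by exists t, k; split; [rewrite /before eqxx ltnSn orbT|right; exists i].
Qed.

Lemma past_next t : Fy t N `<=` Fy t.+1 0%N.
Proof.
move=> Y [s [j [b h]]]; exists s, j; split=> //.
case/orP: b => /andP[h1 h2]; apply/orP; left; rewrite ?h2 andbT.
  exact: ltnW.
by rewrite ltnS leq_eqVlt h1.
Qed.

Lemma past_ax t k i : Fy t k.+1 (fun w => ax t k w 0 i).
Proof.
by exists t, k; split; [rewrite /before eqxx ltnSn orbT|left; exists i].
Qed.

Lemma past_ay t k i : Fx t k (fun w => ay t k w 0 i).
Proof. by right; exists i. Qed.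

Let iyS t k w := (iter_step f g th1 mux Orc x0 y0 t k w).1.
Let ixS t k w := (iter_step f g th1 mux Orc x0 y0 t k w).2.

Let pfP z : prox_point (edom f) F (tau p) z (prox (tau p) f z).
Proof. exact: proxP. Qed.

Let pgP z : prox_point (edom g) G (sigma p) z (prox (sigma p) g z).
Proof. exact: proxP. Qed.

Let pfP' t w k : prox_point (edom f) F (tau p)
  (ix t k w - tau p *: (ax t k w + (gamma + gamma) *: (ix t k w - ix t 0 w)))
  (ix t k.+1 w).
Proof. by rewrite ixS; exact: pfP. Qed.

Let pgP' t w k : prox_point (edom g) G (sigma p)
  (iy t k w + sigma p *: (2 *: ay t k w - ay t k.-1 w)) (iy t k.+1 w).
Proof. by rewrite iyS; exact: pgP. Qed.

Lemma start_dom t w : edom f (sapdp_start f g gamma p Orc x0 y0 t w).1 /\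
  edom g (sapdp_start f g gamma p Orc x0 y0 t w).2.
Proof.
elim: t => [//|t [Cx Dy]]; rewrite sapdp_startS; split.
  exact: (ergodic_xC SP (xs := ix t ^~ w) Cx (pfP' t w) N0).
exact: (ergodic_yD SP (ys := iy t ^~ w) Dy (pgP' t w) N0).
Qed.

Let ix0C t w : edom f (ix t 0 w). Proof. by case: (start_dom t w). Qed.
Let iy0D t w : edom g (iy t 0 w). Proof. by case: (start_dom t w). Qed.

(** Induction on the call: the next start averages iterates that are functions of answers received
    before the next call begins. *)
Lemma start_omeas t :
  omeas (Fy t 0%N) (ix t 0%N) /\ omeas (Fy t 0%N) (iy t 0%N).
Proof.
elim: t => [|t [mx my]]; first by split; exact: vmeas_cst.
have it k : (k <= N)%N -> omeas (Fy t k) (ix t k) /\ omeas (Fy t k) (iy t k).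
  exact: (omeas_iterates tau0 sigma0 pfP pgP (fun j _ => @past_yx t j)
    (fun j _ => @past_xy t j) mx my (iyS t) (ixS t)
    (fun j _ => past_ax t j) (fun j _ => past_ay t j)).
have itN k : (k < N)%N -> omeas (Fy t.+1 0%N) (ix t k.+1) /\
    omeas (Fy t.+1 0%N) (iy t k.+1).
  move=> kN; have [h1 h2] := it k.+1 kN.
  have sub : Fy t k.+1 `<=` Fy t.+1 0%N.
    move=> Y [s [j [b h]]]; apply: past_next; exists s, j; split=> //.
    case/orP: b => /andP[b1 b2]; apply/orP; [left|right]; rewrite b1 //=.
    exact: leq_trans b2 kN.
  by split; exact: omeas_subset sub _.
split.
  have -> : ix t.+1 0%N = fun w => ergodic_x (ix t ^~ w) N.
    by apply/funext => w; rewrite /iter_x /= -/(sapdp_start _ _ _ _ _ _ _ t.+1 w)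
      sapdp_startS.
  apply: vmeasZ.
  exact: (@vmeas_sum _ _ (observed (Fy t.+1 0%N)) n N (fun k => ix t k.+1)
    (fun k kN => (itN k kN).1)).
have -> : iy t.+1 0%N = fun w => ergodic_y (iy t ^~ w) N.
  by apply/funext => w; rewrite /iter_y /= -/(sapdp_start _ _ _ _ _ _ _ t.+1 w)
    sapdp_startS.
apply: vmeasZ.
  exact: (@vmeas_sum _ _ (observed (Fy t.+1 0%N)) m N (fun k => iy t k.+1)
    (fun k kN => (itN k kN).2)).
Qed.

Definition call_error t w := noise_error Phi (tau p) (sigma p)
  (ix t ^~ w) (ax t ^~ w) (iy t ^~ w) (ay t ^~ w) N.

Lemma call_error_mean t : mean_ub P (call_error t)
  (N%:R * (3 * (tau p * delta_x ^+ 2) + 21 * (sigma p * delta_y ^+ 2))).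
Proof.
have [BC BCP] := bounded_compact cf C0; have [BD BDP] := bounded_compact cg D0.
have [mx my] := start_omeas t.
apply: (call_noise_bound SP tau0 sigma0 tauE tauE2 sigmaE pfP pgP
  (@measurable_past_x t) (@measurable_past_y t) (fun j _ => @past_yx t j)
  (fun j _ => @past_xy t j) mx my (ix0C t) (iy0D t) (iyS t) (ixS t)
  (fun j _ => past_ax t j) (fun j _ => past_ay t j) _ _ _ _ BCP BDP N0).
- by move=> k kN; case: (noise t kN).
- by move=> k kN; case: (noise t kN).
- move=> k kN; have [_ _ h _] := noise t kN.
  exact: cond_second_moment_mean (measurable_past_x kN) h.
- move=> k kN; have [_ _ _ h] := noise t kN.
  exact: cond_second_moment_mean (measurable_past_y (ltnW kN)) h.
Qed.

Hypotheses (Ntau : 132 <= N%:R * (gamma * tau p))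
  (Nsigma : 264 <= N%:R * (mu * sigma p)).

Let z t w := (sapdp_start f g gamma p Orc x0 y0 t w).1.
Let y t w := (sapdp_start f g gamma p Orc x0 y0 t w).2.

Lemma pathwise_decrease (gap0 : R) w T :
  (forall x, edom f x -> primal_value (edom g) F G Phi x0
     - primal_value (edom g) F G Phi x <= gap0) ->
  prox_gap (edom f) (edom g) F G Phi gamma x0 y0 <= gap0 ->
  41 * \sum_(t < T) prox_decrease (edom f) (edom g) F G Phi gamma (z t w)
    <= 42 * gap0 + 44 * \sum_(t < T) call_error t w / N%:R.
Proof.
move=> h1 h2.
apply: (outer_loop SP C0 D0 (z := z ^~ w) (y := y ^~ w)
  (V := fun t => call_error t w / N%:R)) => //.
- by move=> t; case: (start_dom t w).
- by move=> t; case: (start_dom t w).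
move=> t; have [Cz Dy] := start_dom t w; have [Cz' Dy'] := start_dom t.+1 w.
apply: (call_gap_bound SP C0 D0 Cz Cz' Dy Dy' (tau := tau p)
  (sigma := sigma p)) => //; first by rewrite ltr0n.
move=> u v Cu Dv.
have := ergodic_gap SP tau0 sigma0 tauE sigmaE (ix0C t w) (iy0D t w) (pgP' t w)
  (pfP' t w) N0 Cu Dv.
by rewrite sapdp_startS.
Qed.

Let gv t w := grad_vector f g Phi gamma (z t w).

Lemma vmeas_grad_vector t : vmeas (gv t).
Proof.
have [mx _] := start_omeas t.
have g0 := sp_gamma SP.
apply: (@vmeas_lipschitz _ _ _ _ _ setT _ (6 * gamma)) => //.
- by rewrite mulr_ge0 // ltW.
- by move=> a b _ _; exact: grad_vector_lipschitz SA SM cf cg a b.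
- exact: omeas_vmeas (measurable_past_y (leq0n _)) mx.
Qed.

Lemma mean_stationarity (gap0 : R) T :
  (forall x, edom f x -> primal_value (edom g) F G Phi x0
     - primal_value (edom g) F G Phi x <= gap0) ->
  prox_gap (edom f) (edom g) F G Phi gamma x0 y0 <= gap0 ->
  mean_le P (fun w => \sum_(t < T) dot (gv t w) (gv t w))
    (8 * gamma / 41 * (42 * gap0 + 44 * (T%:R
      * (3 * (tau p * delta_x ^+ 2) + 21 * (sigma p * delta_y ^+ 2))))).
Proof.
move=> h1 h2; have g0 := sp_gamma SP.
have NR : 0 < N%:R :> R by rewrite ltr0n.
have hv t : mean_ub P (fun w => call_error t w / N%:R)
    (3 * (tau p * delta_x ^+ 2) + 21 * (sigma p * delta_y ^+ 2)).
  have N1 : 0 <= N%:R^-1 :> R by rewrite invr_ge0 ltW.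
  have := mean_ubZ N1 (call_error_mean t); rewrite mulKf ?gt_eqF //.
  by apply: mean_ub_dominated => w; rewrite mulrC.
have hs := mean_ub_sum (X := fun t w => call_error t w / N%:R) (N := T)
  (fun t _ => hv t).
have c0 : 0 <= 8 * gamma / 41 by rewrite divr_ge0 // mulr_ge0 // ltW.
have c1 : 0 <= 44 :> R by [].
have [Y XY Yc] := mean_ubZ c0 (mean_ubD (mean_ub_le (mean_le_cst P (42 * gap0)))
  (mean_ubZ c1 hs)).
(* [Y] is only an integrable majorant; measurability of the gradients makes their own expectation
   well defined and bounded. *)
apply: mean_le_dominated Yc.
- apply: measurable_sum => t; exact: measurable_dot (vmeas_grad_vector t)
    (vmeas_grad_vector t).
- by move=> w; apply: sumr_ge0 => t _; exact: dot_ge0.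
- move=> w; apply: le_trans (XY w).
  have h := pathwise_decrease w T h1 h2.
  have h3 : \sum_(t < T) dot (gv t w) (gv t w) <= 8 * gamma *
      \sum_(t < T) prox_decrease (edom f) (edom g) F G Phi gamma (z t w).
    rewrite mulr_sumr; apply: ler_sum => t _.
    by apply: (grad_vector_decrease SA SM cf cg); case: (start_dom t w).
  apply: le_trans h3 _.
  have g8 : 0 <= 8 * gamma / 41 by [].
  by have := ler_wpM2l g8 h; lra.
Qed.

End sapdp_mean.

(** * Parameters *)

(** Each nonnegative term is dominated by the integrable sum, so its expectation is finite and can
    be handled as a real number. *)
Lemma expectation_sum_le (R : realType) (d : measure_display)
    (Om : measurableType d) (P : probability Om R) (X : nat -> Om -> R)
    (M : nat) (c : R) :
  (forall t, measurable_fun setT (X t)) -> (forall t w, 0 <= X t w) ->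
  mean_le P (fun w => \sum_(t < M) X t w) c ->
  exists2 r : nat -> R, (forall t : 'I_M, 'E_P[X t] = (r t)%:E)%E &
    \sum_(t < M) r t <= c.
Proof.
move=> mX X0 [iS Sc].
have iX (t : 'I_M) : P.-integrable setT (EFin \o X t).
  have XS w : X t w <= \sum_(t < M) X t w.
    by rewrite (bigD1 t) //= lerDl sumr_ge0.
  by case: (mean_le_dominated (mX t) (X0 t) XS (conj iS Sc)).
exists (fun t => fine ('E_P[X t])%E).
  move=> t; rewrite fineK // unlock.
  exact: integrable_fin_num (iX t).
rewrite -lee_fin; apply: le_trans Sc.
rewrite -sumEFin le_eqVlt; apply/orP; left; apply/eqP.
under [RHS]eq_integral do rewrite -sumEFin.
rewrite (integral_sum measurableT iX); apply: eq_bigr => t _.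
by rewrite unlock fineK //; exact: integrable_fin_num (iX t).
Qed.

Lemma exists_le_average (R : realType) (T : nat) (r : nat -> R) (c : R) :
  \sum_(t < T.+1) r t <= T.+1%:R * c -> exists t : 'I_T.+1, r t <= c.
Proof.
move=> h.
have [t _ ht] := @arg_minP _ _ _ (ord0 : 'I_T.+1) xpredT (fun t => r t) isT.
exists t; rewrite -(ler_pM2l (_ : 0 < T.+1%:R)) ?ltr0n //.
apply: le_trans h; rewrite mulr_natl -[X in _ *+ X]card_ord -sumr_const.
by apply: ler_sum => s _; exact: ht.
Qed.

(** Common to both step sizes. The inverse of a minimum is at most the sum of the inverses; for
    [delta] = 0 the ratio is +oo and the minimum is [a]. *)
Lemma step_size (R : realType) (a c eps delta : R) : 0 < a -> 0 < c -> 0 < eps ->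
  let s := fine (Order.min a%:E (c%:E * noise_ratio eps delta))%E in
  [/\ 0 < s, s <= a, s * delta ^+ 2 <= c * eps ^+ 2 &
      s^-1 <= a^-1 + delta ^+ 2 / (c * eps ^+ 2)].
Proof.
move=> a0 c0 e0; rewrite /noise_ratio.
have ce0 : 0 < c * eps ^+ 2 by rewrite mulr_gt0 // exprn_gt0.
have [->|dn0] := eqVneq delta 0.
  rewrite gt0_muley ?lte_fin // min_l ?leey //= expr0n /= mulr0 mul0r addr0.
  by split => //; exact: ltW.
have d0 : 0 < delta ^+ 2 by rewrite lt_neqAle eq_sym sqrf_eq0 dn0 sqr_ge0.
rewrite -EFinM -EFin_min /=.
have b0 : 0 < c * (eps ^+ 2 / delta ^+ 2).
  by rewrite mulr_gt0 // divr_gt0 // exprn_gt0.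
have db : c * (eps ^+ 2 / delta ^+ 2) * delta ^+ 2 = c * eps ^+ 2.
  by rewrite -mulrA divfK // gt_eqF.
have bi : (c * (eps ^+ 2 / delta ^+ 2))^-1 = delta ^+ 2 / (c * eps ^+ 2).
  by field; rewrite dn0 !gt_eqF.
have [ab|ba] := leP a (c * (eps ^+ 2 / delta ^+ 2)); split => //.
- by rewrite -db ler_pM2r.
- by rewrite lerDl divr_ge0 // ltW.
- exact: ltW.
- by rewrite db.
- by rewrite bi lerDr invr_ge0 ltW.
Qed.

Section parameters.
Context (R : realType) (gamma mu Lxx Lxy Lyx Lyy delta_x delta_y eps : R).
Hypotheses (g0 : 0 < gamma) (m0 : 0 < mu) (Lxx0 : 0 <= Lxx) (Lyy0 : 0 <= Lyy).
Hypotheses (Lxy0 : 0 < Lxy) (Lyx0 : 0 < Lyx) (gL : gamma <= Lxx) (e0 : 0 < eps).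
Local Notation prm :=
  (sapdp_params gamma mu Lxx Lxy Lyx Lyy delta_x delta_y eps).

Lemma tau_bounds : [/\ 0 < tau prm, tau prm <= 1 / (Lyx + Lxx + 2 * gamma),
  tau prm <= 1 / Lxy, tau prm * delta_x ^+ 2 <= 1 / (480 * gamma) * eps ^+ 2 &
  (tau prm)^-1 <= Lyx + Lxx + 2 * gamma + Lxy
    + 480 * (gamma * delta_x ^+ 2 / eps ^+ 2)].
Proof.
have a1 : 0 < Lyx + Lxx + 2 * gamma by move: Lyx0 Lxx0 g0; lra.
have a0 : 0 < Num.min (1 / (Lyx + Lxx + 2 * gamma)) (1 / Lxy).
  by rewrite lt_min !divr_gt0.
have c0 : 0 < 1 / (480 * gamma) by rewrite div1r invr_gt0; move: g0; lra.
rewrite /sapdp_params /= minA -EFin_min.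
have [t0 ta tn ti] := step_size delta_x a0 c0 e0; split => //.
- by apply: le_trans ta _; rewrite ge_min lexx.
- by apply: le_trans ta _; rewrite ge_min lexx orbT.
apply: le_trans ti _; rewrite lerD //.
  rewrite /Order.min; case: ifP => _; rewrite div1r invrK.
    by rewrite lerDl ltW.
  by rewrite lerDr ltW.
rewrite le_eqVlt; apply/orP; left; apply/eqP; field.
by rewrite !gt_eqF.
Qed.

Lemma sigma_bounds : [/\ 0 < sigma prm, sigma prm <= 1 / (Lyx + 2 * Lyy),
  sigma prm * delta_y ^+ 2 <= 1 / (4512 * gamma) * eps ^+ 2 &
  (sigma prm)^-1 <= Lyx + 2 * Lyy + 4512 * (gamma * delta_y ^+ 2 / eps ^+ 2)].
Proof.
have a1 : 0 < Lyx + 2 * Lyy by move: Lyx0 Lyy0; lra.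
have a0 : 0 < 1 / (Lyx + 2 * Lyy) by rewrite divr_gt0.
have c0 : 0 < 1 / (4512 * gamma) by rewrite div1r invr_gt0; move: g0; lra.
rewrite /sapdp_params /=.
have [t0 ta tn ti] := step_size delta_y a0 c0 e0; split => //.
apply: le_trans ti _; rewrite div1r invrK lerD2l.
rewrite le_eqVlt; apply/orP; left; apply/eqP; field.
by rewrite !gt_eqF.
Qed.

Let t0 : 0 < tau prm. Proof. by case: tau_bounds. Qed.
Let s0 : 0 < sigma prm. Proof. by case: sigma_bounds. Qed.
Let m := Num.max (4 / (gamma * tau prm)) (8 / (mu * sigma prm)).

(** Since [gamma <= Lxx], the first bound on [tau] gives 3 gamma tau <= 1. In particular the 1 lost
    to the ceiling is at most [m], whence 34 for 33. *)
Let m_ge12 : 12 <= m.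
Proof.
rewrite le_max; apply/orP; left; rewrite ler_pdivlMr ?mulr_gt0 //.
have [_ + _ _ _] := tau_bounds.
rewrite ler_pdivlMr; last by move: Lyx0 Lxx0 g0; lra.
have := mulr_ge0 (ltW t0) Lxx0; have := mulr_ge0 (ltW t0) (ltW Lyx0).
have : tau prm * gamma <= tau prm * Lxx by rewrite ler_pM2l.
by rewrite (mulrC gamma); lra.
Qed.

Lemma iters_bounds : 33 * m <= (iters prm)%:R <= 34 * m.
Proof.
have -> : (iters prm)%:R = (Num.ceil (33 * m))%:~R :> R.
  rewrite /= -/m -[RHS]ger0_norm ?ler0z ?ceil_ge0; last by have := m_ge12; lra.
  by rewrite -intr_norm natr_absz.
rewrite ceil_ge /=; have := ltW (ceilB1_lt (33 * m)).
by rewrite intrB; have := m_ge12; lra.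
Qed.

Lemma iters_gt0 : (0 < iters prm)%N.
Proof.
have /andP[h _] := iters_bounds; rewrite -(ltr0n R).
by apply: lt_le_trans h; have := m_ge12; lra.
Qed.

Lemma iters_tau : 132 <= (iters prm)%:R * (gamma * tau prm).
Proof.
have gt : 0 < gamma * tau prm by rewrite mulr_gt0.
have /andP[h _] := iters_bounds.
have : 4 / (gamma * tau prm) <= m by rewrite le_max lexx.
rewrite ler_pdivrMr // => h1.
by have := ler_wpM2r (ltW gt) h; lra.
Qed.

Lemma iters_sigma : 264 <= (iters prm)%:R * (mu * sigma prm).
Proof.
have gt : 0 < mu * sigma prm by rewrite mulr_gt0.
have /andP[h _] := iters_bounds.
have : 8 / (mu * sigma prm) <= m by rewrite le_max lexx orbT.
rewrite ler_pdivrMr // => h1.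
by have := ler_wpM2r (ltW gt) h; lra.
Qed.

Lemma iters_complexity : (iters prm)%:R <= 34 * (40 * 1000) *
  (Num.max Lxx (Num.max Lyx Lxy) / gamma + Num.max Lyy Lyx / mu
   + (delta_x ^+ 2 / gamma + delta_y ^+ 2 / mu) * (gamma / eps ^+ 2)).
Proof.
set M1 := Num.max Lxx _; set M2 := Num.max Lyy _.
have [h1 h2 h3] : [/\ Lxx <= M1, Lyx <= M1 & Lxy <= M1].
  by rewrite !le_max !lexx !orbT.
have [h4 h5] : Lyy <= M2 /\ Lyx <= M2 by rewrite !le_max !lexx orbT.
have /andP[_ h] := iters_bounds; apply: le_trans h _.
(* The largest constant is 8 * 4512 = 36096, below 40 * 1000. *)
rewrite -mulrA ler_pM2l // ge_max; apply/andP.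
have ee : 0 < eps ^+ 2 by rewrite exprn_gt0.
set X := delta_x ^+ 2 / eps ^+ 2; set Y := delta_y ^+ 2 / mu * (gamma / eps ^+ 2).
have eX : (delta_x ^+ 2 / gamma + delta_y ^+ 2 / mu) * (gamma / eps ^+ 2) = X + Y.
  by rewrite /X /Y; field; rewrite !gt_eqF.
rewrite eX.
have X0 : 0 <= X by rewrite divr_ge0 ?sqr_ge0 // ltW.
have Y0 : 0 <= Y by rewrite mulr_ge0 // divr_ge0 ?sqr_ge0 // ltW.
have P1 : 0 <= M1 / gamma by rewrite divr_ge0 //; [move: Lxx0; lra|exact: ltW].
have P2 : 0 <= M2 / mu by rewrite divr_ge0 //; [move: Lyy0; lra|exact: ltW].
have [_ _ _ _ ht] := tau_bounds; have [_ _ _ hs] := sigma_bounds.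
split.
  have gi : 0 < gamma^-1 by rewrite invr_gt0.
  have := ler_wpM2l (ltW gi) ht.
  have -> : gamma^-1 * (Lyx + Lxx + 2 * gamma + Lxy
    + 480 * (gamma * delta_x ^+ 2 / eps ^+ 2)) =
    (Lyx + Lxx + 2 * gamma + Lxy) / gamma + 480 * X.
    by rewrite /X; field; rewrite !gt_eqF.
  have : (Lyx + Lxx + 2 * gamma + Lxy) / gamma <= 5 * M1 / gamma.
    by rewrite ler_pM2r //; move: gL; lra.
  by rewrite invfM; lra.
have mi : 0 < mu^-1 by rewrite invr_gt0.
have := ler_wpM2l (ltW mi) hs.
have -> : mu^-1 * (Lyx + 2 * Lyy + 4512 * (gamma * delta_y ^+ 2 / eps ^+ 2)) =
    (Lyx + 2 * Lyy) / mu + 4512 * Y.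
  by rewrite /Y; field; rewrite !gt_eqF.
have : (Lyx + 2 * Lyy) / mu <= 3 * M2 / mu by rewrite ler_pM2r //; lra.
by rewrite invfM; lra.
Qed.

End parameters.

(** * Stationarity and complexity *)

Section stationarity.
Context (R : realType) (n m : nat).
Context (f : 'rV[R]_n -> \bar R) (g : 'rV[R]_m -> \bar R).
Context (Phi : 'rV[R]_n -> 'rV[R]_m -> R).
Context (gamma mu Lxx Lxy Lyx Lyy delta_x delta_y : R).
Context (d : measure_display) (Om : measurableType d) (P : probability Om R).
Context (Orc : sfo R n m Om) (x0 : 'rV[R]_n) (y0 : 'rV[R]_m).
Hypothesis SA : structural_assumption f g Phi gamma mu.
Hypothesis SM : smoothness_assumption f g Phi Lxx Lxy Lyx Lyy.
Hypothesis gL : gamma <= Lxx.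
Hypothesis NA : noise_assumption f g Phi gamma P Orc gamma x0 y0 delta_x delta_y.
Hypotheses (cf : compact (edom f)) (cg : compact (edom g)).
Hypotheses (x0f : edom f x0) (y0g : edom g y0).
Context (eps : R).
Hypothesis e0 : 0 < eps.
Local Notation prm :=
  (sapdp_params gamma mu Lxx Lxy Lyx Lyy delta_x delta_y eps).
Let x t w := (sapdp_start f g gamma prm Orc x0 y0 t w).1.
Let stat t w := enorm (grad_moreau (1 / (2 * gamma)) (primal f g Phi) (x t w)).

Let g0 : 0 < gamma. Proof. by case: SA => _ [] . Qed.
Let m0 : 0 < mu. Proof. by case: SA => _ _ []. Qed.
Let Lxx0 : 0 <= Lxx. Proof. by case: SM => -[]. Qed.
Let Lyy0 : 0 <= Lyy. Proof. by case: SM => -[]. Qed.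
Let Lxy0 : 0 < Lxy. Proof. by case: SM => _ []. Qed.
Let Lyx0 : 0 < Lyx. Proof. by case: SM => _ []. Qed.

Let statE t w : stat t w = enorm (grad_vector f g Phi gamma (x t w)).
Proof. by rewrite /stat (grad_moreau_primal SA SM cf cg). Qed.

Lemma stationarity_measurable t : measurable_fun setT (stat t).
Proof.
have -> : stat t = fun w => enorm (grad_vector f g Phi gamma (x t w)).
  by apply/funext => w; exact: statE.
have [t0 _ _ _ _] := tau_bounds mu Lyy delta_x delta_y g0 Lxx0 Lxy0 Lyx0 e0.
have [s0 _ _ _] := sigma_bounds mu Lxx Lxy delta_x delta_y g0 Lyy0 Lyx0 e0.
have N0 := iters_gt0 mu Lyy delta_x delta_y g0 Lxx0 Lxy0 Lyx0 gL e0.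
have mv : vmeas (fun w => grad_vector f g Phi gamma (x t w)).
  exact: (vmeas_grad_vector SA SM cf cg NA t0 s0 erefl erefl N0).
have cn : lsc_on setT (fun v : 'rV[R]_n => enorm (v - 0)).
  by apply: lsc_on_continuous => v _; exact: continuous_enormB.
have := measurable_lsc mv (fun=> I) cn.
by apply: eq_measurable_fun => w _; rewrite subr0.
Qed.

Lemma stationarity_ge0 t w : 0 <= stat t w.
Proof. exact: enorm_ge0. Qed.

Context (gap0 : R).
Hypothesis gapP : gap f g Phi x0 y0 = gap0%:E.

Lemma gap_ge0 : 0 <= gap0.
Proof.
have [g1 [e h _]] := gapE SA SM cf cg x0f y0g.
by have := h x0 x0f; rewrite subrr; move: e; rewrite gapP => -[->].
Qed.

Lemma sum_stationarity T : 10 * (gamma * gap0) <= T.+1%:R * eps ^+ 2 ->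
  mean_le P (fun w => \sum_(t < T.+1) stat t w ^+ 2) (T.+1%:R * eps ^+ 2).
Proof.
move=> hT; have [g1 [e h1 h2]] := gapE SA SM cf cg x0f y0g.
move: e; rewrite gapP => -[e]; rewrite -e in h1 h2.
have [t0 ta tb td _] := tau_bounds mu Lyy delta_x delta_y g0 Lxx0 Lxy0 Lyx0 e0.
have [s0 sa sd _] := sigma_bounds mu Lxx Lxy delta_x delta_y g0 Lyy0 Lyx0 e0.
have N0 := iters_gt0 mu Lyy delta_x delta_y g0 Lxx0 Lxy0 Lyx0 gL e0.
have Nt := iters_tau mu Lyy delta_x delta_y g0 Lxx0 Lxy0 Lyx0 gL e0.
have Ns := iters_sigma delta_x delta_y g0 m0 Lxx0 Lyy0 Lxy0 Lyx0 gL e0.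
have := mean_stationarity SA SM cf cg NA x0f y0g t0 s0 erefl erefl N0 ta tb sa
  Nt Ns T.+1 h1 h2.
move=> hm; have {}hm : mean_le P (fun w => \sum_(t < T.+1) stat t w ^+ 2)
    (8 * gamma / 41 * (42 * gap0 + 44 * (T.+1%:R * (3 * (tau prm * delta_x ^+ 2)
      + 21 * (sigma prm * delta_y ^+ 2))))).
  apply: mean_le_eq hm => w; apply: eq_bigr => t _.
  by rewrite statE enorm_sqr.
apply: mean_leW hm.
(* 3/480 + 21/4512 is below 0.011. In the final sum the gap contributes less than 8.2/10 and the
   noise less than 0.095 of the allowed total. *)
have hv : gamma * (3 * (tau prm * delta_x ^+ 2) + 21 * (sigma prm * delta_y ^+ 2))
    <= 11 / 1000 * eps ^+ 2.
  have := ler_wpM2l (ltW g0) td; have := ler_wpM2l (ltW g0) sd.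
  have -> : gamma * (1 / (480 * gamma) * eps ^+ 2) = eps ^+ 2 / 480.
    by field; rewrite gt_eqF.
  have -> : gamma * (1 / (4512 * gamma) * eps ^+ 2) = eps ^+ 2 / 4512.
    by field; rewrite gt_eqF.
  have := sqr_ge0 eps; lra.
set v := 3 * _ + 21 * _ in hv *.
have := ler_wpM2l (ler0n R T.+1) hv; have := hT.
have := mulr_ge0 (ltW g0) gap_ge0.
move: hv; move: (T.+1%:R : R) (eps ^+ 2) v => M E v' _; lra.
Qed.

Lemma mean_square_stationarity T : 10 * (gamma * gap0) <= T.+1%:R * eps ^+ 2 ->
  ((T.+1%:R^-1)%:E * \sum_(t < T.+1) 'E_P[(fun w => stat t w ^+ 2)%R]
    <= (eps ^+ 2)%:E)%E.
Proof.
move=> hT; have [||r hr hs] := expectation_sum_le (X := fun t w => stat t w ^+ 2)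
  _ _ (sum_stationarity hT).
- by move=> t; apply: measurable_funX; exact: stationarity_measurable.
- by move=> t w; exact: sqr_ge0.
rewrite (eq_bigr _ (fun t _ => hr t)) sumEFin -EFinM lee_fin.
by rewrite ler_pdivrMl ?ltr0n.
Qed.

Lemma mean_stationarity_le T : 10 * (gamma * gap0) <= T.+1%:R * eps ^+ 2 ->
  ((T.+1%:R^-1)%:E * \sum_(t < T.+1) 'E_P[stat t] <= eps%:E)%E /\
  exists2 t : nat, (t <= T)%N & ('E_P[stat t] <= eps%:E)%E.
Proof.
move=> hT; have T0 : 0 < T.+1%:R :> R by rewrite ltr0n.
have hS : mean_le P (fun w => \sum_(t < T.+1) stat t w) (T.+1%:R * eps).
  have i0 : 0 <= (2 * eps)^-1 by rewrite invr_ge0 mulr_ge0 // ltW.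
  (* Pathwise, s <= s^2 / (2 eps) + eps / 2 passes from second to first moments. *)
  have h := mean_leD (mean_leZ i0 (sum_stationarity hT))
    (mean_le_cst P (T.+1%:R * (eps / 2))).
  have -> : T.+1%:R * eps = (2 * eps)^-1 * (T.+1%:R * eps ^+ 2)
      + T.+1%:R * (eps / 2).
    by field; rewrite gt_eqF.
  apply: mean_le_dominated h.
  - by apply: measurable_sum => t; exact: stationarity_measurable.
  - by move=> w; apply: sumr_ge0 => t _; exact: stationarity_ge0.
  move=> w; have -> : T.+1%:R * (eps / 2) = \sum_(t < T.+1) eps / 2.
    by rewrite sumr_const card_ord mulr_natl.
  rewrite mulr_sumr -big_split; apply: ler_sum => t _ /=.
  rewrite -(ler_pM2l (_ : 0 < 2 * eps)) ?mulr_gt0 // mulrDr mulrA divff ?mul1r.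
    by have := sqr_ge0 (stat t w - eps); lra.
  by rewrite gt_eqF // mulr_gt0.
have [||r hr hs] := expectation_sum_le (X := stat) _ _ hS.
- exact: stationarity_measurable.
- exact: stationarity_ge0.
split.
  rewrite (eq_bigr _ (fun t _ => hr t)) sumEFin -EFinM lee_fin.
  by rewrite ler_pdivrMl.
have [t ht] := exists_le_average hs.
by exists t; [rewrite -ltnS|rewrite hr lee_fin].
Qed.

Lemma oracle_complexity (K : nat) :
  3 * 10 * (34 * (40 * 1000)) <= K%:R :> R -> exists T : nat,
  [/\ ((oracle_calls (iters prm) T)%:R%:E <= K%:R%:E *
        ((Num.max Lxx (Num.max Lyx Lxy) / gamma + Num.max Lyy Lyx / mu)
             * gamma * eps ^- 2
           + (delta_x ^+ 2 / gamma + delta_y ^+ 2 / mu)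
             * gamma ^+ 2 * eps ^- 4)%:E
          * gap f g Phi x0 y0)%E,
      ((T.+1%:R^-1)%:E * \sum_(t < T.+1) 'E_P[stat t] <= eps%:E)%E &
      exists2 t : nat, (t <= T)%N & ('E_P[stat t] <= eps%:E)%E].
Proof.
move=> hK; have ee : 0 < eps ^+ 2 by rewrite exprn_gt0.
have G0 := gap_ge0; set q := 10 * (gamma * gap0) / eps ^+ 2.
have gG0 : 0 <= gamma * gap0 by rewrite mulr_ge0 // ltW.
have q0 : 0 <= q by apply: divr_ge0; [lra|exact: ltW].
(* Rounding down keeps the number of calls at most [q], hence proportional to the gap with no
   additive term. The initial point costs nothing, so [T] calls give T + 1 > [q] points to
   average. *)
exists (Num.truncn q).
have [h1 h2] : 10 * (gamma * gap0) <= (Num.truncn q).+1%:R * eps ^+ 2 /\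
    (Num.truncn q)%:R <= q.
  by rewrite -ler_pdivrMr // ltW ?truncnS_gt // truncn_le.
have [h3 h4] := mean_stationarity_le h1; split => //.
rewrite gapP -!EFinM lee_fin; set T := Num.truncn q in h2 *.
set N := iters prm.
have N1 : 1 <= N%:R :> R.
  by rewrite ler1n (iters_gt0 mu Lyy delta_x delta_y g0 Lxx0 Lxy0 Lyx0 gL e0).
have hN := iters_complexity delta_x delta_y g0 m0 Lxx0 Lyy0 Lxy0 Lyx0 gL e0.
rewrite -/N in hN; set A := _ / gamma + _ in hN *.
set B := delta_x ^+ 2 / gamma + _ in hN *.
have -> : A * gamma * eps ^- 2 + B * gamma ^+ 2 * eps ^- 4 =
    (A + B * (gamma / eps ^+ 2)) * (gamma / eps ^+ 2).
  by field; rewrite gt_eqF.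
set X := A + _ in hN *.
have X0 : 0 <= X.
  by move: hN N1; lra.
have -> : (oracle_calls N T)%:R = T%:R * (N%:R + N%:R + 1) :> R.
  by rewrite /oracle_calls natrM natrD -natr1 addrA.
have qE : q = 10 * (gamma / eps ^+ 2 * gap0) by rewrite /q; field; rewrite gt_eqF.
have hT : 0 <= T%:R :> R by rewrite ler0n.
have w0 : 0 <= gamma / eps ^+ 2 * gap0.
  by rewrite mulr_ge0 // divr_ge0 // ltW.
apply: (@le_trans _ _ (q * (3 * (34 * (40 * 1000) * X)))).
  have h5 : N%:R + N%:R + 1 <= 3 * (34 * (40 * 1000) * X) by move: hN N1; lra.
  by apply: ler_pM h2 h5 => //; lra.
rewrite qE; move: w0; set w := gamma / eps ^+ 2 * gap0 => w0.
have -> : K%:R * (X * (gamma / eps ^+ 2)) * gap0 = K%:R * (X * w).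
  by rewrite /w; ring.
have -> : 10 * w * (3 * (34 * (40 * 1000) * X)) =
    3 * 10 * (34 * (40 * 1000)) * (X * w) by ring.
by rewrite ler_wpM2r // mulr_ge0.
Qed.

End stationarity.

Theorem theorem1 :
  exists K : nat,
  forall (R : realType) (n m : nat)
    (f : 'rV[R]_n -> \bar R) (g : 'rV[R]_m -> \bar R)
    (Phi : 'rV[R]_n -> 'rV[R]_m -> R)
    (gamma mu_y Lxx Lxy Lyx Lyy delta_x delta_y : R)
    (d : measure_display) (Om : measurableType d) (P : probability Om R)
    (Orc : sfo R n m Om) (x0 : 'rV[R]_n) (y0 : 'rV[R]_m),
  structural_assumption f g Phi gamma mu_y ->
  smoothness_assumption f g Phi Lxx Lxy Lyx Lyy ->
  gamma <= Lxx ->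
  0 <= delta_x -> 0 <= delta_y ->
  noise_assumption f g Phi gamma P Orc gamma x0 y0 delta_x delta_y ->
  compact (edom f) -> compact (edom g) ->
  edom f x0 -> edom g y0 ->
  let prm eps :=
    sapdp_params gamma mu_y Lxx Lxy Lyx Lyy delta_x delta_y eps in
  let lambda := 1 / (2 * gamma) in
  let x eps t w := (sapdp_start f g gamma (prm eps) Orc x0 y0 t w).1 in
  let stat eps t w :=
    enorm (grad_moreau lambda (primal f g Phi) (x eps t w)) in
  (forall eps : R, 0 < eps -> forall T : nat,
    (96%:E * gap f g Phi x0 y0 * (gamma / eps ^+ 2)%:E + 1 <= T%:R%:E)%E ->
    ((T.+1%:R^-1)%:E * \sum_(t < T.+1) 'E_P[(fun w => stat eps t w ^+ 2)%R]
      <= (eps ^+ 2)%:E)%E)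
  /\
  (\forall eps \near (0 : R)^'+,
    exists T : nat,
    [/\ ((oracle_calls (iters (prm eps)) T)%:R%:E <=
          K%:R%:E *
          ((Num.max Lxx (Num.max Lyx Lxy) / gamma + Num.max Lyy Lyx / mu_y)
             * gamma * eps ^- 2
           + (delta_x ^+ 2 / gamma + delta_y ^+ 2 / mu_y)
             * gamma ^+ 2 * eps ^- 4)%:E
          * gap f g Phi x0 y0)%E,
        ((T.+1%:R^-1)%:E * \sum_(t < T.+1) 'E_P[stat eps t] <= eps%:E)%E &
        exists2 t : nat, (t <= T)%N & ('E_P[stat eps t] <= eps%:E)%E]).
Proof.
(* 3 covers the 2 N + 1 queries of one call, 10 the number of calls, and 34 * 40000 the bound on
   [N]. *)
exists (3 * (10 * (34 * (40 * 1000))))%N => R n m f g Phi gamma mu Lxx Lxy Lyx Lyy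
  dx dy d Om P Orc x0 y0 SA SM gL _ _ NA cf cg x0f y0g prm lambda x stat.
have [g0 [gapP _ _]] := gapE SA SM cf cg x0f y0g.
have gam0 : 0 < gamma by case: SA => _ [].
split.
  move=> eps e0 T; rewrite gapP => hT.
  apply: (mean_square_stationarity SA SM gL NA cf cg x0f y0g e0 gapP).
  have ee : 0 < eps ^+ 2 by rewrite exprn_gt0.
  have G0 := gap_ge0 SA SM cf cg x0f y0g gapP.
  move: hT; rewrite -!EFinM -EFinD lee_fin => hT.
  have w0 : 0 <= g0 * (gamma / eps ^+ 2) by rewrite mulr_ge0 // divr_ge0 ?ltW.
  (* It suffices that T + 1 is at least 10 gamma gap / eps^2, which the bound with 96 implies. *)
  rewrite -ler_pdivrMr //.
  have -> : 10 * (gamma * g0) / eps ^+ 2 = 10 * (g0 * (gamma / eps ^+ 2)).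
    by field; rewrite gt_eqF.
  rewrite -natr1; move: hT w0; rewrite -mulrA.
  by set w := g0 * _ => hT w0; lra.
near=> eps; have e0 : 0 < eps by near: eps; exact: nbhs_right_gt.
apply: (oracle_complexity SA SM gL NA cf cg x0f y0g e0 gapP).
by rewrite !natrM; lra.
Unshelve. all: by end_near. Qed.
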